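(* Let $k\ge 2$. Given $\varepsilon>0$ and $\alpha<\alpha_*(k)$, there exist $\delta'>0$ and an algorithm, running in time polynomial in $N$ (with the polynomial independent of $\varepsilon$), which on input $\beta\in\mathbb{R}$ and a $k$-SAT formula $F$ outputs a number $\Phi(\beta,F)$ such that the following holds: if $\beta\in[0,N^{\delta'}]$ and $F$ is a random $k$-SAT formula with $N$ variables and $M=N\alpha$ clauses, then with probability $1-o_N(1)$, $$\Phi(\beta,F)\,(1-\varepsilon)\le \log Z_N(\beta,F)\le \Phi(\beta,F)\,(1+\varepsilon).$$
   Context: A $k$-SAT formula on Boolean variables $x_1,\dots,x_N$ is a conjunction $F=\bigwedge_{j=1}^M C_j$ of clauses, each clause being a disjunction of $k$ literals, a literal being $x_i$ or its negation $\bar x_i$. An assignment $\underline{x}\in\{0,1\}^N$ satisfies a clause if at least one of its literals evaluates to true (true $=1$). $E(\underline{x})$ denotes the number of clauses of $F$ not satisfied by $\underline{x}$. For $\beta\ge 0$, the partition function is $Z_N(\beta,F)=\sum_{\underline{x}\in\{0,1\}^N} e^{-\beta E(\underline{x})}$. A random $k$-SAT formula with $N$ variables and $M=\alpha N$ clauses is obtained by choosing $M$ clauses independently and uniformly at random from all $2^k\binom{N}{k}$ possible $k$-clauses (clauses on $k$ distinct variables with each variable negated or not). Define $$\kappa(\alpha)=k(k-1)\alpha\left(1-\tfrac14 e^{-k\alpha/2}\right)\left(1-\tfrac12 e^{-k\alpha/2}\right)^{k-2},$$ and let $\alpha_*(k)$ be the smallest positive root of $\kappa(\alpha)=1$. 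*)

(* Defs.v *)
(* MathComp / MathComp-Analysis *)
From HB Require Import structures.
From mathcomp Require Import all_boot all_order all_algebra.
From mathcomp Require Import ring lra.
From mathcomp Require Import all_classical all_reals all_analysis.
Import Order.TTheory GRing.Theory Num.Theory.
Import numFieldNormedType.Exports.

Set Implicit Arguments.
Unset Strict Implicit.
Unset Printing Implicit Defensive.

Local Open Scope classical_set_scope.
Local Open Scope ring_scope.

(** * k-SAT *)

(* [(i, true)] is the literal x_i, [(i, false)] is its negation. *)
Definition literal (N : nat) : finType := ('I_N * bool)%type.

(* k literals on k distinct variables: there are 2 ^ k * 'C(N, k) of these. *)
Definition is_kclause (N k : nat) (c : {set literal N}) : bool :=
  (#|c| == k) && (#|[set l.1 | l in c]%SET| == k).

Definition kclause (N k : nat) : finType :=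
  {c : {set literal N} | is_kclause k c}.

(* Clauses are indexed, hence may be repeated. *)
Definition kformula (N M k : nat) : finType := {ffun 'I_M -> kclause N k}.

Definition assignment (N : nat) : finType := {ffun 'I_N -> bool}.

Definition satisfies (N k : nat) (x : assignment N) (c : kclause N k) : bool :=
  [exists l in val c, x l.1 == l.2].

Definition energy (N M k : nat) (F : kformula N M k) (x : assignment N) : nat :=
  #|[set j | ~~ satisfies x (F j)]%SET|.

Definition partition_function (R : realType) (N M k : nat) (beta : R)
    (F : kformula N M k) : R :=
  \sum_(x : assignment N) expR (- beta * (energy F x)%:R).

(* Probability of [A] when the M clauses are independent and uniform. *)
Definition prob_kSAT (R : realType) (N M k : nat) (A : pred (kformula N M k)) : R :=
  \sum_(F : kformula N M k | A F) \prod_(j < M) (#|kclause N k|%:R)^-1.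

(** * The threshold *)

Definition kappa (R : realType) (k : nat) (a : R) : R :=
  k%:R * (k%:R - 1) * a * (1 - 4^-1 * expR (- (k%:R * a / 2)))
    * (1 - 2^-1 * expR (- (k%:R * a / 2))) ^+ (k - 2).

Definition is_alpha_star (R : realType) (k : nat) (a : R) : Prop :=
  [/\ 0 < a, kappa k a = 1 & forall b : R, 0 < b -> kappa k b = 1 -> a <= b].

Lemma continuous_kappa (R : realType) (k : nat) : continuous (@kappa R k).
Proof.
move=> x.
have cexp : {for x, continuous (fun a : R => expR (- (k%:R * a / 2)))}.
  apply: (@continuous_comp _ _ _ (fun a : R => - (k%:R * a / 2)) expR).
    by apply: cvgN; apply: cvgMr_tmp; apply: cvgMl_tmp; exact: cvg_id.
  exact: continuous_expR.
have caff (c : R) :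
    {for x, continuous (fun a : R => 1 - c * expR (- (k%:R * a / 2)))}.
  by apply: cvgB; [exact: cvg_cst | apply: cvgMl_tmp; exact: cexp].
apply: cvgM; last first.
  apply: (@continuous_comp _ _ _ (fun a : R => 1 - 2^-1 * expR (- (k%:R * a / 2)))
            (fun y => y ^+ (k - 2))); first exact: caff.
  exact: exprn_continuous.
by apply: cvgM; [apply: cvgMl_tmp; exact: cvg_id | exact: caff].
Qed.

Lemma is_alpha_star_exists (R : realType) (k : nat) :
  (2 <= k)%N -> exists a : R, is_alpha_star k a.
Proof.
move=> k2.
have cK := @continuous_kappa R k.
have K0 : kappa k (0 : R) = 0 by rewrite /kappa mulr0 !mul0r.
pose u : R := 2 ^+ k.
have u0 : 0 < u by rewrite exprn_gt0.
have Ku : 1 <= kappa k u.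
  have e1 : expR (- (k%:R * u / 2)) <= 1.
    by rewrite -[leRHS]expR0 ler_expR oppr_le0 !mulr_ge0// ltW.
  have h1 : 2^-1 <= 1 - 4^-1 * expR (- (k%:R * u / 2)) by lra.
  have h2 : 2^-1 <= 1 - 2^-1 * expR (- (k%:R * u / 2)) by lra.
  have h3 : (2^-1) ^+ (k - 2) <=
      (1 - 2^-1 * expR (- (k%:R * u / 2))) ^+ (k - 2).
    by apply: lerXn2r => //; rewrite nnegrE ?(le_trans _ h2)// invr_ge0.
  have hk : 2 <= k%:R :> R by rewrite ler_nat.
  have h4 : 2 <= k%:R * (k%:R - 1) :> R by nra.
  have -> : 1 = 1 * u * 2^-1 * (2^-1) ^+ (k - 2) * 2^-1 :> R.
    rewrite /u -{1}(subnK k2) exprD exprVn; field.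
    by rewrite expf_neq0// pnatr_eq0.
  rewrite /kappa.
  set e := expR _ in h1 h2 h3 e1 *.
  have p0 : 0 <= (2^-1 : R) ^+ (k - 2) by rewrite exprn_ge0// invr_ge0.
  apply: (@le_trans _ _ (1 * u * 2^-1 * 2^-1 ^+ (k - 2))).
    rewrite ger_pMr; last by rewrite !mulr_gt0 ?invr_gt0 ?exprn_gt0 ?invr_gt0.
    lra.
  apply: ler_pM => //; first by rewrite !mulr_ge0 ?invr_ge0 ?ltW.
  apply: ler_pM => //; first by rewrite mul1r ltW.
  by apply: ler_wpM2r; [exact: ltW | lra].
have [c cI Kc] : exists2 c, c \in `[0, u] & kappa k c = 1.
  apply: IVT; [exact: ltW | exact: continuous_subspaceT |].
  by rewrite K0 ge_min ler01/= le_max Ku orbT.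
pose A : set R := `[0, u]%classic `&` (@kappa R k) @^-1` [set 1].
have Ac : A c by [].
have cA : compact A.
  apply: (@subclosed_compact _ _ `[0, u]%classic) => //.
  - apply: closedI; first exact: interval_closed.
    apply: preimage_closed => [x _|]; first exact: cK.
    exact/accessible_closed_set1/hausdorff_accessible/norm_hausdorff.
  - exact: segment_compact.
  - by move=> x [].
have [a /set_mem[/= aI Ka] amin] :=
  @compact_EVT_min _ R id A (ex_intro _ c Ac) cA (continuous_subspaceT (fun=> cvg_id)).
exists a; split => //.
  move: aI; rewrite in_itv/= => /andP[a0 _].
  rewrite lt_neqAle a0 andbT; apply/eqP => az.
  by move: Ka; rewrite -az K0 => /eqP; rewrite eq_sym oner_eq0.
move=> b b0 Kb; have [bu|/ltW ub] := leP b u.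
  by apply: amin; apply/mem_set; split => //=; rewrite in_itv/= bu ltW.
by apply: le_trans ub; move: aI; rewrite in_itv/= => /andP[].
Qed.

(** * Algorithms *)

(* A random access machine in the style of Cook and Reckhow: integer registers
   X_a, addition and subtraction but no multiplication, indirect addressing.
   With this instruction set the number of executed instructions is
   polynomially related to the running time of a Turing machine, since t
   instructions produce integers of bit size at most t plus a constant plus the
   bit size of the input.

   The real input beta cannot be stored in a register; it is accessed
   through its Dedekind cut, that is, through comparisons of beta with
   rationals p / q whose numerator and denominator have been computed by the
   machine (instruction [Query]). *)
Inductive instr : Type :=
| Const of int & int         (* Const a c     : X_a := c *)
| Add of int & int & int     (* Add a b c     : X_a := X_b + X_c *)
| Sub of int & int & int     (* Sub a b c     : X_a := X_b - X_c *)
| Fetch of int & int         (* Fetch a b     : X_a := X_(X_b) *)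
| Store of int & int         (* Store a b     : X_(X_a) := X_b *)
| JumpPos of int & nat       (* JumpPos a l   : if X_a > 0 goto l *)
| Query of int & int & nat.  (* Query a b l   : if X_a <= X_b * beta goto l *)

Definition program : Type := seq instr.

Definition memory : Type := int -> int.

(* program counter and memory *)
Definition config : Type := (nat * memory)%type.

Definition upd (m : memory) (a v : int) : memory :=
  fun b => if b == a then v else m b.

Definition exec (R : realType) (beta : R) (i : instr) (s : config) : config :=
  let: (pc, m) := s in
  match i with
  | Const a c => (pc.+1, upd m a c)
  | Add a b c => (pc.+1, upd m a (m b + m c))
  | Sub a b c => (pc.+1, upd m a (m b - m c))
  | Fetch a b => (pc.+1, upd m a (m (m b)))
  | Store a b => (pc.+1, upd m (m a) (m b))
  | JumpPos a l => (if 0 < m a then l else pc.+1, m)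
  | Query a b l => (if (m a)%:~R <= (m b)%:~R * beta then l else pc.+1, m)
  end.

(* The machine halts when the program counter leaves the program. *)
Definition halted (P : program) (s : config) : bool := (size P <= s.1)%N.

Definition step (R : realType) (P : program) (beta : R) (s : config) : config :=
  if onth P s.1 is Some i then exec beta i s else s.

(* The input (N, M, F) is stored in the registers X_0, X_1, X_2, ... as
   N, M, and the k literals of each of the M clauses, where the i-th variable
   (i >= 1) is encoded by i and its negation by - i; other registers are 0. *)
Definition encode_literal (N : nat) (l : literal N) : int :=
  if l.2 then (l.1.+1)%:Z else - (l.1.+1)%:Z.

Definition encode (N M k : nat) (F : kformula N M k) : seq int :=
  [:: N%:Z, M%:Z &
    flatten [seq [seq encode_literal l | l <- enum (val (F j))] | j <- enum 'I_M]].

Definition init (N M k : nat) (F : kformula N M k) : config :=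
  (0%N, fun a => if a is Posz n then nth 0 (encode F) n else 0).

(* The output is the rational number X_0 / X_1. *)
Definition output (R : realType) (s : config) : R := (s.2 0)%:~R / (s.2 1)%:~R.

(* On input (beta, F), [P] halts after at most [t] instructions with output [v]. *)
Definition computes_within (R : realType) (P : program) (N M k : nat) (beta : R)
    (F : kformula N M k) (v : R) (t : nat) : Prop :=
  let s := iter t (step P beta) (init F) in
  halted P s /\ output R s = v.

(* Main.v *)
(** For alpha <= 1 the mean of log Z is approximated by N times a function of
    beta alone, so that the algorithm only has to locate beta in a finite table;
    and the threshold is at most 1, since kappa(1) >= 1.

    At fixed beta, (E log Z) / N converges by the Franz-Leone interpolation:
    expanding the logarithm, a clause whose literals lie in a common random block
    of variables costs at least as much as a uniform clause, because t ^ k is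
    convex in the overlaps t of the replicas. Hence E log Z is almost
    superadditive.

    Uniformity in beta follows from an estimate E log Z(B) - E log Z(beta) <=
    C (N e^(- theta B) + beta) for B <= beta. Exchanging one clause at a time
    reduces it to the cost of imposing a random unit clause, which is bounded
    by eliminating variables: making a literal true creates new unit clauses,
    and moment by moment (again via replicas) their cost is at most that of
    uniform unit clauses created at the rate of a subcritical branching process
    when alpha < 1.

    Isolated variables give log Z a lower bound linear in N as long as
    beta ^ 4 <= N, so that additive errors o(N) are multiplicative, and log Z
    concentrates by the bounded differences of its clauses and Chebyshev's
    inequality. *)
From HB Require Import structures.
From mathcomp Require Import all_boot all_order all_algebra.
From mathcomp Require Import ring lra.
From mathcomp Require Import all_classical all_reals all_analysis.
Require Import Defs.
Import Order.TTheory GRing.Theory Num.Theory.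
Import numFieldNormedType.Exports.

Set Implicit Arguments.
Unset Strict Implicit.
Unset Printing Implicit Defensive.

Local Open Scope classical_set_scope.
Local Open Scope ring_scope.

(** * Product laws *)

(** Replica moments compare only functions whose power series has nonnegative coefficients. In the
    elimination every cost is therefore brought to the form [ln (1 + r / (1 - s * u))], with [u] the
    Gibbs probability that a clause is violated. Here [r] must not depend on that clause, so
    eliminating a variable deletes its clauses from the numerator partition function.

    The number j of pending unit clauses is weighted by e^(t j), which contracts as long as fewer
    than one unit clause is created per eliminated variable. The ratio before a step is at most
    twice the ratio after it, so the parameter [a] in e^-a drops by 1; the contraction must pay for
    this as well, which governs [theta]. Since M / n grows as variables disappear, elimination stops
    at a positive fraction of N. There only the crude bound by beta j is left, damped exponentially
    by the steps already made.

    The limits stored in the table are only known to exist: they are rounded to rationals and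
    written into the program, and N is required to exceed the program length, so that the time bound
    does not see the table. *)

Section Expectation.
Variable R : realType.

(** A law is used only through its integral. Positivity, linearity and exchange of integrals
    suffice, and hybrid laws such as mixtures need no sample space of their own. *)
Definition op (T : Type) := (T -> R) -> R.

Definition positive_linear T (A : op T) : Prop :=
  [/\ forall f g, A (fun x => f x + g x) = A f + A g,
      forall c f, A (fun x => c * f x) = c * A f &
      forall f g, (forall x, f x <= g x) -> A f <= A g].

Definition expectation T (A : op T) : Prop :=
  positive_linear A /\ A (fun=> 1) = 1.

Definition swaps T U (A : op T) (B : op U) : Prop :=
  forall f : T -> U -> R, A (fun x => B (f x)) = B (fun y => A (f ^~ y)).

(* The head of the list is the innermost variable. *)
Fixpoint prodE T (As : seq (op T)) (phi : seq T -> R) : R :=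
  if As is A :: l then prodE l (fun F => A (fun c => phi (c :: F)))
  else phi [::].

Definition avg (T : finType) : op T := fun f => #|T|%:R^-1 * \sum_x f x.

Section PositiveLinear.
Variables (T : Type) (A : op T).
Hypothesis hA : positive_linear A.

Lemma plD f g : A (fun x => f x + g x) = A f + A g. Proof. by case: hA. Qed.
Lemma plZ c f : A (fun x => c * f x) = c * A f. Proof. by case: hA. Qed.
Lemma pl_le f g : (forall x, f x <= g x) -> A f <= A g.
Proof. by case: hA => _ _; apply. Qed.

Lemma pl0 : A (fun=> 0) = 0.
Proof.
rewrite -[RHS](mul0r (A (fun=> 0))) -plZ.
by congr A; apply/funext => x; rewrite mul0r.
Qed.

Lemma plB f g : A (fun x => f x - g x) = A f - A g.
Proof.
have -> : (fun x => f x - g x) = (fun x => f x + (-1) * g x).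
  by apply/funext => x; rewrite mulN1r.
by rewrite plD plZ mulN1r.
Qed.

Lemma plZr c f : A (fun x => f x * c) = A f * c.
Proof. by rewrite mulrC -plZ; congr A; apply/funext => x; rewrite mulrC. Qed.

Lemma pl_cst c : A (fun=> c) = c * A (fun=> 1).
Proof. by rewrite -plZ; congr A; apply/funext => x; rewrite mulr1. Qed.

Lemma pl_ge0 f : (forall x, 0 <= f x) -> 0 <= A f.
Proof. by move=> f0; rewrite -pl0; exact: pl_le. Qed.

Lemma pl_sum (I : Type) (r : seq I) (P : pred I) (f : I -> T -> R) :
  A (fun x => \sum_(i <- r | P i) f i x) = \sum_(i <- r | P i) A (f i).
Proof.
elim: r => [|i r IH].
  by rewrite big_nil -[RHS]pl0; congr A; apply/funext => x; rewrite big_nil.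
rewrite big_cons -IH; case: ifP => Pi.
  by rewrite -plD; congr A; apply/funext => x; rewrite big_cons Pi.
by congr A; apply/funext => x; rewrite big_cons Pi.
Qed.

End PositiveLinear.

Section ExpectationTheory.
Variables (T : Type) (A : op T).
Hypothesis hA : expectation A.

Let pA : positive_linear A := hA.1.

Lemma expect_cst c : A (fun=> c) = c.
Proof. by rewrite (pl_cst pA) hA.2 mulr1. Qed.

Lemma expectDr f c : A (fun x => f x + c) = A f + c.
Proof. by rewrite (plD pA) expect_cst. Qed.

Lemma expect_le_cst f c : (forall x, f x <= c) -> A f <= c.
Proof. by move=> h; rewrite -[leRHS]expect_cst; exact: (pl_le pA). Qed.

Lemma expect_ge_cst f c : (forall x, c <= f x) -> c <= A f.
Proof. by move=> h; rewrite -[leLHS]expect_cst; exact: (pl_le pA). Qed.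

End ExpectationTheory.

Section ProductLaw.
Variable T : Type.
Implicit Types (As : seq (op T)) (A : op T).

Fixpoint all_prop (P : op T -> Prop) As : Prop :=
  if As is A :: l then P A /\ all_prop P l else True.

Lemma all_prop_nseq (P : op T -> Prop) A n : P A -> all_prop P (nseq n A).
Proof. by move=> PA; elim: n => //= n IH. Qed.

Lemma all_prop_map (P : op T -> Prop) (I : Type) (f : I -> op T) r :
  (forall i, P (f i)) -> all_prop P (map f r).
Proof. by move=> Pf; elim: r => //= i r IH; split. Qed.

Lemma prodE_positive_linear As :
  all_prop (@positive_linear T) As -> positive_linear (prodE As).
Proof.
elim: As => [|A As IH] //= [[AD AZ AL] /IH [D Z L]]; split.
- move=> f g; rewrite -D; congr prodE; apply/funext => F; exact: AD.
- move=> c f; rewrite -Z; congr prodE; apply/funext => F; exact: AZ.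
- by move=> f g fg; apply: L => F; apply: AL => x.
Qed.

Lemma prodE_expectation As : all_prop (@expectation T) As -> expectation (prodE As).
Proof.
move=> eAs; split.
  by apply: prodE_positive_linear; elim: As eAs => //= A As IH [[? _] /IH].
by elim: As eAs => //= A As IH [[_ ->] /IH].
Qed.

Lemma prodE_swaps U As (B : op U) :
  all_prop (fun A => swaps A B) As -> swaps (prodE As) B.
Proof.
elim: As => [|A As IH] //= [sA /IH sAs] f.
by rewrite -sAs; congr prodE; apply/funext => F; exact: sA.
Qed.

Lemma prodE_cat As Bs phi :
  prodE (As ++ Bs) phi = prodE Bs (fun G => prodE As (fun F => phi (F ++ G))).
Proof. by elim: As phi => [|A As IH] phi //=; rewrite IH. Qed.

Lemma prodE_prod As (g : T -> R) : all_prop (@positive_linear T) As ->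
  prodE As (fun F => \prod_(c <- F) g c) = \prod_(A <- As) A g.
Proof.
elim: As => [|A As IH] /=; first by rewrite !big_nil.
case=> pA pAs; rewrite big_cons -(IH pAs) -(plZ (prodE_positive_linear pAs)).
congr prodE; apply/funext => F; rewrite -(plZr pA).
by congr A; apply/funext=> c; rewrite big_cons.
Qed.

End ProductLaw.

Lemma avg_expectation (T : finType) : (0 < #|T|)%N -> expectation (@avg T).
Proof.
move=> T0; have N0 : (#|T|%:R : R) != 0 by rewrite pnatr_eq0 -lt0n.
split; first split.
- by move=> f g; rewrite /avg big_split mulrDr.
- by move=> c f; rewrite /avg -mulr_sumr mulrCA.
- move=> f g fg; rewrite /avg ler_wpM2l ?invr_ge0//.
  by apply: ler_sum => x _.
- by rewrite /avg sumr_const -mulr_natl mulr1 mulVf.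
Qed.

Lemma avg_swaps (T : finType) U (B : op U) : positive_linear B -> swaps (@avg T) B.
Proof.
by move=> pB f; rewrite /avg (plZ pB) (pl_sum pB).
Qed.

End Expectation.

(** * Power series of the logarithm and comparison by moments *)

Section LogSeries.
Variable R : realType.
Implicit Types s y u : R.

Lemma geo_sum_lt1 n y : y != 1 -> \sum_(i < n) y ^+ i = (1 - y ^+ n) / (1 - y).
Proof.
move=> y1; have y1' : 1 - y != 0 by rewrite subr_eq0 eq_sym.
by apply: (mulIf y1'); rewrite divfK// -opprB -[in RHS]opprB subrX1 mulrC mulNr.
Qed.

Lemma is_derive_ln_series n (x : R) : x < 1 ->
  is_derive x (1 : R) (fun z : R => - ln (1 - z) - \sum_(i < n) z ^+ i.+1 / i.+1%:R)
    (x ^+ n / (1 - x)).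
Proof.
move=> x1; have x1' : 0 < 1 - x by rewrite subr_gt0.
have dln : is_derive x (1 : R) (fun z : R => ln (1 - z)) (- (1 - x)^-1).
  have h1 : is_derive x (1 : R) (fun z : R => 1 - z) (-1).
    by apply: is_derive_eq; rewrite add0r mul1r.
  have := @is_derive1_comp _ (@ln R) (fun z : R => 1 - z) x _ _ (is_derive1_ln x1') h1.
  by rewrite mulrN1.
have dsum : is_derive x (1 : R) (fun z : R => \sum_(i < n) z ^+ i.+1 / i.+1%:R)
    (\sum_(i < n) x ^+ i).
  have -> : (fun z : R => \sum_(i < n) z ^+ i.+1 / i.+1%:R) =
     \sum_(i < n) (i.+1%:R^-1 \*: (fun z : R => z ^+ i.+1)).
    by apply/funext => z; rewrite fct_sumE; apply: eq_bigr => i _; rewrite mulrC.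
  apply: is_derive_sum => i.
  have -> : (fun z : R => z ^+ i.+1) = (id : R -> R) ^+ i.+1.
    by apply/funext => z; rewrite exprfctE.
  apply: is_derive_eq.
  by rewrite /GRing.scale/= mulr1 -mulr_natl mulrA mulVf ?pnatr_eq0 ?mul1r.
have := is_deriveB (is_deriveN dln) dsum.
move/is_derive_eq; apply.
rewrite opprK geo_sum_lt1 ?lt_eqF//.
by field; rewrite gt_eqF.
Qed.

(** The remainder vanishes at 0 and has derivative x^n / (1 - x), so the mean value theorem bounds
    it uniformly on [0, s]. *)
Lemma ln_series_remainder n s y : 0 <= y -> y <= s -> s < 1 ->
  0 <= - ln (1 - y) - \sum_(i < n) y ^+ i.+1 / i.+1%:R <= s ^+ n / (1 - s).
Proof.
move=> y0 ys s1.
pose D (x : R) := - ln (1 - x) - \sum_(i < n) x ^+ i.+1 / i.+1%:R.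
have D0 : D 0 = 0.
  rewrite /D subr0 ln1 oppr0 add0r big1 ?oppr0// => i _.
  by rewrite expr0n mul0r.
have [x||c] := @MVT_segment R D (fun x => x ^+ n / (1 - x)) 0 y y0.
- rewrite in_itv/= => /andP[_ xy]; apply: is_derive_ln_series.
  by rewrite (lt_trans xy)// (le_lt_trans ys).
- apply: derivable_within_continuous => x; rewrite in_itv/= => /andP[_ xy].
  have [] // := @is_derive_ln_series n x _.
  by rewrite (le_lt_trans xy)// (le_lt_trans ys).
rewrite in_itv/= D0 subr0 => /andP[c0 cy]; rewrite /D subr0 => ->.
have cs : c <= s by exact: le_trans ys.
have c1 : 0 < 1 - c by rewrite subr_gt0 (le_lt_trans cs).
have s1' : 0 < 1 - s by rewrite subr_gt0.
rewrite mulr_ge0 ?divr_ge0 ?exprn_ge0 ?(ltW c1)//=.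
rewrite -[leRHS]mulr1; apply: ler_pM; rewrite ?divr_ge0 ?exprn_ge0 ?(ltW c1)//.
  apply: ler_pM; rewrite ?exprn_ge0 ?invr_ge0 ?(ltW c1)//.
    by rewrite lerXn2r ?nnegrE// (le_trans c0).
  by rewrite lef_pV2 ?posrE// lerD2l lerN2.
by rewrite ltW// (le_lt_trans ys).
Qed.

(* Finite positive measures on [0, 1], seen as functionals. *)
Definition unit_functional (L : op R R) : Prop :=
  [/\ forall f g, L (fun x => f x + g x) = L f + L g,
      forall c f, L (fun x => c * f x) = c * L f &
      forall f g, (forall x, 0 <= x <= 1 -> f x <= g x) -> L f <= L g].

Lemma unit_positive_linear L : unit_functional L -> positive_linear L.
Proof. by case=> LD LZ Lle; split => // f g fg; apply: Lle. Qed.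

(* [u |-> ln (1 - s' u) - ln (1 - s u)] is a power series with nonnegative
   coefficients [(s ^+ m - s' ^+ m) / m]. *)
Lemma moment_domination (L1 L2 : op R R) (C s' s : R) :
  unit_functional L1 -> unit_functional L2 ->
  (forall m, L1 (fun u => u ^+ m) <= L2 (fun u => u ^+ m)) ->
  0 <= C -> 0 <= s' -> s' <= s -> s < 1 ->
  L1 (fun u => C + ln (1 - s' * u) - ln (1 - s * u)) <=
  L2 (fun u => C + ln (1 - s' * u) - ln (1 - s * u)).
Proof.
move=> u1 u2 mom C0 s'0 s's s1.
set h := fun u => _.
have p1 := unit_positive_linear u1; have p2 := unit_positive_linear u2.
have s0 : 0 <= s by exact: le_trans s's.
pose P n u := C + \sum_(i < n) (s ^+ i.+1 - s' ^+ i.+1) / i.+1%:R * u ^+ i.+1.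
have PL n : L1 (P n) <= L2 (P n).
  rewrite /P (plD p1) (plD p2) (pl_sum p1) (pl_sum p2); apply: lerD.
    rewrite (pl_cst p1) (pl_cst p2); apply: ler_wpM2l => //.
    have := mom 0%N; congr (L1 _ <= L2 _); apply/funext => u; exact: expr0.
  apply: ler_sum => i _; rewrite (plZ p1) (plZ p2); apply: ler_wpM2l => //.
  by rewrite divr_ge0// subr_ge0 lerXn2r ?nnegrE.
have hP n u : 0 <= u <= 1 -> `|h u - P n u| <= s ^+ n / (1 - s).
  move=> /andP[u0 v1].
  have su : s * u <= s by rewrite ler_piMr.
  have s'u : s' * u <= s by rewrite (le_trans _ su)// ler_wpM2r.
  have /andP[a1 a2] := ln_series_remainder n (mulr_ge0 s0 u0) su s1.
  have /andP[b1 b2] := ln_series_remainder n (mulr_ge0 s'0 u0) s'u s1.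
  have E : P n u = C + \sum_(i < n) (s * u) ^+ i.+1 / i.+1%:R
      - \sum_(i < n) (s' * u) ^+ i.+1 / i.+1%:R.
    rewrite /P -addrA -sumrB; congr (_ + _); apply: eq_bigr => i _.
    by rewrite !exprMn; ring.
  rewrite E /h ler_norml; move: a1 a2 b1 b2.
  set A := \sum_(_ < _) _; set B := \sum_(_ < _) _; lra.
have main n : L1 h <= L2 h + s ^+ n * ((L1 (fun=> 1) + L2 (fun=> 1)) / (1 - s)).
  have h1 : L1 h <= L1 (P n) + s ^+ n / (1 - s) * L1 (fun=> 1).
    rewrite -(pl_cst p1) -(plD p1); case: u1 => _ _; apply => u /(hP n).
    by rewrite ler_norml; lra.
  have h2 : L2 (P n) <= L2 h + s ^+ n / (1 - s) * L2 (fun=> 1).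
    rewrite -(pl_cst p2) -(plD p2); case: u2 => _ _; apply => u /(hP n).
    by rewrite ler_norml; lra.
  apply: (le_trans h1); rewrite -lerBrDr; apply: (le_trans (PL n)).
  apply: (le_trans h2); rewrite lerBrDr -addrA lerD2l le_eqVlt; apply/orP; left.
  by apply/eqP; ring.
apply/ler_addgt0Pr => e e0.
set K := (_ / _) in main.
have K0 : 0 <= K.
  by apply: divr_ge0; [apply: addr_ge0; exact: pl_ge0 | rewrite subr_ge0 ltW].
have cv : (s ^+ n * K) @[n --> \oo] --> (0 : R).
  rewrite -(mul0r K); apply: cvgMr_tmp; apply: cvg_expr.
  by rewrite ger0_norm.
have /cvgrPdist_lt/(_ e e0) [n _ hn] := cv.
apply: (le_trans (main n)); rewrite lerD2l.
have := hn n (leqnn n); rewrite sub0r normrN => /ltW; apply: le_trans; exact: ler_norm.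
Qed.

End LogSeries.

(** * Replica overlaps *)

Section Replicas.
Variables (R : realType) (Omega : finType) (L : Type) (fals : Omega -> L -> bool).

Definition weighted (mu : Omega -> R) : op R Omega := fun f => \sum_x mu x * f x.

Definition violated (x : Omega) (c : seq L) : bool := all (fals x) c.

Definition viol_prob (mu : Omega -> R) (c : seq L) : R :=
  weighted mu (fun x => (violated x c)%:R).

Definition overlap (X : seq Omega) (l : L) : R := (all (fals ^~ l) X)%:R.

Lemma weighted_positive_linear mu :
  (forall x, 0 <= mu x) -> positive_linear (weighted mu).
Proof.
move=> mu0; rewrite /weighted; split.
- by move=> f g; rewrite -big_split; apply: eq_bigr => x _; rewrite mulrDr.
- by move=> c f; rewrite mulr_sumr; apply: eq_bigr => x _; rewrite mulrCA.
- by move=> f g fg; apply: ler_sum => x _; rewrite ler_wpM2l.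
Qed.

Lemma swaps_sym T U (A : op R T) (B : op R U) : swaps A B -> swaps B A.
Proof. by move=> s f; rewrite s. Qed.

Lemma weighted_swaps mu U (B : op R U) : positive_linear B -> swaps (weighted mu) B.
Proof.
move=> pB f; rewrite /weighted (pl_sum pB); apply: eq_bigr => x _.
by rewrite (plZ pB).
Qed.

Lemma prod_bool (I : Type) (r : seq I) (P : I -> bool) :
  \prod_(i <- r) (P i)%:R = (all P r)%:R :> R.
Proof.
elim: r => [|i r IH]; first by rewrite big_nil.
by rewrite big_cons IH /= -natrM mulnb.
Qed.

Lemma prod_violated (X : seq Omega) (c : seq L) :
  \prod_(x <- X) (violated x c)%:R = \prod_(l <- c) overlap X l.
Proof.
rewrite !prod_bool; congr (nat_of_bool _)%:R; apply/idP/idP; elim: X c => [|x X IH] c /=.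
- by move=> _; apply/allT.
- case/andP => h1 /IH h2; move: h1 h2; rewrite /violated; elim: c {IH} => //= l c IHc.
  by move=> /andP[-> ?] /andP[-> ?] /=; exact: IHc.
- by [].
- move=> h; apply/andP; split; first by apply: sub_all h => l /andP[].
  by apply: IH; apply: sub_all h => l /andP[].
Qed.

(** The m-th power of a violation probability is the probability that m independent replicas all
    violate the clause. For fixed replicas the k literals are independent, hence the k-th power. The
    weight [r] serves to restrict to clauses that avoid a variable. *)
Lemma replica_moment (mu : Omega -> R) (A : op R L) (r : L -> R) k m :
  (forall x, 0 <= mu x) -> positive_linear A ->
  prodE (nseq k A) (fun c => \prod_(l <- c) r l * viol_prob mu c ^+ m) =
  prodE (nseq m (weighted mu)) (fun X => A (fun l => r l * overlap X l) ^+ k).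
Proof.
move=> mu0 pA; have pW := weighted_positive_linear mu0.
have pk : positive_linear (prodE (nseq k A)).
  by apply: prodE_positive_linear; exact: all_prop_nseq.
have E c : viol_prob mu c ^+ m =
    prodE (nseq m (weighted mu)) (fun X => \prod_(x <- X) (violated x c)%:R).
  rewrite prodE_prod; last exact: all_prop_nseq.
  by rewrite big_nseq iter_mulr_1.
have pm : positive_linear (prodE (nseq m (weighted mu))).
  by apply: prodE_positive_linear; exact: all_prop_nseq.
transitivity (prodE (nseq k A) (fun c => prodE (nseq m (weighted mu))
   (fun X => \prod_(l <- c) (r l * overlap X l)))).
  congr prodE; apply/funext => c; rewrite E -(plZ pm); congr prodE.
  by apply/funext => X; rewrite prod_violated big_split.
have sw : swaps (prodE (nseq m (weighted mu))) (prodE (nseq k A)).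
  by apply: prodE_swaps; apply: all_prop_nseq; exact: weighted_swaps.
rewrite (swaps_sym sw); congr prodE; apply/funext => X.
by rewrite prodE_prod ?big_nseq ?iter_mulr_1//; exact: all_prop_nseq.
Qed.

Lemma viol_prob_ge0 mu c : (forall x, 0 <= mu x) -> 0 <= viol_prob mu c.
Proof. by move=> mu0; apply: sumr_ge0 => x _; rewrite mulr_ge0. Qed.

Lemma viol_prob_le1 mu c : (forall x, 0 <= mu x) -> \sum_x mu x = 1 ->
  viol_prob mu c <= 1.
Proof.
move=> mu0 <-; apply: ler_sum => x _.
by rewrite ler_piMr// lern1 leq_b1.
Qed.

End Replicas.

(** * Random clauses and Boltzmann weights *)

Section Model.
Variable R : realType.

Definition falsified n (x : assignment n) (l : literal n) : bool := x l.1 != l.2.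

Definition viol n (x : assignment n) (c : seq (literal n)) : bool :=
  violated (@falsified n) x c.

Definition litE n : op R (literal n) := @avg R (literal n).
Arguments litE : clear implicits.

Lemma litE_expectation n : (0 < n)%N -> expectation (litE n).
Proof. by move=> n0; apply: avg_expectation; rewrite card_prod card_ord card_bool muln_gt0 n0. Qed.

(* A literal and its negation cannot both be false. *)
Lemma litE_overlap_le n (X : seq (assignment n)) : (0 < n)%N -> X != [::] ->
  litE n (overlap R (@falsified n) X) <= 2^-1.
Proof.
case: X => // x X n0 _.
apply: (@le_trans _ _ (litE n (fun l => (falsified x l)%:R))).
  apply: (pl_le (litE_expectation n0).1) => l.
  by rewrite /overlap /= ler_nat; case: falsified => //=; exact: leq_b1.
rewrite /litE /avg card_prod card_ord card_bool.
have -> : \sum_(l : literal n) (falsified x l)%:R = n%:R :> R.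
  rewrite -(pair_bigA_idem _ (fun i b => (falsified x (i, b))%:R : R))//=; last by rewrite addr0.
  rewrite -[RHS](_ : \sum_(i < n) 1 = _); last by rewrite sumr_const card_ord.
  apply: eq_bigr => i _; rewrite big_bool /falsified/=.
  by case: (x i); rewrite /= ?addr0 ?add0r.
by rewrite natrM invfM mulrAC mulVf ?mul1r// pnatr_eq0 -lt0n.
Qed.

Lemma litE_overlap_ge0 n (X : seq (assignment n)) : (0 < n)%N ->
  0 <= litE n (overlap R (@falsified n) X).
Proof. by move=> n0; apply: (pl_ge0 (litE_expectation n0).1) => l; rewrite ler0n. Qed.

End Model.
Arguments litE : clear implicits.

Section Weights.
Variables (R : realType) (st : bool -> R).

(** The tag selects one of two interaction strengths, so that formulas with clauses at two different
    temperatures can be interpolated. *)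
Definition entry n : Type := (bool * seq (literal n))%type.

Definition factor n (e : entry n) (x : assignment n) : R :=
  1 - st e.1 * (viol x e.2)%:R.

Definition wt n (F : seq (entry n)) (x : assignment n) : R :=
  \prod_(e <- F) factor e x.

Definition part n (F : seq (entry n)) : R := \sum_x wt F x.

Definition clE n k i : op R (entry n) :=
  fun phi => prodE (nseq k (litE R n)) (fun c => phi (i, c)).
Arguments clE : clear implicits.

Definition formE n k (sigma : seq bool) : op R (seq (entry n)) :=
  prodE (map (clE n k) sigma).
Arguments formE : clear implicits.

Lemma clE_expectation n k i : (0 < n)%N -> expectation (clE n k i).
Proof.
move=> n0.
have [[D Z L] O] : expectation (prodE (nseq k (litE R n))).
  by apply: prodE_expectation; apply: all_prop_nseq; exact: litE_expectation.
by split => //; split => [f g|c f|f g fg]; rewrite /clE; [exact: D|exact: Z|exact: L].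
Qed.

Lemma clE_swaps n k i U (B : op R U) : positive_linear B -> swaps (clE n k i) B.
Proof.
move=> pB f.
have sB : all_prop (fun A => swaps A B) (nseq k (litE R n)).
  by apply: all_prop_nseq; exact: avg_swaps.
exact: (prodE_swaps sB (fun c => f (i, c))).
Qed.

Lemma formE_expectation n k sigma : (0 < n)%N -> expectation (formE n k sigma).
Proof.
by move=> n0; apply: prodE_expectation; apply: all_prop_map => i; exact: clE_expectation.
Qed.

Lemma wt_cat n (F G : seq (entry n)) x : wt (F ++ G) x = wt F x * wt G x.
Proof. by rewrite /wt big_cat. Qed.

Lemma wt_cons n (e : entry n) F x : wt (e :: F) x = factor e x * wt F x.
Proof. by rewrite /wt big_cons. Qed.

Variable beta : R.
Hypothesis hst : forall i, 0 <= st i /\ expR (- beta) <= 1 - st i.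

Lemma st_ge0 i : 0 <= st i. Proof. by case: (hst i). Qed.

Lemma st_lt1 i : st i < 1.
Proof. by case: (hst i) => _ h; rewrite -subr_gt0 (lt_le_trans (expR_gt0 _) h). Qed.

Lemma beta_ge0 : 0 <= beta.
Proof.
case: (hst true) => h1 h2; rewrite -oppr_le0 -expR_le1 (le_trans h2)//.
by rewrite gerBl.
Qed.

Lemma factor_ge n (e : entry n) x : expR (- beta) <= factor e x.
Proof.
rewrite /factor; case: viol => /=; first by rewrite mulr1; case: (hst e.1).
by rewrite mulr0 subr0 expR_le1 oppr_le0 beta_ge0.
Qed.

Lemma factor_gt0 n (e : entry n) x : 0 < factor e x.
Proof. by rewrite (lt_le_trans (expR_gt0 _) (factor_ge e x)). Qed.

Lemma factor_le1 n (e : entry n) x : factor e x <= 1.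
Proof. by rewrite gerBl mulr_ge0// st_ge0. Qed.

Lemma wt_gt0 n (F : seq (entry n)) x : 0 < wt F x.
Proof. by apply: prodr_gt0 => e _; exact: factor_gt0. Qed.

Lemma asg_sum_gt0 n (f : assignment n -> R) : (forall x, 0 < f x) -> 0 < \sum_x f x.
Proof.
move=> f0; rewrite (bigD1 [ffun=> true])//=.
by apply: ltr_wpDr => //; apply: sumr_ge0 => x _; exact: ltW.
Qed.

Lemma part_gt0 n (F : seq (entry n)) : 0 < part F.
Proof. by apply: asg_sum_gt0 => x; exact: wt_gt0. Qed.

Lemma part_insert n (F G : seq (entry n)) e : part (F ++ e :: G) = part (e :: F ++ G).
Proof.
by apply: eq_bigr => x _; rewrite wt_cat !wt_cons wt_cat mulrCA.
Qed.

Lemma part_cons_le n (F : seq (entry n)) e : part (e :: F) <= part F.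
Proof.
apply: ler_sum => x _; rewrite wt_cons ler_piMl ?factor_le1//.
exact/ltW/wt_gt0.
Qed.

Lemma part_cons_ge n (F : seq (entry n)) e :
  expR (- beta) * part F <= part (e :: F).
Proof.
rewrite mulr_sumr; apply: ler_sum => x _; rewrite wt_cons.
by rewrite ler_wpM2r ?factor_ge// ltW// wt_gt0.
Qed.

Definition lnpart n (F : seq (entry n)) : R := ln (part F).

Lemma lnpart_insert_le n (F G : seq (entry n)) e :
  lnpart (F ++ e :: G) <= lnpart (F ++ G).
Proof. by rewrite /lnpart part_insert ler_ln ?posrE ?part_gt0// part_cons_le. Qed.

Lemma lnpart_insert_ge n (F G : seq (entry n)) e :
  lnpart (F ++ G) - beta <= lnpart (F ++ e :: G).
Proof.
rewrite /lnpart part_insert -[X in _ - X](expRK beta) -ln_div ?posrE ?part_gt0 ?expR_gt0//.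
rewrite ler_ln ?posrE ?divr_gt0 ?part_gt0 ?expR_gt0//.
by rewrite mulrC -expRN part_cons_ge.
Qed.

End Weights.
Arguments clE {R} n k i.
Arguments formE {R} n k sigma.

(** * Convexity estimates and the interpolation step *)

Section Domination.
Variable R : realType.

Lemma prodE_le_size T (As : seq (op R T)) phi psi :
  all_prop (@positive_linear R T) As ->
  (forall F, size F = size As -> phi F <= psi F) -> prodE As phi <= prodE As psi.
Proof.
elim: As phi psi => [|A As IH] phi psi; first by move=> _ h; exact: h.
by case=> pA pAs h; apply: IH => // F sF; apply: (pl_le pA) => c; apply: h; rewrite /= sF.
Qed.

(** The image under [u] of the law with density [r]: the form in which clause laws enter
    [moment_domination]. *)
Lemma uf_pushforward T (E : op R T) (r u : T -> R) : positive_linear E ->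
  (forall c, 0 <= r c) -> (forall c, 0 <= u c <= 1) ->
  unit_functional (fun h => E (fun c => r c * h (u c))).
Proof.
move=> pE r0 u01; split => [f g|c f|f g fg].
- by rewrite -(plD pE); congr E; apply/funext => c; rewrite mulrDr.
- by rewrite -(plZ pE); congr E; apply/funext => x; rewrite mulrCA.
- by apply: (pl_le pE) => c; rewrite ler_wpM2l// fg.
Qed.

Lemma uf_eval (x : R) : 0 <= x <= 1 -> unit_functional (fun h : R -> R => h x).
Proof. by move=> x01; split => // f g; apply. Qed.

Lemma ufZ (c : R) L : 0 <= c -> unit_functional L -> unit_functional (fun h => c * L h).
Proof.
move=> c0 [D Z l]; split => [f g|d f|f g fg].
- by rewrite D mulrDr.
- by rewrite Z mulrCA.
- by rewrite ler_wpM2l// l.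
Qed.

Lemma ufD (L L' : op R R) : unit_functional L -> unit_functional L' ->
  unit_functional (fun h => L h + L' h).
Proof.
move=> [D Z l] [D' Z' l']; split => [f g|d f|f g fg].
- by rewrite D D' addrACA.
- by rewrite Z Z' mulrDr.
- by rewrite lerD ?l ?l'.
Qed.

Lemma convex_pow (p a b : R) k : 0 <= p <= 1 -> 0 <= a -> 0 <= b ->
  (p * a + (1 - p) * b) ^+ k <= p * a ^+ k + (1 - p) * b ^+ k.
Proof.
move=> /andP[p0 p1] a0 b0; have q0 : 0 <= 1 - p by rewrite subr_ge0.
elim: k => [|k IH]; first by rewrite !expr0 !mulr1 addrC subrK.
apply: (@le_trans _ _ ((p * a + (1 - p) * b) * (p * a ^+ k + (1 - p) * b ^+ k))).
  by rewrite exprS ler_wpM2l// addr_ge0// mulr_ge0.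
have : 0 <= p * (1 - p) * ((a - b) * (a ^+ k - b ^+ k)).
  apply: mulr_ge0; first exact: mulr_ge0.
  have [ab|/ltW ba] := leP a b.
    by apply: mulr_le0; rewrite subr_le0// lerXn2r.
  by apply: mulr_ge0; rewrite subr_ge0// lerXn2r.
by rewrite !exprS; lra.
Qed.

(** [f] collects the mixed terms of the binomial expansion. It is convex with [f 0 = 0], so on
    [0, 1/2] it lies below its chord; the recursion [fS] proves this by induction on the
    exponent. *)
Lemma pow_cross_le (p z : R) k (f := fun x => (p + x) ^+ k.+1 - x ^+ k.+1 - p ^+ k.+1) :
  0 <= p -> 0 <= z -> z <= 2^-1 -> 0 <= f z /\ f z <= 2 * z * f 2^-1.
Proof.
move=> p0 z0 z2.
suff: (forall x, 0 <= x -> 0 <= f x) /\ f z <= 2 * z * f 2^-1 by case=> /(_ z z0).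
rewrite /f {f}; elim: k => [|k [IH0 IH]].
  by rewrite !expr1 !addrK subrr mulr0; split => // x _; rewrite expr1 addrK subrr.
pose f x := (p + x) ^+ k.+1 - x ^+ k.+1 - p ^+ k.+1.
have fS x : (p + x) ^+ k.+2 - x ^+ k.+2 - p ^+ k.+2 =
    (p + x) * f x + p * x ^+ k.+1 + x * p ^+ k.+1.
  by rewrite /f [(p + x) ^+ k.+2]exprS [x ^+ k.+2]exprS [p ^+ k.+2]exprS; ring.
rewrite -/(f z) -/(f 2^-1) in IH; have {}IH0 (x : R) : 0 <= x -> 0 <= f x := IH0 x.
clearbody f; split=> [x x0|].
  rewrite fS; apply: addr_ge0; first apply: addr_ge0.
  - by apply: mulr_ge0; [exact: addr_ge0|exact: IH0].
  - by rewrite mulr_ge0 ?exprn_ge0.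
  - by rewrite mulr_ge0 ?exprn_ge0.
rewrite !fS !mulrDr; apply: lerD; first apply: lerD.
- apply: (@le_trans _ _ ((p + 2^-1) * (2 * z * f 2^-1))).
    by apply: ler_pM; [exact: addr_ge0|exact: IH0|rewrite lerD2l|exact: IH].
  by rewrite mulrCA -!mulrA.
- rewrite [leRHS]mulrCA ler_wpM2l// exprS mulrAC [leRHS](_ : _ = z * 2^-1 ^+ k).
    by rewrite ler_wpM2l// lerXn2r ?nnegrE ?invr_ge0.
  by rewrite exprS; field.
- by rewrite mulrA -[2 * z * 2^-1]mulrAC mulfV ?pnatr_eq0// mul1r.
Qed.

(* The excess is, up to its constant term, a convex function of [r] vanishing at 0. *)
Lemma pow_excess_le (p r q : R) k : 0 <= p -> 0 <= r -> r <= q -> q <= 2^-1 ->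
  (p + r) ^+ k.+1 - r ^+ k.+1 <=
  2 * q * ((p + 2^-1) ^+ k.+1 - 2^-1 ^+ k.+1) + p ^+ k.+1.
Proof.
move=> p0 r0 rq q2; have r2 : r <= 2^-1 by exact: le_trans q2.
have [_ h] := pow_cross_le k p0 r0 r2.
have h20 : 0 <= 2^-1 :> R by rewrite invr_ge0.
have [h2 _] := pow_cross_le k p0 h20 (lexx _).
have pk : 0 <= p ^+ k.+1 by rewrite exprn_ge0.
rewrite -lerBlDr; apply: (le_trans h).
apply: ler_pM; rewrite ?mulr_ge0//.
- by rewrite ler_wpM2l.
- by rewrite gerBl.
Qed.

End Domination.

Section GibbsAverage.
Variables (R : realType) (Omega : finType) (L : Type) (fals : Omega -> L -> bool).
Variable w : Omega -> R.
Let S := \sum_x w x.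
Hypotheses (w0 : forall x, 0 < w x) (S0 : 0 < S).

Definition gibbs (x : Omega) : R := w x / S.

Lemma gibbs_ge0 x : 0 <= gibbs x. Proof. by rewrite divr_ge0// ltW. Qed.

Lemma gibbs_sum : \sum_x gibbs x = 1.
Proof. by rewrite -mulr_suml divff// gt_eqF. Qed.

Lemma weighted_gibbs_expectation : expectation (weighted gibbs).
Proof.
split; first exact/weighted_positive_linear/gibbs_ge0.
by rewrite /weighted -[RHS]gibbs_sum; apply: eq_bigr => x _; rewrite mulr1.
Qed.

Lemma sum_factor s c : \sum_x w x * (1 - s * (violated fals x c)%:R) =
  S * (1 - s * viol_prob fals gibbs c).
Proof.
rewrite mulrBr mulr1 /viol_prob /weighted.
have -> : S * (s * \sum_x gibbs x * (violated fals x c)%:R) =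
   \sum_x w x * s * (violated fals x c)%:R.
  rewrite !mulr_sumr; apply: eq_bigr => x _; rewrite /gibbs.
  by field; rewrite gt_eqF.
rewrite -sumrB; apply: eq_bigr => x _; ring.
Qed.

Lemma gibbs_viol01 c : 0 <= viol_prob fals gibbs c <= 1.
Proof.
by rewrite viol_prob_ge0 ?viol_prob_le1//; [exact: gibbs_ge0|exact: gibbs_sum|exact: gibbs_ge0].
Qed.

End GibbsAverage.

(** Puts the cost of a clause into the shape required by [moment_domination], with
    [s' = s / (1 + r) <= s]. *)
Lemma ln_ratio (R : realType) (r s u : R) : 0 <= r -> 0 <= s -> s < 1 -> 0 <= u <= 1 ->
  ln (1 + r / (1 - s * u)) = ln (1 + r) + ln (1 - s / (1 + r) * u) - ln (1 - s * u).
Proof.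
move=> r0 s0 s1 /andP[u0 u1].
have r1 : 0 < 1 + r by rewrite ltr_wpDr.
have su : s * u < 1 by rewrite (le_lt_trans _ s1)// ler_piMr.
have su' : 0 < 1 - s * u by rewrite subr_gt0.
have E : (1 + r) * (1 - s / (1 + r) * u) = 1 - s * u + r by field; rewrite gt_eqF.
have sr : 0 < 1 - s / (1 + r) * u.
  by rewrite -(pmulr_rgt0 _ r1) E ltr_wpDr.
rewrite -lnM ?posrE// E -ln_div ?posrE//; last by rewrite ltr_wpDr.
by congr ln; field; rewrite gt_eqF.
Qed.

Section ClauseDomination.
Variables (R : realType) (st : bool -> R) (beta : R).
Hypothesis hst : forall i, 0 <= st i /\ expR (- beta) <= 1 - st i.

Definition ln_with n (w : assignment n -> R) i (c : seq (literal n)) : R :=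
  ln (\sum_x w x * factor st (i, c) x).

(* Interpolation step (Franz-Leone): a clause whose literals are all drawn from
   the same random block costs more than a clause with independent literals,
   because the replica overlaps enter through the convex function [t ^ k]. *)
Lemma mixture_le n k i (A A1 A2 : op R (literal n)) (p : R) (w : assignment n -> R) :
  0 <= p <= 1 -> expectation A -> expectation A1 -> expectation A2 ->
  (forall f, A f = p * A1 f + (1 - p) * A2 f) -> (forall x, 0 < w x) ->
  p * prodE (nseq k A1) (ln_with w i) + (1 - p) * prodE (nseq k A2) (ln_with w i) <=
  prodE (nseq k A) (ln_with w i).
Proof.
set g := ln_with w i; move=> p01 eA eA1 eA2 AE w0; have /andP[p0 p1] := p01.
have q0 : 0 <= 1 - p by rewrite subr_ge0.
have S0 : 0 < \sum_x w x by exact: asg_sum_gt0.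
pose u c := viol_prob (@falsified n) (gibbs w) c.
have u01 c : 0 <= u c <= 1 by apply: gibbs_viol01.
(* The zero terms exhibit [- ln (1 - st i * v)] as the case [C = s' = 0] of [moment_domination]. *)
pose h (v : R) := ln (\sum_x w x) - (0 + ln (1 - 0 * v) - ln (1 - st i * v)).
have gE c : g c = h (u c).
  rewrite /g /h /ln_with (eq_bigr (fun x => w x * (1 - st i * (viol x c)%:R)))//.
  rewrite /viol sum_factor// mul0r subr0 ln1 addr0 add0r opprK lnM ?posrE//.
  rewrite subr_gt0 (le_lt_trans _ (st_lt1 hst i))//.
  by rewrite ler_piMr ?(st_ge0 hst)//; have /andP[] := u01 c.
have ek (B : op R (literal n)) : expectation B -> expectation (prodE (nseq k B)).
  by move=> eB; apply: prodE_expectation; exact: all_prop_nseq.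
pose h' (v : R) := 0 + ln (1 - 0 * v) - ln (1 - st i * v).
have gE' (B : op R (literal n)) : expectation B -> prodE (nseq k B) g =
    ln (\sum_x w x) - prodE (nseq k B) (fun c => 1 * h' (u c)).
  move=> eB; rewrite -[X in X - _](expect_cst (ek _ eB)) -(plB (ek _ eB).1).
  by congr prodE; apply/funext => c; rewrite gE mul1r.
rewrite !gE'// -subr_ge0.
have ufB (B : op R (literal n)) : expectation B -> unit_functional (fun h => prodE (nseq k B) (fun c => 1 * h (u c))).
  by move=> eB; apply: uf_pushforward => //; exact: (ek _ eB).1.
have mom (B : op R (literal n)) m : expectation B -> prodE (nseq k B) (fun c => 1 * u c ^+ m) =
    prodE (nseq m (weighted (gibbs w))) (fun X => B (overlap R (@falsified n) X) ^+ k).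
  move=> eB.
  have := @replica_moment R _ _ (@falsified n) (gibbs w) B (fun=> 1) k m
    (gibbs_ge0 w0 S0) eB.1.
  have -> : (fun c => \prod_(l <- c) 1 * viol_prob (@falsified n) (gibbs w) c ^+ m) =
            (fun c => 1 * u c ^+ m) by apply/funext => c; rewrite big1_eq.
  move=> ->; congr prodE; apply/funext => X; congr (B _ ^+ k).
  by apply/funext => l; rewrite mul1r.
have epW m : expectation (prodE (nseq m (weighted (gibbs w)))).
  by apply: prodE_expectation; apply: all_prop_nseq; exact: weighted_gibbs_expectation.
have := @moment_domination R (fun h => prodE (nseq k A) (fun c => 1 * h (u c)))
  (fun h => p * prodE (nseq k A1) (fun c => 1 * h (u c)) +
       (1 - p) * prodE (nseq k A2) (fun c => 1 * h (u c))) 0 0 (st i)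
  (ufB _ eA) (ufD (ufZ p0 (ufB _ eA1)) (ufZ q0 (ufB _ eA2))).
rewrite -/(h') => H; have {H} : prodE (nseq k A) (fun c => 1 * h' (u c)) <=
   p * prodE (nseq k A1) (fun c => 1 * h' (u c)) +
       (1 - p) * prodE (nseq k A2) (fun c => 1 * h' (u c)).
  apply: H => //; rewrite ?(st_ge0 hst) ?(st_lt1 hst)// => m.
  rewrite !mom// -!(plZ (epW m).1) -(plD (epW m).1); apply: (pl_le (epW m).1) => X.
  have ov0 (l : literal n) : 0 <= overlap R (@falsified n) X l by rewrite ler0n.
  by rewrite AE; apply: convex_pow => //; [exact: (pl_ge0 eA1.1)|exact: (pl_ge0 eA2.1)].
set a := prodE _ _; set b := prodE _ _; set c := prodE _ _; lra.
Qed.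

End ClauseDomination.

(** * Elimination of a variable *)

Section Ratio.
Variables (R : realType) (Omega : finType).
Implicit Types N D : Omega -> R.

(** [D] is the weight before and [N] the weight after imposing constraints. The shape comes from
    [swap_temperature], where [a] is the higher temperature's inverse; each elimination then lowers
    [a] by 1. *)
Definition log_ratio (a : R) N D : R := ln (1 + expR (- a) * ((\sum_x D x) / \sum_x N x)).

Lemma log_ratio_factor (L : Type) (fals : Omega -> L -> bool) a N D s c :
  (forall x, 0 < N x) -> 0 < \sum_x N x -> 0 <= s -> s < 1 ->
  log_ratio a (fun x => N x * (1 - s * (violated fals x c)%:R)) D =
  ln (1 + expR (- a) * ((\sum_x D x) / \sum_x N x) /
     (1 - s * viol_prob fals (gibbs N) c)).
Proof.
move=> N0 S0 s0 s1; rewrite /log_ratio sum_factor//; congr (ln (1 + _)).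
by rewrite invfM !mulrA.
Qed.

Lemma log_ratio_le a N N' D D' : 0 < \sum_x N' x -> 0 <= \sum_x D x ->
  \sum_x N' x <= \sum_x N x -> \sum_x D x <= \sum_x D' x ->
  log_ratio a N D <= log_ratio a N' D'.
Proof.
move=> N0 D0 NN DD; have N1 : 0 < \sum_x N x by exact: lt_le_trans NN.
have D1 : 0 <= \sum_x D' x by exact: le_trans DD.
have pos (d m : R) : 0 <= d -> 0 < m -> 0 < 1 + expR (- a) * (d / m).
  by move=> d0 m0; rewrite ltr_wpDr// mulr_ge0 ?expR_ge0// divr_ge0// ltW.
rewrite ler_ln ?posrE ?pos// lerD2l ler_wpM2l ?expR_ge0//.
by apply: ler_pM; rewrite ?invr_ge0 ?(ltW N1)// lef_pV2 ?posrE.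
Qed.

Lemma log_ratio_shift_le a b N N' D : 0 <= b -> 0 <= \sum_x D x -> 0 < \sum_x N x ->
  expR (- b) * \sum_x N x <= \sum_x N' x -> log_ratio a N' D <= log_ratio a N D + b.
Proof.
move=> b0 D0 N0 NN.
have N1 : 0 < \sum_x N' x by rewrite (lt_le_trans _ NN)// mulr_gt0 ?expR_gt0.
set d := \sum_x D x; set m := \sum_x N x; set m' := \sum_x N' x.
have pos (q : R) : 0 < q -> 0 < 1 + expR (- a) * (d / q).
  by move=> q0; rewrite ltr_wpDr// mulr_ge0 ?expR_ge0// divr_ge0// ltW.
rewrite -[X in _ + X](expRK b) -lnM ?posrE ?pos ?expR_gt0//.
rewrite ler_ln ?posrE ?pos ?mulr_gt0 ?pos ?expR_gt0//.
rewrite mulrDl mul1r; apply: lerD; first by rewrite -expR0 ler_expR.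
rewrite -mulrA ler_wpM2l ?expR_ge0// -mulrA ler_wpM2l//.
rewrite -[leLHS]mul1r ler_pdivrMr// -mulrA mulrC ler_pdivlMr// mul1r.
by rewrite -ler_pdivrMl ?expR_gt0// -expRN.
Qed.

End Ratio.

Section VariableElimination.
Variables (R : realType) (n : nat).
Hypothesis n0 : (0 < n)%N.
Variable l : literal n.+1.

Definition negl m (l : literal m) : literal m := (l.1, ~~ l.2).

Definition lft (l' : literal n) : literal n.+1 := (lift l.1 l'.1, l'.2).

(* [ins] makes [l] true and [insn] makes it false. *)
Definition ins (x : assignment n) : assignment n.+1 :=
  [ffun j => if unlift l.1 j is Some j' then x j' else l.2].

Definition insn (x : assignment n) : assignment n.+1 :=
  [ffun j => if unlift l.1 j is Some j' then x j' else ~~ l.2].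

Let y : R := n.+1%:R^-1.

Lemma litE_split f :
  litE R n.+1 f = y / 2 * (f l + f (negl l)) + (1 - y) * litE R n (f \o lft).
Proof.
rewrite /litE /avg !card_prod !card_ord !card_bool.
have E m (g : literal m -> R) : \sum_l g l = \sum_(i < m) (g (i, true) + g (i, false)).
  rewrite (eq_bigr (fun p => g (p.1, p.2))); last by case.
  rewrite -(pair_bigA_idem _ (fun i b => g (i, b)))//=; last by rewrite addr0.
  by apply: eq_bigr => i _; rewrite big_bool.
rewrite !E (bigD1_ord l.1)//= mulrDr; congr (_ + _).
  rewrite /y natrM invfM; congr (_ * _); rewrite /negl.
  by case: l => v []; rewrite //= addrC.
rewrite mulrA; congr (_ * _).
rewrite /y !natrM -natr1; field.
by rewrite natr1 !pnatr_eq0 -lt0n n0.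
Qed.

Lemma falsified_ins x l' : falsified (ins x) (lft l') = falsified x l'.
Proof. by rewrite /falsified ffunE /= liftK. Qed.

Lemma falsified_ins_l x : falsified (ins x) l = false.
Proof. by rewrite /falsified ffunE unlift_none eqxx. Qed.

Lemma falsified_ins_negl x : falsified (ins x) (negl l) = true.
Proof. by rewrite /falsified ffunE /= unlift_none; case: (l.2). Qed.

Lemma violated_ins x c :
  violated (fun x => falsified (ins x)) x (map lft c) = viol x c.
Proof.
rewrite /viol /violated all_map; apply: eq_all => l' /=; exact: falsified_ins.
Qed.

Lemma sum_assignment (f : assignment n.+1 -> R) :
  \sum_x f x = \sum_x f (ins x) + \sum_x f (insn x).
Proof.
rewrite (bigID (fun x : assignment n.+1 => x l.1 == l.2))/=; congr (_ + _).
  rewrite (reindex_onto ins (fun x => [ffun i => x (lift l.1 i)]))/=; last first.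
    move=> x /eqP xl; apply/ffunP => j; rewrite !ffunE.
    by case: unliftP => [j' ->|->]; rewrite ?ffunE.
  apply: eq_bigl => x; rewrite ffunE unlift_none eqxx/=.
  by apply/eqP/ffunP => j; rewrite !ffunE liftK.
rewrite (reindex_onto insn (fun x => [ffun i => x (lift l.1 i)]))/=; last first.
  move=> x xl; apply/ffunP => j; rewrite !ffunE.
  case: unliftP => [j' ->|->]; rewrite ?ffunE//.
  by move: xl; case: (x l.1); case: (l.2).
apply: eq_bigl => x; rewrite ffunE unlift_none.
have -> : (~~ l.2 != l.2) by case: (l.2).
by apply/eqP/ffunP => j; rewrite !ffunE liftK.
Qed.

Definition avoids (c : seq (literal n.+1)) : bool := all (fun l' => l'.1 != l.1) c.

Lemma prodE_avoids k (g : seq (literal n.+1) -> R) :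
  prodE (nseq k (litE R n.+1)) (fun c => (avoids c)%:R * g c) =
  (1 - y) ^+ k * prodE (nseq k (litE R n)) (fun c => g (map lft c)).
Proof.
elim: k g => [|k IH] g /=; first by rewrite !mul1r.
have -> : (fun F => litE R n.+1 (fun c => (avoids (c :: F))%:R * g (c :: F))) =
   (fun F => (avoids F)%:R * ((1 - y) * litE R n (fun c => g (lft c :: F)))).
  apply/funext => F; rewrite litE_split /= /avoids /= !eqxx /= !mul0r addr0 mulr0 add0r.
  rewrite -!(plZ (litE_expectation R n0).1).
  apply: (congr1 (litE R n)); apply/funext => c /=.
  by rewrite eq_sym neq_lift mulrCA.
rewrite IH exprSr -mulrA; congr (_ * _).
rewrite -(plZ (prodE_positive_linear _))//.
by apply: all_prop_nseq; exact: (litE_expectation R n0).1.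
Qed.

End VariableElimination.

Section ClauseElimination.
Variables (R : realType) (st : bool -> R) (beta : R).
Hypothesis hst : forall i, 0 <= st i /\ expR (- beta) <= 1 - st i.
Hypothesis st_max : forall i, st i <= st true.

(** The slope in [pow_excess_le] for p = y / 2 with y = 1 / (n + 1): the intensity at which a
    clause, on elimination of one of n + 1 variables, is replaced by a random unit clause. *)
Definition unit_rate (k n : nat) : R :=
  2 * ((n.+1%:R^-1 / 2 + 2^-1) ^+ k - 2^-1 ^+ k).

Lemma prodE_nseq_expectation T (A : op R T) k :
  expectation A -> expectation (prodE (nseq k A)).
Proof. by move=> eA; apply: prodE_expectation; exact: all_prop_nseq. Qed.

Lemma log_ratio_factor_ge_unit n (N D : assignment n -> R) a i (l : literal n) :
  (forall x, 0 < N x) -> (forall x, 0 < D x) ->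
  log_ratio a (fun x => N x * factor st (i, [:: l]) x) D <=
  log_ratio a (fun x => N x * factor st (true, [:: l]) x) D.
Proof.
move=> N0 D0; apply: log_ratio_le => //.
- by apply: asg_sum_gt0 => x; rewrite mulr_gt0// (factor_gt0 hst).
- exact/ltW/asg_sum_gt0.
- apply: ler_sum => x _; rewrite ler_wpM2l//; first exact: ltW.
  by rewrite lerD2l lerN2 ler_wpM2r.
Qed.

(** Mean overlaps t lie in [0, 1], where t^(k+1) <= t; so each moment of a longer clause is at most
    that of a unit clause. *)
Lemma clause_le_unit n k i (N D : assignment n -> R) a : (0 < n)%N ->
  (forall x, 0 < N x) -> (forall x, 0 < D x) ->
  clE n k.+1 i (fun e => log_ratio a (fun x => N x * factor st e x) D) <=
  litE R n (fun l => log_ratio a (fun x => N x * factor st (true, [:: l]) x) D).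
Proof.
move=> n0 N0 D0; have eL := litE_expectation R n0.
have S0 : 0 < \sum_x N x by exact: asg_sum_gt0.
have SD : 0 < \sum_x D x by exact: asg_sum_gt0.
apply: le_trans (pl_le eL.1 (fun l => log_ratio_factor_ge_unit a i l N0 D0)).
pose u c := viol_prob (@falsified n) (gibbs N) c.
have u01 c : 0 <= u c <= 1 by apply: gibbs_viol01.
pose r := expR (- a) * ((\sum_x D x) / \sum_x N x).
have r0 : 0 <= r by rewrite mulr_ge0 ?expR_ge0// divr_ge0// ltW.
pose h v : R := ln (1 + r) + ln (1 - st i / (1 + r) * v) - ln (1 - st i * v).
have vE c : log_ratio a (fun x => N x * factor st (i, c) x) D = h (u c).
  rewrite /h -ln_ratio ?(st_ge0 hst) ?(st_lt1 hst)//.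
  by rewrite (log_ratio_factor (@falsified n)) ?(st_ge0 hst) ?(st_lt1 hst).
rewrite /clE.
have -> : (fun c => log_ratio a (fun x => N x * factor st (i, c) x) D) = (fun c => 1 * h (u c)).
  by apply/funext => c; rewrite mul1r vE.
have -> : (fun l => log_ratio a (fun x => N x * factor st (i, [:: l]) x) D) =
   (fun l => 1 * h (u [:: l])).
  by apply/funext => l; rewrite mul1r vE.
have ek := prodE_nseq_expectation k.+1 eL.
have mom j m : prodE (nseq j (litE R n)) (fun c => 1 * u c ^+ m) =
    prodE (nseq m (weighted (gibbs N))) (fun X => litE R n (overlap R (@falsified n) X) ^+ j).
  have := @replica_moment R _ _ (@falsified n) (gibbs N) (litE R n) (fun=> 1) j m
    (gibbs_ge0 N0 S0) eL.1.
  have -> : (fun c => \prod_(l <- c) 1 * viol_prob (@falsified n) (gibbs N) c ^+ m) =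
            (fun c => 1 * u c ^+ m) by apply/funext => c; rewrite big1_eq.
  move=> ->; congr prodE; apply/funext => X; congr (litE R n _ ^+ j).
  by apply/funext => l; rewrite mul1r.
have r1 : 0 < 1 + r by rewrite ltr_wpDr.
apply: (@moment_domination R (fun h => prodE (nseq k.+1 (litE R n)) (fun c => 1 * h (u c)))
  (fun h => litE R n (fun l => 1 * h (u [:: l]))) (ln (1 + r)) (st i / (1 + r)) (st i)).
- by apply: uf_pushforward => //; exact: ek.1.
- by apply: uf_pushforward => //; exact: eL.1.
- move=> m; rewrite mom.
  have := mom 1%N m; rewrite /= => ->.
  have epW : expectation (prodE (nseq m (weighted (gibbs N)))).
    by apply: prodE_nseq_expectation; exact: weighted_gibbs_expectation.
  apply: (pl_le epW.1) => X; rewrite expr1 exprS.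
  rewrite ler_piMr ?litE_overlap_ge0// exprn_ile1// ?litE_overlap_ge0//.
  by rewrite -(expect_cst eL 1); apply: (pl_le eL.1) => l; rewrite lern1 leq_b1.
- by rewrite ln_ge0// lerDl.
- by rewrite divr_ge0 ?(st_ge0 hst)// ltW.
- by rewrite ler_pdivrMr// ler_peMr ?(st_ge0 hst)// lerDl.
- exact: st_lt1.
Qed.

Section Step.
Variables (n : nat) (l : literal n.+1) (k : nat) (i : bool) (a : R).
Variables (N D : assignment n -> R).
Hypotheses (n0 : (0 < n)%N) (N0 : forall x, 0 < N x) (D0 : forall x, 0 < D x).

Let y : R := n.+1%:R^-1.
Let Q := unit_rate k.+1 n.
Let fals' (x : assignment n) := falsified (ins l x).
Let Nl (e : entry n.+1) x := N x * factor st e (ins l x).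
(** A clause on the eliminated variable is left out of [D]. This can only increase the ratio, and
    makes the cost of such a clause a function of its violation probability alone. *)
Let Dl (e : entry n.+1) x := D x * (if avoids l e.2 then factor st e (ins l x) else 1).

Hypothesis hQ : Q + (y / 2) ^+ k.+1 <= 1 - (1 - y) ^+ k.+1.

Let SN : 0 < \sum_x N x. Proof. exact: asg_sum_gt0. Qed.
Let SD : 0 < \sum_x D x. Proof. exact: asg_sum_gt0. Qed.
Let y0 : 0 < y. Proof. by rewrite invr_gt0. Qed.
Let y1 : y <= 1. Proof. by rewrite invf_le1// ler1n. Qed.
Let q0 : 0 <= Q.
Proof.
rewrite mulr_ge0// subr_ge0 lerXn2r ?nnegrE ?addr_ge0 ?divr_ge0 ?invr_ge0// ?(ltW y0)//.
by rewrite lerDr divr_ge0// ltW.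
Qed.
Let u c := viol_prob fals' (gibbs N) c.
Let u01 c : 0 <= u c <= 1. Proof. exact: gibbs_viol01. Qed.

Let touch_functional (h : R -> R) : R :=
  prodE (nseq k.+1 (litE R n.+1)) (fun c => (~~ avoids l c)%:R * h (u c)).

Let v (l' : literal n) := viol_prob (@falsified n) (gibbs N) [:: l'].
Let v01 l' : 0 <= v l' <= 1. Proof. exact: gibbs_viol01. Qed.

(** Three fates of a clause on the eliminated variable: satisfied ([h 0]), empty ([h 1], all
    literals being the negation of [l]), or a random unit clause. The weight of [h 0] makes the
    total masses agree, and [hQ] makes it nonnegative. *)
Let bound_functional (h : R -> R) : R :=
  ((1 - (1 - y) ^+ k.+1 - Q - (y / 2) ^+ k.+1) * h 0 + (y / 2) ^+ k.+1 * h 1) +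
  Q * litE R n (fun l' => 1 * h (v l')).

Let ek := prodE_nseq_expectation k.+1 (litE_expectation R (ltn0Sn n)).
Let eL := litE_expectation R n0.

Lemma touch_uf : unit_functional touch_functional.
Proof. by apply: uf_pushforward => //; exact: ek.1. Qed.

Lemma bound_uf : unit_functional bound_functional.
Proof.
apply: ufD; first apply: ufD.
- by apply: ufZ; [move: hQ; lra | apply: uf_eval; rewrite lexx ler01].
- apply: ufZ; last by apply: uf_eval; rewrite lexx ler01.
  by rewrite exprn_ge0// divr_ge0// ltW.
- by apply: ufZ => //; apply: uf_pushforward => //; exact: eL.1.
Qed.

Lemma touchE (g : seq (literal n.+1) -> R) :
  prodE (nseq k.+1 (litE R n.+1)) (fun c => (~~ avoids l c)%:R * g c) =
  prodE (nseq k.+1 (litE R n.+1)) g -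
  prodE (nseq k.+1 (litE R n.+1)) (fun c => (avoids l c)%:R * g c).
Proof.
rewrite -(plB ek.1); congr prodE; apply/funext => c.
by case: avoids; rewrite ?mul0r ?mul1r ?subrr ?subr0.
Qed.

(** With at least one replica, [l] has overlap 0 and its negation overlap 1. If q is the mean
    overlap on the other variables, the moment is (y/2 + (1 - y) q)^(k+1) - ((1 - y) q)^(k+1), and
    [pow_excess_le] applies because q <= 1/2. *)
Lemma touch_moment m :
  touch_functional (fun x => x ^+ m) <= bound_functional (fun x => x ^+ m).
Proof.
rewrite /touch_functional /bound_functional touchE.
case: m => [|m].
  under [X in _ - prodE _ X]funext do rewrite expr0.
  rewrite (prodE_avoids n0 l k.+1 (fun=> 1)).
  under [X in prodE _ X - _]funext do rewrite expr0.
  under [X in Q * litE R n X]funext do rewrite expr0 mulr1.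
  rewrite (expect_cst ek) (expect_cst eL) (expect_cst (prodE_nseq_expectation k.+1 eL)).
  by rewrite !expr0; lra.
have avE c : (avoids l c)%:R = \prod_(l' <- c) (l'.1 != l.1)%:R :> R.
  by rewrite prod_bool.
have pW := gibbs_ge0 N0 SN.
have m1 := @replica_moment R _ _ fals' (gibbs N) (litE R n.+1) (fun=> 1) k.+1 m.+1
  pW (litE_expectation R (ltn0Sn n)).1.
have m2 := @replica_moment R _ _ fals' (gibbs N) (litE R n.+1)
  (fun l' => (l'.1 != l.1)%:R) k.+1 m.+1 pW (litE_expectation R (ltn0Sn n)).1.
have m3 := @replica_moment R _ _ (@falsified n) (gibbs N) (litE R n) (fun=> 1) 1 m.+1
  pW eL.1.
rewrite [X in X - _](_ : _ = prodE (nseq m.+1 (weighted (gibbs N)))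
   (fun X => litE R n.+1 (fun l' => 1 * overlap R fals' X l') ^+ k.+1)); last first.
  by rewrite -m1; congr prodE; apply/funext => c; rewrite big1_eq mul1r.
rewrite [X in _ - X](_ : _ = prodE (nseq m.+1 (weighted (gibbs N)))
   (fun X => litE R n.+1 (fun l' => (l'.1 != l.1)%:R * overlap R fals' X l') ^+ k.+1)); last first.
  by rewrite -m2; congr prodE; apply/funext => c; rewrite avE.
rewrite [litE R n _](_ : _ = prodE (nseq m.+1 (weighted (gibbs N)))
   (fun X => litE R n (fun l' => 1 * overlap R (@falsified n) X l') ^+ 1)); last first.
  rewrite -m3 /=; apply: (congr1 (litE R n)); apply/funext => l'.
  by rewrite big1_eq.
have pWs : all_prop (@positive_linear R (assignment n)) (nseq m.+1 (weighted (gibbs N))).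
  by apply: all_prop_nseq; exact: weighted_positive_linear.
have eWs := prodE_nseq_expectation m.+1 (weighted_gibbs_expectation N0 SN).
have -> : (0 : R) ^+ m.+1 = 0 by rewrite expr0n.
rewrite mulr0 add0r expr1n mulr1.
rewrite -(plB eWs.1) -(plZ eWs.1) -[X in X + _](expect_cst eWs) -(plD eWs.1).
apply: prodE_le_size => // X sX.
have X0 : X != [::] by rewrite -size_eq0 sX size_nseq.
set q := litE R n _ ^+ 1.
have qE : q = litE R n (overlap R (@falsified n) X).
  rewrite /q expr1; apply: (congr1 (litE R n)); apply/funext => l'; exact: mul1r.
have ovl (l' : literal n) : overlap R fals' X (lft l l') = overlap R (@falsified n) X l'.
  by rewrite /overlap; congr (nat_of_bool _)%:R; apply: eq_all => x; exact: falsified_ins.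
have ov1 : overlap R fals' X l = 0.
  by case: X X0 {sX q qE ovl} => // x X _; rewrite /overlap /= /fals' falsified_ins_l.
have ov2 : overlap R fals' X (negl l) = 1.
  by rewrite /overlap (_ : all _ _ = true)//; apply/allP => x _; exact: falsified_ins_negl.
have -> : litE R n.+1 (fun l' => 1 * overlap R fals' X l') = y / 2 + (1 - y) * q.
  rewrite (litE_split n0 l) ov1 ov2 !mul1r add0r mulr1 qE; congr (_ + _ * _).
  by apply: (congr1 (litE R n)); apply/funext => l' /=; rewrite mul1r ovl.
have -> : litE R n.+1 (fun l' => (l'.1 != l.1)%:R * overlap R fals' X l') = (1 - y) * q.
  rewrite (litE_split n0 l) /= !eqxx /= !mul0r addr0 mulr0 add0r qE; congr (_ * _).
  by apply: (congr1 (litE R n)); apply/funext => l' /=; rewrite eq_sym neq_lift mul1r ovl.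
rewrite [leRHS]addrC /Q /unit_rate -/y.
rewrite [2 * _ * q]mulrAC.
have ql : 0 <= q by rewrite qE litE_overlap_ge0.
apply: pow_excess_le; rewrite ?qE ?litE_overlap_le//.
- by rewrite divr_ge0// ltW.
- by rewrite mulr_ge0 ?subr_ge0// -qE.
- by rewrite -qE ler_piMl// gerBl ltW.
Qed.

(* Clauses that contain the variable of [l] are compared with random unit clauses:
   by [moment_domination] it suffices to compare all replica moments. *)
Lemma clause_elimination :
  clE n.+1 k.+1 i (fun e => log_ratio a (Nl e) (Dl e)) <=
  (1 - y) ^+ k.+1 * clE n k.+1 i
     (fun e => log_ratio a (fun x => N x * factor st e x) (fun x => D x * factor st e x)) +
  (1 - (1 - y) ^+ k.+1 - Q) * log_ratio a N D +
  Q * litE R n (fun l' => log_ratio a (fun x => N x * factor st (true, [:: l']) x) D) +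
  (y / 2) ^+ k.+1 * beta.
Proof.
pose r := expR (- a) * ((\sum_x D x) / \sum_x N x).
have r0 : 0 <= r by rewrite mulr_ge0 ?expR_ge0// divr_ge0// ltW.
have r1 : 0 < 1 + r by rewrite ltr_wpDr.
pose h v : R := ln (1 + r) + ln (1 - st i / (1 + r) * v) - ln (1 - st i * v).
have hE z : 0 <= z <= 1 -> h z = ln (1 + r / (1 - st i * z)).
  by move=> z01; rewrite /h -ln_ratio ?(st_ge0 hst) ?(st_lt1 hst).
have vE c : log_ratio a (Nl (i, c)) D = h (u c).
  by rewrite hE// (log_ratio_factor fals') ?(st_ge0 hst) ?(st_lt1 hst).
have vE' l' : log_ratio a (fun x => N x * factor st (i, [:: l']) x) D = h (v l').
  by rewrite hE// (log_ratio_factor (@falsified n)) ?(st_ge0 hst) ?(st_lt1 hst).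
have h0 : h 0 = log_ratio a N D by rewrite hE ?lexx ?ler01// mulr0 subr0 divr1.
have h1 : h 1 <= log_ratio a N D + beta.
  have -> : h 1 = log_ratio a (fun x => N x * (1 - st i)) D.
    rewrite hE ?lexx ?ler01// mulr1 /log_ratio -mulr_suml.
    by congr (ln (1 + _)); rewrite invfM /r !mulrA.
  apply: log_ratio_shift_le => //; [exact: beta_ge0 hst|exact: ltW|].
  rewrite -mulr_suml [leRHS]mulrC ler_wpM2r//; first exact: ltW.
  by case: (hst i).
have step1 : clE n.+1 k.+1 i (fun e => log_ratio a (Nl e) (Dl e)) =
  (1 - y) ^+ k.+1 * clE n k.+1 i
     (fun e => log_ratio a (fun x => N x * factor st e x) (fun x => D x * factor st e x)) +
  touch_functional h.
  rewrite /clE.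
  have -> : (fun c => log_ratio a (Nl (i, c)) (Dl (i, c))) =
     (fun c => (avoids l c)%:R * log_ratio a (Nl (i, c)) (fun x => D x * factor st (i, c) (ins l x)) +
               (~~ avoids l c)%:R * h (u c)).
    apply/funext => c; rewrite -vE /Dl /=; case: avoids; rewrite /= ?mul0r ?mul1r ?addr0 ?add0r//.
    by congr (log_ratio _ _ _); apply/funext => x; rewrite mulr1.
  rewrite (plD ek.1); congr (_ + _).
  rewrite (prodE_avoids n0 l k.+1 (fun c => log_ratio a (Nl (i, c)) (fun x => D x * factor st (i, c) (ins l x)))).
  congr (_ * _); congr prodE; apply/funext => c; congr (log_ratio _ _ _).
    by apply/funext => x; rewrite /Nl /factor /=; congr (_ * (1 - _ * _%:R)); rewrite -(violated_ins l x c).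
  by apply/funext => x; rewrite /factor /=; congr (_ * (1 - _ * _%:R)); rewrite -(violated_ins l x c).
rewrite step1 -!addrA lerD2l.
have dom : touch_functional h <= bound_functional h.
  apply: (moment_domination touch_uf bound_uf touch_moment).
  - by rewrite ln_ge0// lerDl.
  - by rewrite divr_ge0 ?(st_ge0 hst)// ltW.
  - by rewrite ler_pdivrMr// ler_peMr ?(st_ge0 hst)// lerDl.
  - exact: st_lt1 hst i.
apply: (le_trans dom); rewrite /bound_functional h0.
have hv : Q * litE R n (fun l' => 1 * h (v l')) <=
    Q * litE R n (fun l' => log_ratio a (fun x => N x * factor st (true, [:: l']) x) D).
  rewrite ler_wpM2l//; apply: (pl_le eL.1) => l'.
  by rewrite mul1r -vE' log_ratio_factor_ge_unit.
have hp : (y / 2) ^+ k.+1 * h 1 <= (y / 2) ^+ k.+1 * (log_ratio a N D + beta).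
  by rewrite ler_wpM2l// exprn_ge0// divr_ge0// ltW.
move: hv hp; set A := litE R n _; set B := litE R n _; lra.
Qed.

End Step.
End ClauseElimination.

Section LowTemperature.
Variables (R : realType) (st : bool -> R) (beta : R).
Hypothesis hst : forall i, 0 <= st i /\ expR (- beta) <= 1 - st i.
Hypothesis st_max : forall i, st i <= st true.
Variable k : nat.

Definition units n (b : seq (literal n)) : seq (entry n) := [seq (true, [:: l]) | l <- b].

Lemma log_ratio_ext (Omega : finType) a (N N' D D' : Omega -> R) :
  N =1 N' -> D =1 D' -> log_ratio a N D = log_ratio a N' D'.
Proof. by move=> /funext -> /funext ->. Qed.

(** Since e >= 2, lowering [a] by 1 absorbs a factor 2 in the numerator. *)
Lemma ln_ratio_double (a d d' m m' : R) : 0 <= d -> 0 <= d' -> 0 < m -> m <= m' ->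
  d' <= 2 * d -> ln (1 + expR (- a) * (d' / m')) <= ln (1 + expR (- (a - 1)) * (d / m)).
Proof.
move=> d0 d'0 m0 mm' dd; have m'0 : 0 < m' by exact: lt_le_trans mm'.
have pos b (p q : R) : 0 <= p -> 0 < q -> 0 < 1 + expR (- b) * (p / q).
  by move=> p0 q0; rewrite ltr_wpDr// mulr_ge0 ?expR_ge0// divr_ge0// ltW.
rewrite ler_ln ?posrE ?pos// lerD2l opprB addrC expRD -!mulrA.
rewrite ler_wpM2l ?expR_ge0// mulrA; apply: ler_pM => //.
- by rewrite invr_ge0 ltW.
- by apply: (le_trans dd); rewrite ler_wpM2r//; apply: le_trans (expR_ge1Dx 1); lra.
- by rewrite lef_pV2 ?posrE.
Qed.

Section Elimination.
Variables (n : nat) (l : literal n.+1).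
Hypothesis n0 : (0 < n)%N.
Let y : R := n.+1%:R^-1.
Let y0 : 0 < y. Proof. by rewrite invr_gt0. Qed.
Let y1 : y <= 1. Proof. by rewrite invf_le1// ler1n. Qed.
Let Q := unit_rate R k.+1 n.
Hypothesis hQ : Q + (y / 2) ^+ k.+1 <= 1 - (1 - y) ^+ k.+1.
Variable a : R.

Definition restricted_log_ratio (N D : assignment n -> R) (F : seq (entry n.+1)) : R :=
  log_ratio a (fun x => N x * wt st F (ins l x))
        (fun x => D x * wt st [seq e <- F | avoids l e.2] (ins l x)).

Definition restrictedE sigma N D : R :=
  formE n.+1 k.+1 sigma (restricted_log_ratio N D).

Let eL := litE_expectation R n0.
Let eLn := litE_expectation R (ltn0Sn n).
Let beta0 : 0 <= beta := beta_ge0 hst.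

Let q0 : 0 <= Q.
Proof.
rewrite mulr_ge0// subr_ge0 lerXn2r ?nnegrE ?addr_ge0 ?divr_ge0 ?invr_ge0// ?(ltW y0)//.
by rewrite lerDr divr_ge0// ltW.
Qed.

Lemma restrictedE_cons s sigma N D : (forall x, 0 < N x) -> (forall x, 0 < D x) ->
  restrictedE (s :: sigma) N D <=
  (1 - y) ^+ k.+1 * clE n k.+1 s (fun e =>
     restrictedE sigma (fun x => N x * factor st e x) (fun x => D x * factor st e x)) +
  (1 - (1 - y) ^+ k.+1 - Q) * restrictedE sigma N D +
  Q * litE R n (fun l' => restrictedE sigma (fun x => N x * factor st (true, [:: l']) x) D) +
  (y / 2) ^+ k.+1 * beta.
Proof.
move=> N0 D0; rewrite /restrictedE.
have eF := @formE_expectation R n.+1 k.+1 sigma isT.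
have eC := @clE_expectation R n k.+1 s n0.
rewrite (clE_swaps _ _ eF.1) /litE (avg_swaps eF.1).
rewrite -!(plZ eF.1) -!(plD eF.1) -(expectDr eF).
apply: (pl_le eF.1) => F.
have NF x : 0 < N x * wt st F (ins l x) by rewrite mulr_gt0// (wt_gt0 hst).
have DF x : 0 < D x * wt st [seq e <- F | avoids l e.2] (ins l x).
  by rewrite mulr_gt0// (wt_gt0 hst).
have H := clause_elimination hst st_max l s a n0 NF DF hQ.
apply: (le_trans _ (le_trans H _)).
  rewrite le_eqVlt; apply/orP; left; apply/eqP; apply: (congr1 (clE n.+1 k.+1 s)).
  apply/funext => e; apply: log_ratio_ext => x.
    by rewrite wt_cons; ring.
  rewrite /=; case: ifP => _; last by rewrite mulr1.
  by rewrite wt_cons; ring.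
rewrite lerD2r le_eqVlt; apply/orP; left; apply/eqP; congr (_ + _); first congr (_ + _).
  congr (_ * _); apply: (congr1 (clE n k.+1 s)); apply/funext => e.
  by apply: log_ratio_ext => x; rewrite mulrAC.
congr (_ * _); apply: (congr1 (litE R n)); apply/funext => e.
by apply: log_ratio_ext => x; rewrite // mulrAC.
Qed.

Definition unit_wt n (b : seq (literal n)) (x : assignment n) : R := wt st (units b) x.

Lemma unit_wt_cons m (l' : literal m) b x :
  unit_wt (l' :: b) x = factor st (true, [:: l']) x * unit_wt b x.
Proof. exact: wt_cons. Qed.

Lemma unit_wt_gt0 m (b : seq (literal m)) x : 0 < unit_wt b x.
Proof. exact: (wt_gt0 hst). Qed.

(* [E_F E_b ln (1 + e^-a Z(F) / Z(F, b))], for random clauses F and j random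
   unit clauses b. *)
Definition unit_cost m (sigma : seq bool) (j : nat) (c : R) : R :=
  formE m k.+1 sigma (fun F => prodE (nseq j (litE R m)) (fun b =>
    log_ratio c (fun x => wt st F x * unit_wt b x) (wt st F))).

(** [sigma1] holds the clauses still on n + 1 variables, [sigma2] those already on n. Each clause of
    [sigma1] moves to [sigma2], disappears, or raises j by one with weight [Q]; the weight e^(t j)
    turns this into a factor 1 + Q (e^t - 1). Empty clauses give the additive term. *)
Lemma restrictedE_bound (W0 t : R) (M : nat) sigma1 sigma2 j :
  0 <= W0 -> 0 <= t ->
  (forall sigma j, (size sigma <= M)%N -> unit_cost n sigma j a <= W0 * expR t ^+ j) ->
  (size sigma1 + size sigma2 <= M)%N ->
  formE n k.+1 sigma2 (fun F => prodE (nseq j (litE R n)) (fun b =>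
    restrictedE sigma1 (fun x => wt st F x * unit_wt b x) (wt st F))) <=
  W0 * expR t ^+ j * (1 + Q * (expR t - 1)) ^+ size sigma1 +
  (size sigma1)%:R * ((y / 2) ^+ k.+1 * beta).
Proof.
move=> W00 t0 hU.
elim: sigma1 sigma2 j => [|s sigma IH] sigma2 j.
  rewrite add0n => sM; rewrite expr0 mulr1 mul0r addr0.
  apply: le_trans (hU sigma2 j sM); rewrite le_eqVlt; apply/orP; left; apply/eqP.
  apply: (congr1 (formE n k.+1 sigma2)); apply/funext => F; congr prodE.
  apply/funext => b; rewrite /restrictedE /formE /restricted_log_ratio /=.
  by apply: log_ratio_ext => x; rewrite /wt big_nil mulr1.
rewrite [size (s :: _)]/= addSn -addnS => sM.
have eF := @formE_expectation R n k.+1 sigma2 n0.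
have eB := prodE_nseq_expectation j eL.
have eC := @clE_expectation R n k.+1 s n0.
set C := (y / 2) ^+ k.+1 * beta.
pose T sg s2 i := formE n k.+1 s2 (fun F => prodE (nseq i (litE R n)) (fun b =>
    restrictedE sg (fun x => wt st F x * unit_wt b x) (wt st F))).
have H : T (s :: sigma) sigma2 j <= (1 - y) ^+ k.+1 * T sigma (s :: sigma2) j +
   (1 - (1 - y) ^+ k.+1 - Q) * T sigma sigma2 j + Q * T sigma sigma2 j.+1 + C.
  have -> : T sigma (s :: sigma2) j = formE n k.+1 sigma2 (fun F =>
     prodE (nseq j (litE R n)) (fun b => clE n k.+1 s (fun e =>
       restrictedE sigma (fun x => wt st F x * unit_wt b x * factor st e x)
         (fun x => wt st F x * factor st e x)))).
    rewrite /T {1}/formE /=; apply: (congr1 (formE n k.+1 sigma2)); apply/funext => F.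
    rewrite (clE_swaps _ _ eB.1); congr prodE; apply/funext => b.
    apply: (congr1 (clE n k.+1 s)); apply/funext => e.
    apply: (congr1 (formE n.+1 k.+1 sigma)); apply/funext => G.
    by apply: log_ratio_ext => x; rewrite wt_cons; ring.
  have -> : T sigma sigma2 j.+1 = formE n k.+1 sigma2 (fun F =>
     prodE (nseq j (litE R n)) (fun b => litE R n (fun l' =>
       restrictedE sigma (fun x => wt st F x * unit_wt b x * factor st (true, [:: l']) x)
         (wt st F)))).
    apply: (congr1 (formE n k.+1 sigma2)); apply/funext => F /=; congr prodE.
    apply/funext => b; apply: (congr1 (litE R n)); apply/funext => l'.
    apply: (congr1 (formE n.+1 k.+1 sigma)); apply/funext => G.
    by apply: log_ratio_ext => x; rewrite // unit_wt_cons; ring.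
  rewrite /T -!(plZ eF.1) -!(plD eF.1) -(expectDr eF); apply: (pl_le eF.1) => F.
  rewrite -!(plZ eB.1) -!(plD eB.1) -(expectDr eB); apply: (pl_le eB.1) => b.
  apply: restrictedE_cons => x; last exact: (wt_gt0 hst).
  by rewrite mulr_gt0 ?unit_wt_gt0// (wt_gt0 hst).
apply: (le_trans H) => {H}.
have sM' : (size sigma + size sigma2 <= M)%N by rewrite (leq_trans _ sM)// leq_add2l.
have h1 := IH (s :: sigma2) j sM.
have h2 := IH sigma2 j sM'.
have h3 := IH sigma2 j.+1 sM'.
rewrite -/(T sigma (s :: sigma2) j) in h1; rewrite -/(T sigma sigma2 j) in h2.
rewrite -/(T sigma sigma2 j.+1) in h3.
have p0 : 0 <= (1 - y) ^+ k.+1 by rewrite exprn_ge0// subr_ge0.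
have pk0 : 0 <= (y / 2) ^+ k.+1 by rewrite exprn_ge0// divr_ge0// ltW.
have pq0 : 0 <= 1 - (1 - y) ^+ k.+1 - Q by move: hQ; lra.
have g1 := ler_wpM2l p0 h1; have g2 := ler_wpM2l pq0 h2; have g3 := ler_wpM2l q0 h3.
rewrite -natr1 [_ ^+ (size sigma).+1]exprS.
rewrite exprS in g3.
set U := W0 * expR t ^+ j in g1 g2 g3 *.
set V := (1 + _) ^+ _ in g1 g2 g3 *.
rewrite [W0 * (expR t * _)]mulrCA -/U in g3.
move: g1 g2 g3; set m := (size sigma)%:R; set T1 := T _ _ _; set T2 := T _ _ _.
set T3 := T _ _ _; rewrite -/C; set p := (1 - y) ^+ k.+1; set e := expR t; lra.
Qed.

(** A pending unit clause equal to the negation of [l], of probability y / 2, costs at most beta;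
    one equal to [l] is satisfied, which costs no more than a random unit clause on the other
    variables. *)
Lemma units_restrict (D : assignment n -> R) (N : assignment n -> R) j :
  (forall x, 0 < N x) -> (forall x, 0 < D x) ->
  prodE (nseq j (litE R n.+1)) (fun b => log_ratio a (fun x => N x * unit_wt b (ins l x)) D) <=
  prodE (nseq j (litE R n)) (fun b => log_ratio a (fun x => N x * unit_wt b x) D) +
  j%:R * (y / 2 * beta).
Proof.
move=> N0 D0.
have SD : 0 <= \sum_x D x by exact/ltW/asg_sum_gt0.
have one (N' : assignment n -> R) : (forall x, 0 < N' x) ->
    litE R n.+1 (fun l' => log_ratio a (fun x => N' x * factor st (true, [:: l']) (ins l x)) D) <=
    litE R n (fun l' => log_ratio a (fun x => N' x * factor st (true, [:: l']) x) D) + y / 2 * beta.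
  move=> N'0; rewrite (litE_split n0 l).
  have SN : 0 < \sum_x N' x by exact: asg_sum_gt0.
  set g := litE R n (fun l' => log_ratio a (fun x => N' x * factor st (true, [:: l']) x) D).
  have -> : litE R n ((fun l' => log_ratio a (fun x => N' x * factor st (true, [:: l']) (ins l x)) D)
      \o lft l) = g.
    apply: (congr1 (litE R n)); apply/funext => l' /=; apply: log_ratio_ext => // x.
    by rewrite /factor /viol /violated /= falsified_ins.
  have g1 : log_ratio a N' D <= g.
    apply: (expect_ge_cst eL) => l'; apply: log_ratio_le => //.
      by apply: asg_sum_gt0 => x; rewrite mulr_gt0// (factor_gt0 hst).
    by apply: ler_sum => x _; rewrite ler_piMr ?(factor_le1 hst)// ltW.
  have -> : log_ratio a (fun x => N' x * factor st (true, [:: l]) (ins l x)) D = log_ratio a N' D.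
    apply: log_ratio_ext => // x.
    by rewrite /factor /viol /violated /= falsified_ins_l mulr0 subr0 mulr1.
  have h2 : log_ratio a (fun x => N' x * factor st (true, [:: negl l]) (ins l x)) D <=
      log_ratio a N' D + beta.
    apply: log_ratio_shift_le => //; rewrite mulr_sumr; apply: ler_sum => x _.
    by rewrite mulrC ler_wpM2l ?(factor_ge hst)// ltW.
  have yy : 0 <= y / 2 by rewrite divr_ge0// ltW.
  have h3 := ler_wpM2l yy (lerD (lexx (log_ratio a N' D)) h2).
  have h4 := ler_wpM2l (ltW y0) g1.
  by move: h3 h4; rewrite -/y; lra.
elim: j N N0 => [|j IH] N N0.
  rewrite mul0r addr0 /= le_eqVlt; apply/orP; left; apply/eqP.
  by apply: log_ratio_ext => // x; rewrite /unit_wt /wt !big_nil.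
have eBn := prodE_nseq_expectation j eLn.
have eB := prodE_nseq_expectation j eL.
rewrite /=.
apply: (@le_trans _ _ (prodE (nseq j (litE R n.+1)) (fun b => litE R n (fun l' =>
   log_ratio a (fun x => N x * factor st (true, [:: l']) x * unit_wt b (ins l x)) D) + y / 2 * beta))).
  apply: (pl_le eBn.1) => b.
  have Nb x : 0 < N x * unit_wt b (ins l x) by rewrite mulr_gt0// unit_wt_gt0.
  have H := one _ Nb; apply: (le_trans _ (le_trans H _)).
    rewrite le_eqVlt; apply/orP; left; apply/eqP.
    apply: (congr1 (litE R n.+1)); apply/funext => l'; apply: log_ratio_ext => // x.
    by rewrite unit_wt_cons; ring.
  rewrite lerD2r le_eqVlt; apply/orP; left; apply/eqP.
  by apply: (congr1 (litE R n)); apply/funext => l'; apply: log_ratio_ext => // x; ring.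
rewrite (expectDr eBn) [j.+1%:R](mulrSr 1 j) mulrDl mul1r addrA lerD2r.
rewrite -(avg_swaps eBn.1) -(avg_swaps eB.1) -(expectDr eL).
apply: (pl_le eL.1) => l'.
have Nl x : 0 < N x * factor st (true, [:: l']) x by rewrite mulr_gt0// (factor_gt0 hst).
apply: (le_trans (IH _ Nl)); rewrite lerD2r le_eqVlt; apply/orP; left; apply/eqP.
by congr prodE; apply/funext => b; apply: log_ratio_ext => // x; rewrite unit_wt_cons mulrA.
Qed.

(** In the denominator only the assignments with [l] true are kept. In the numerator the clauses on
    the variable of [l] are deleted; then both its values have equal weight, and the resulting
    factor 2 is paid by [a - 1]. *)
Lemma unit_elimination F b :
  log_ratio a (fun x => wt st F x * unit_wt (l :: b) x) (wt st F) <=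
  log_ratio (a - 1) (fun x => wt st F (ins l x) * unit_wt b (ins l x))
    (fun x => wt st [seq e <- F | avoids l e.2] (ins l x)).
Proof.
set F' := [seq e <- F | avoids l e.2].
have N0 x : 0 < wt st F (ins l x) * unit_wt b (ins l x).
  by rewrite mulr_gt0 ?unit_wt_gt0// (wt_gt0 hst).
have D'0 : 0 < \sum_x wt st F' (ins l x).
  by apply: asg_sum_gt0 => x; exact: (wt_gt0 hst).
have D0 : 0 < \sum_x wt st F x by exact: (part_gt0 hst).
have SN : 0 < \sum_x wt st F (ins l x) * unit_wt b (ins l x) by exact: asg_sum_gt0.
have le_N : \sum_x wt st F (ins l x) * unit_wt b (ins l x) <=
     \sum_x wt st F x * unit_wt (l :: b) x.
  rewrite (sum_assignment l) -[leLHS]addr0; apply: lerD.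
    apply: ler_sum => x _; rewrite unit_wt_cons.
    by rewrite /factor /viol /violated /= falsified_ins_l mulr0 subr0 mul1r.
  by apply: sumr_ge0 => x _; rewrite ltW// mulr_gt0 ?unit_wt_gt0// (wt_gt0 hst).
have le_D : \sum_x wt st F x <= 2 * \sum_x wt st F' (ins l x).
  have leF x : wt st F x <= wt st F' x.
    rewrite /wt /F' big_filter [leRHS]big_mkcond/=; apply: ler_prod => e _.
    rewrite ltW ?(factor_gt0 hst)//=; case: ifP => // _; exact: (factor_le1 hst).
  rewrite (sum_assignment l) mulr2n mulrDl mul1r; apply: lerD; apply: ler_sum => x _.
    exact: leF.
  apply: (le_trans (leF _)); rewrite /wt /F' !big_filter le_eqVlt; apply/orP; left.
  apply/eqP; apply: eq_bigr => e; rewrite /factor /avoids => av.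
  congr (1 - _ * _%:R); congr nat_of_bool; rewrite /viol /violated.
  apply: eq_in_all => l' /(allP av) ll'; rewrite /falsified !ffunE.
  by case: unliftP ll' => [j ->|->]; rewrite ?eqxx.
by rewrite /log_ratio; apply: ln_ratio_double => //; exact: ltW.
Qed.

End Elimination.
End LowTemperature.

(** * Low temperature *)

Section LowTemperatureBound.
Variables (R : realType) (st : bool -> R) (beta : R).
Hypothesis hst : forall i, 0 <= st i /\ expR (- beta) <= 1 - st i.
Hypothesis st_max : forall i, st i <= st true.
Variable k : nat.

Local Notation unit_cost := (unit_cost st k).
Local Notation p n := (n.+1%:R^-1 / 2 : R).

Lemma unit_cost_step n (W0 t a : R) (M : nat) sigma j : (0 < n)%N ->
  unit_rate R k.+1 n + p n ^+ k.+1 <= 1 - (1 - n.+1%:R^-1) ^+ k.+1 ->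
  0 <= W0 -> 0 <= t ->
  (forall sigma j, (size sigma <= M)%N -> unit_cost n sigma j (a - 1) <= W0 * expR t ^+ j) ->
  (size sigma <= M)%N ->
  unit_cost n.+1 sigma j.+1 a <=
  W0 * expR t ^+ j * (1 + unit_rate R k.+1 n * (expR t - 1)) ^+ size sigma +
  (size sigma)%:R * (p n ^+ k.+1 * beta) + j%:R * (p n * beta).
Proof.
move=> n0 hQ W00 t0 hU sM.
have eLn := litE_expectation R (ltn0Sn n).
have eL := litE_expectation R n0.
have eF := @formE_expectation R n.+1 k.+1 sigma isT.
have eBn := prodE_nseq_expectation j eLn.
have eB := prodE_nseq_expectation j eL.
have sw f : formE n.+1 k.+1 sigma (fun F => prodE (nseq j (litE R n.+1)) (fun b =>
    litE R n.+1 (fun l => f F b l))) =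
  litE R n.+1 (fun l => formE n.+1 k.+1 sigma (fun F => prodE (nseq j (litE R n.+1))
    (fun b => f F b l))).
  rewrite /litE (avg_swaps eF.1); apply: (congr1 (formE n.+1 k.+1 sigma)).
  by apply/funext => F; rewrite (avg_swaps eBn.1).
rewrite /unit_cost /= sw; apply: (expect_le_cst eLn) => l.
pose w' F x := wt st [seq e <- F | avoids l e.2] (ins l x).
apply: (@le_trans _ _ (formE n.+1 k.+1 sigma (fun F => prodE (nseq j (litE R n)) (fun b =>
    log_ratio (a - 1) (fun x => wt st F (ins l x) * unit_wt st b x) (w' F)) +
    j%:R * (p n * beta)))).
  apply: (pl_le eF.1) => F.
  have wF x : 0 < wt st F (ins l x) by exact: (wt_gt0 hst).
  have wF' x : 0 < w' F x by exact: (wt_gt0 hst).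
  apply: le_trans (units_restrict hst l n0 (a - 1) j wF wF').
  by apply: (pl_le eBn.1) => b; exact: unit_elimination.
rewrite (expectDr eF) lerD2r.
rewrite -(prodE_swaps (As := nseq j (litE R n)) (B := formE n.+1 k.+1 sigma)); last first.
  by apply: all_prop_nseq; apply: avg_swaps; exact: eF.1.
have H := restrictedE_bound hst st_max l n0 hQ (a := a - 1) (sigma1 := sigma) (sigma2 := [::])
  j W00 t0 hU.
apply: le_trans (H _); last by rewrite addn0.
rewrite {1}/formE /= le_eqVlt; apply/orP; left; apply/eqP; congr prodE.
apply/funext => b; apply: (congr1 (formE n.+1 k.+1 sigma)); apply/funext => F.
by apply: log_ratio_ext => x; rewrite /wt big_nil mul1r// mulrC.
Qed.

(** An upper bound suited to the recursion: the shift from [a] to [a - 1] multiplies it by exactly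
    e^theta, for negative [a] as well. *)
Lemma ln1p_expR_le (theta a : R) : 0 < theta -> theta <= 1 ->
  ln (1 + expR (- a)) <= expR (- (theta * a)) / theta.
Proof.
move=> th0 th1; rewrite ler_pdivlMr//.
have e0 : 0 < 1 + expR (- a) by rewrite addr_gt0// expR_gt0.
have [a0|/ltW a0] := leP 0 a.
  apply: (@le_trans _ _ (expR (- a))); last by rewrite ler_expR lerN2 ler_piMl.
  apply: (@le_trans _ _ (ln (1 + expR (- a)))).
    by rewrite ler_piMr// ln_ge0// lerDl expR_ge0.
  by rewrite -[leRHS]expRK ler_ln ?posrE ?expR_gt0// expR_ge1Dx.
apply: (@le_trans _ _ (1 - theta * a)); last exact: expR_ge1Dx.
have : ln (1 + expR (- a)) <= 1 - a.
  rewrite -[leRHS]expRK ler_ln ?posrE ?expR_gt0// expRD.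
  have e1 : 1 <= expR (- a) by rewrite -expR0 ler_expR oppr_ge0.
  have := ler_wpM2r (expR_ge0 (- a)) (expR_ge1Dx (1 : R)); lra.
move=> h; apply: (@le_trans _ _ ((1 - a) * theta)); first by rewrite ler_wpM2r// ltW.
by rewrite mulrBl mul1r [a * _]mulrC lerD2r.
Qed.

Lemma unit_cost0 n sigma a : (0 < n)%N -> unit_cost n sigma 0 a = ln (1 + expR (- a)).
Proof.
move=> n0; have eF := @formE_expectation R n k.+1 sigma n0.
rewrite /unit_cost /= -[RHS](expect_cst eF); apply: (congr1 (formE n k.+1 sigma)).
apply/funext => F; rewrite /log_ratio.
have -> : \sum_x wt st F x * unit_wt st [::] x = \sum_x wt st F x.
  by apply: eq_bigr => x _; rewrite /unit_wt /wt big_nil mulr1.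
by rewrite divff ?mulr1// gt_eqF// (part_gt0 hst).
Qed.

Lemma unit_cost_crude n sigma j a : (0 < n)%N ->
  unit_cost n sigma j a <= ln (1 + expR (- a)) + j%:R * beta.
Proof.
move=> n0; have eF := @formE_expectation R n k.+1 sigma n0.
have eB := prodE_nseq_expectation j (litE_expectation R n0).
rewrite -(expect_cst eF (_ + _)); apply: (pl_le eF.1) => F.
rewrite -(expect_cst eB (_ + _)); apply: prodE_le_size => [|b sb].
  by apply: all_prop_nseq; exact: (litE_expectation R n0).1.
have S0 : 0 < \sum_x wt st F x by exact: (part_gt0 hst).
have -> : ln (1 + expR (- a)) = log_ratio a (wt st F) (wt st F).
  by rewrite /log_ratio divff ?mulr1// gt_eqF.
have b0 := beta_ge0 hst.
apply: log_ratio_shift_le => //; [exact: mulr_ge0|exact: ltW|].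
rewrite mulr_sumr; apply: ler_sum => x _; rewrite mulrC ler_wpM2l//.
  exact/ltW/(wt_gt0 hst).
move: sb; rewrite size_nseq => <- {j eB}; elim: b => [|l b IH].
  by rewrite mul0r oppr0 expR0 /unit_wt /wt big_nil.
rewrite unit_wt_cons /= -natr1 mulrDl mul1r opprD expRD mulrC.
by apply: ler_pM; rewrite ?expR_ge0// (factor_ge hst).
Qed.

(** Each elimination gains e^-theta by the third condition on [n]. This cancels the factor e^theta
    that the first summand picks up from [a - 1]; it leaves b0 (1 - e^-theta) to pay the additive
    errors; and it makes the last summand, which is the crude bound at [n1], decay. *)
Lemma unit_cost_bound (t theta b0 : R) (M n1 n : nat) :
  0 < t -> 0 < theta -> theta <= 1 -> 0 <= b0 -> (0 < n1)%N ->
  (forall n, (n1 <= n)%N ->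
     [/\ unit_rate R k.+1 n + p n ^+ k.+1 <= 1 - (1 - n.+1%:R^-1) ^+ k.+1,
         0 <= unit_rate R k.+1 n,
         (1 + unit_rate R k.+1 n * (expR t - 1)) ^+ M <= expR t * expR (- theta) &
         M%:R * (p n ^+ k.+1 * beta) <= p n * beta /\
         p n * beta <= b0 * (1 - expR (- theta)) * t]) ->
  (n1 <= n)%N -> forall sigma j a, (size sigma <= M)%N ->
  unit_cost n sigma j a <=
    (expR (- (theta * a)) / theta + b0 + beta / t * expR (- (theta * (n - n1)%:R)))
    * expR t ^+ j.
Proof.
move=> t0 th0 th1 b00 n10 hyp; have beta0 := beta_ge0 hst.
have te1 j : 1 <= expR t ^+ j by rewrite exprn_ege1// -expR0 ler_expR ltW.
have tej j : t * j%:R <= expR t ^+ j.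
  by rewrite -expRM_natr (le_trans _ (expR_ge1Dx _))// lerDr.
elim: n => [|n IH] n1n; first by move: n1n; rewrite leqNgt n10.
have crude m sigma j a : (0 < m)%N -> unit_cost m sigma j a <=
    expR (- (theta * a)) / theta + beta / t * expR t ^+ j.
  move=> m0; apply: (le_trans (unit_cost_crude _ _ _ m0)); apply: lerD.
    exact: ln1p_expR_le.
  by rewrite mulrC -mulrA ler_wpM2l// mulrC ler_pdivlMr// mulrC.
have [nn1|n1n'] := leqP n.+1 n1.
  have {n1n nn1} <- : n.+1 = n1 by apply/eqP; rewrite eqn_leq n1n nn1.
  move=> sigma j a _; apply: (le_trans (crude _ sigma j a _)) => //.
  rewrite subnn mulr0 oppr0 expR0 mulr1 mulrDl lerD2r.
  have e0 : 0 <= expR (- (theta * a)) / theta by rewrite divr_ge0 ?expR_ge0 ?ltW.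
  apply: (@le_trans _ _ (expR (- (theta * a)) / theta + b0)); first by rewrite lerDl.
  by rewrite ler_peMr// addr_ge0.
rewrite ltnS in n1n'; have {IH} IH := IH n1n'.
have n0 : (0 < n)%N by exact: leq_trans n1n'.
have [hQ Q0 hM [hp1 hp2]] := hyp n n1n'.
have c0 m : 0 <= beta / t * expR (- (theta * m)) :> R.
  by rewrite mulr_ge0 ?expR_ge0//; apply: divr_ge0 => //; exact: ltW.
have eth0 a : 0 <= expR a / theta by apply: divr_ge0; [exact: expR_ge0|exact: ltW].
move=> sigma [|j] a sM.
  rewrite unit_cost0// expr0 mulr1; apply: (le_trans (ln1p_expR_le a th0 th1)).
  by rewrite -addrA lerDl addr_ge0.
set W0 := expR (- (theta * (a - 1))) / theta + b0 + beta / t * expR (- (theta * (n - n1)%:R)).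
have W00 : 0 <= W0 by rewrite !addr_ge0.
have hU sg i : (size sg <= M)%N -> unit_cost n sg i (a - 1) <= W0 * expR t ^+ i.
  exact: IH.
apply: (le_trans (unit_cost_step j n0 hQ W00 (ltW t0) hU sM)).
have Qe : 1 <= 1 + unit_rate R k.+1 n * (expR t - 1).
  by rewrite lerDl mulr_ge0// subr_ge0 -expR0 ler_expR ltW.
have h1 : W0 * expR t ^+ j * (1 + unit_rate R k.+1 n * (expR t - 1)) ^+ size sigma <=
    W0 * expR (- theta) * expR t ^+ j.+1.
  rewrite exprS [leRHS](_ : _ = W0 * expR t ^+ j * (expR t * expR (- theta))); last by ring.
  rewrite ler_wpM2l ?mulr_ge0 ?exprn_ge0 ?expR_ge0//.
  by apply: le_trans hM; exact: ler_weXn2l.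
have W0E : W0 * expR (- theta) = expR (- (theta * a)) / theta + b0 * expR (- theta) +
    beta / t * expR (- (theta * (n.+1 - n1)%:R)).
  rewrite /W0 subSn// !mulrDl; congr (_ + _ + _).
    by rewrite mulrAC -expRD; congr (expR _ / _); ring.
  by rewrite -mulrA -expRD; congr (_ * expR _); rewrite -natr1; ring.
have h2 : (size sigma)%:R * (p n ^+ k.+1 * beta) + j%:R * (p n * beta) <=
    b0 * (1 - expR (- theta)) * expR t ^+ j.+1.
  apply: (@le_trans _ _ (j.+1%:R * (p n * beta))).
    rewrite [j.+1%:R](mulrSr 1 j) mulrDl mul1r addrC lerD2l; apply: le_trans hp1.
    by rewrite ler_wpM2r ?ler_nat// mulr_ge0// exprn_ge0// divr_ge0.
  apply: (@le_trans _ _ (j.+1%:R * (b0 * (1 - expR (- theta)) * t))).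
    by rewrite ler_wpM2l.
  rewrite [leLHS](_ : _ = b0 * (1 - expR (- theta)) * (t * j.+1%:R)); last by ring.
  apply: ler_wpM2l; last exact: tej.
  by rewrite mulr_ge0// subr_ge0 -expR0 ler_expR oppr_le0 ltW.
rewrite -addrA; apply: (le_trans (lerD h1 h2)).
rewrite W0E -mulrDl ler_wpM2r ?exprn_ge0 ?expR_ge0//.
rewrite le_eqVlt; apply/orP; left; apply/eqP; ring.
Qed.

End LowTemperatureBound.

(** * Exchange of temperatures clause by clause *)

Section MeanLogPartition.
Variable R : realType.

Definition cE n k : op R (seq (literal n)) := prodE (nseq k (litE R n)).
Arguments cE : clear implicits.

Definition lnZ n (s : R) (G : seq (seq (literal n))) : R :=
  ln (\sum_(x : assignment n) \prod_(c <- G) (1 - s * (viol x c)%:R)).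

(* Unlike in [prob_kSAT], the literals of a clause are independent, and may
   repeat a variable. *)
Definition mean_lnZ k n (M : nat) (beta : R) : R :=
  prodE (nseq M (cE n k)) (lnZ (1 - expR (- beta))).

Lemma formE_nseq n k M b phi :
  formE n k (nseq M b) phi = prodE (nseq M (cE n k)) (fun G => phi (map (pair b) G)).
Proof. by elim: M phi => [|M IH] phi //=; rewrite /formE /= -/(formE _ _ _) IH. Qed.

Lemma formE_cat n k s1 s2 phi : formE n k (s1 ++ s2) phi =
  formE n k s2 (fun G => formE n k s1 (fun F => phi (F ++ G))) :> R.
Proof. by rewrite /formE map_cat prodE_cat. Qed.

Lemma lnpart_tag n st b (G : seq (seq (literal n))) :
  lnpart st (map (pair b) G) = lnZ (st b) G.
Proof.
by rewrite /lnpart /part /lnZ; congr ln; apply: eq_bigr => x _; rewrite /wt big_map.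
Qed.

Definition two_temp (B beta : R) (b : bool) : R := 1 - expR (- (if b then beta else B)).

Lemma two_tempP B beta : 0 <= B -> B <= beta ->
  forall i, 0 <= two_temp B beta i /\ expR (- beta) <= 1 - two_temp B beta i.
Proof.
move=> B0 Bb i; have b0 := le_trans B0 Bb.
rewrite /two_temp subKr; split; first by rewrite subr_ge0 expR_le1 oppr_le0; case: i.
by rewrite ler_expR lerN2; case: i.
Qed.

Lemma two_temp_max B beta : 0 <= B -> B <= beta ->
  forall i, two_temp B beta i <= two_temp B beta true.
Proof. by move=> B0 Bb [] //; rewrite /two_temp lerD2l lerN2 ler_expR lerN2. Qed.

(** For v in {0, 1}, e^(-B v) <= e^(-beta v) + e^-B. Summed against the weight of [F] this is the
    origin of the form of [log_ratio]. *)
Lemma swap_temperature B beta n (F : seq (entry n)) c (st := two_temp B beta) :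
  0 <= B -> B <= beta ->
  lnpart st ((false, c) :: F) - lnpart st ((true, c) :: F) <=
  log_ratio B (fun x => wt st F x * factor st (true, c) x) (wt st F).
Proof.
move=> B0 Bb; have hst := two_tempP B0 Bb.
have Zt0 : 0 < \sum_x wt st F x * factor st (true, c) x.
  by apply: asg_sum_gt0 => x; rewrite mulr_gt0 ?(wt_gt0 hst) ?(factor_gt0 hst).
have Z0 : 0 < \sum_x wt st F x by exact: (part_gt0 hst).
have E b : part st ((b, c) :: F) = \sum_x wt st F x * factor st (b, c) x.
  by apply: eq_bigr => x _; rewrite wt_cons mulrC.
rewrite /lnpart -ln_div ?posrE ?(part_gt0 hst)// !E.
have Zf0 : 0 < \sum_x wt st F x * factor st (false, c) x.
  by apply: asg_sum_gt0 => x; rewrite mulr_gt0 ?(wt_gt0 hst) ?(factor_gt0 hst).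
rewrite ler_ln ?posrE ?divr_gt0//; last first.
  by rewrite ltr_wpDr// mulr_ge0 ?expR_ge0// divr_ge0// ltW.
rewrite ler_pdivrMr// mulrDl mul1r mulrA mulfVK ?gt_eqF// mulr_sumr -big_split/=.
apply: ler_sum => x _; rewrite mulrC -subr_ge0.
have wx := wt_gt0 hst F x.
rewrite (_ : _ - _ = wt st F x * (expR (- B) - (st true - st false) * (viol x c)%:R)).
  rewrite mulr_ge0 ?(ltW wx)// subr_ge0 /st /two_temp.
  by case: viol; rewrite ?mulr1 ?mulr0 ?expR_ge0//; have := expR_ge0 (- beta); lra.
by rewrite /factor /=; ring.
Qed.

Lemma mean_lnZ_swap B beta k n i j (st := two_temp B beta) : (0 < n)%N -> 0 <= B -> B <= beta ->
  formE n k.+1 (nseq i true ++ false :: nseq j false) (@lnpart R st n) -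
  formE n k.+1 (nseq i true ++ true :: nseq j false) (@lnpart R st n) <=
  unit_cost st k n (nseq i true ++ nseq j false) 1 B.
Proof.
move=> n0 B0 Bb; have hst := two_tempP B0 Bb; have smax := two_temp_max B0 Bb.
set s1 := nseq i true; set s2 := nseq j false.
have e1 := @formE_expectation R n k.+1 s1 n0.
have e2 := @formE_expectation R n k.+1 s2 n0.
have eC := prodE_nseq_expectation k.+1 (litE_expectation R n0).
have E s : formE n k.+1 (s1 ++ s :: s2) (@lnpart R st n) =
   formE n k.+1 s2 (fun G => formE n k.+1 s1 (fun F => cE n k.+1 (fun c =>
     lnpart st ((s, c) :: F ++ G)))).
  rewrite formE_cat {1}/formE /=; congr prodE; apply/funext => G.
  rewrite (clE_swaps _ _ e1.1).
  apply: (congr1 (formE n k.+1 s1)); apply/funext => F.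
  by apply: (congr1 (cE n k.+1)); apply/funext => c; rewrite /lnpart part_insert.
rewrite !E -(plB e2.1) /unit_cost formE_cat.
apply: (pl_le e2.1) => G; rewrite -(plB e1.1); apply: (pl_le e1.1) => F.
have wF x : 0 < wt st (F ++ G) x by exact: (wt_gt0 hst).
have H := clause_le_unit hst smax k true B n0 wF wF.
rewrite -(plB eC.1); apply: (le_trans _ (le_trans H _)).
  by apply: (pl_le eC.1) => c; exact: swap_temperature.
rewrite /= le_eqVlt; apply/orP; left; apply/eqP; apply: (congr1 (litE R n)).
apply/funext => l; apply: log_ratio_ext => // x.
by rewrite unit_wt_cons /unit_wt /wt big_nil mulr1.
Qed.

Lemma mean_lnZ_diff_le B beta k n M (d : R) : (0 < n)%N -> 0 <= B -> B <= beta ->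
  (forall sigma, (size sigma <= M)%N ->
     unit_cost (two_temp B beta) k n sigma 1 B <= d) ->
  mean_lnZ k.+1 n M B - mean_lnZ k.+1 n M beta <= M%:R * d.
Proof.
move=> n0 B0 Bb hd; pose st := two_temp B beta.
pose T i := formE n k.+1 (nseq i true ++ nseq (M - i) false) (@lnpart R st n).
have T0 : T 0%N = mean_lnZ k.+1 n M B.
  rewrite /T /= subn0 formE_nseq; congr prodE; apply/funext => G.
  by rewrite lnpart_tag.
have TM : T M = mean_lnZ k.+1 n M beta.
  rewrite /T subnn cats0 formE_nseq; congr prodE; apply/funext => G.
  by rewrite lnpart_tag.
suff H i : (i <= M)%N -> T 0%N - T i <= i%:R * d by rewrite -T0 -TM; exact: H.
elim: i => [|i IH] iM; first by rewrite subrr mul0r.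
rewrite -natr1 mulrDl mul1r -(subrK (T i) (T 0%N)) -addrA; apply: lerD; first exact: IH (ltnW iM).
rewrite /T -(subnSK iM) /=.
have E m s : true :: nseq m true ++ s = nseq m true ++ true :: s by elim: m => //= m ->.
rewrite E.
apply: (le_trans (mean_lnZ_swap k i (M - i.+1) n0 B0 Bb)); apply: hd.
by rewrite size_cat !size_nseq -[leqRHS](subnKC (ltnW iM)) leq_add2l leq_sub2l.
Qed.

End MeanLogPartition.
Arguments cE {R} n k.

(** * Subcritical constants for the elimination *)

Section LowTemperatureEstimate.
Variable R : realType.

(** Clauses of two literals are the critical case; a further literal roughly halves the previous
    bound and adds at most y / 4. Thus M clauses create about M / (n + 1) unit clauses per
    elimination, which is where density below 1 enters. *)
Lemma unit_rate_le n k (y : R := n.+1%:R^-1) : (1 <= n)%N ->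
  unit_rate R k.+2 n <= y * (1 + y).
Proof.
move=> n1.
have y0 : 0 < y by rewrite invr_gt0.
have y2 : y <= 2^-1 by rewrite lef_pV2 ?posrE// ler_nat.
rewrite /unit_rate -/y.
elim: k => [|k IH]; first by rewrite !expr2; nra.
have b0 : 0 <= (2^-1 : R) ^+ k.+2 by rewrite exprn_ge0.
have b1 : (2^-1 : R) ^+ k.+2 <= 4^-1.
  rewrite !exprS mulrA; apply: (@le_trans _ _ (2^-1 * 2^-1)); last by lra.
  by rewrite ler_piMr// exprn_ile1//; lra.
rewrite [_ ^+ k.+3]exprS [2^-1 ^+ k.+3]exprS.
move: IH b0 b1; set A := (_ + _) ^+ _; set C := 2^-1 ^+ _ => IH b0 b1.
have h : (1 + y) / 2 * (2 * (A - C)) <= (1 + y) / 2 * (y * (1 + y)).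
  by rewrite ler_wpM2l//; lra.
have h2 : y * C <= y * 4^-1 by rewrite ler_wpM2l// ltW.
have h3 : (1 + y) / 2 * (y * (1 + y)) + y * 4^-1 <= y * (1 + y).
  have : 0 <= y * (4^-1 - y ^+ 2 / 2).
    by rewrite mulr_ge0 ?(ltW y0)// expr2; nra.
  by rewrite expr2; lra.
lra.
Qed.

Lemma unit_rate_ge0 n k : 0 <= unit_rate R k n.
Proof.
rewrite /unit_rate mulr_ge0// subr_ge0 lerXn2r ?nnegrE ?addr_ge0 ?divr_ge0 ?invr_ge0//.
by rewrite lerDr divr_ge0.
Qed.

Lemma expr_le_sqr (z : R) k : 0 <= z -> z <= 1 -> z ^+ k.+2 <= z * z.
Proof.
move=> z0 z1; rewrite !exprS mulrA ler_piMr ?mulr_ge0//.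
exact: exprn_ile1.
Qed.

Lemma unit_rate_feasible n k : (3 <= n)%N ->
  unit_rate R k.+2 n + (n.+1%:R^-1 / 2) ^+ k.+2 <= 1 - (1 - n.+1%:R^-1) ^+ k.+2.
Proof.
move=> n3; have n1 : (1 <= n)%N by exact: leq_trans n3.
have h := unit_rate_le k n1; rewrite /= in h.
set y := n.+1%:R^-1 in h *.
have y0 : 0 < y by rewrite invr_gt0.
have y4 : y <= 4^-1 by rewrite lef_pV2 ?posrE// ler_nat.
have h1 := @expr_le_sqr (y / 2) k ltac:(lra) ltac:(lra).
have h2 := @expr_le_sqr (1 - y) k ltac:(lra) ltac:(lra).
nra.
Qed.

Lemma expR_le_quad (t : R) : 0 <= t -> t <= 2^-1 -> expR t - 1 <= t + 2 * t ^+ 2.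
Proof.
move=> t0 t2.
have h := expR_ge1Dx (- t); rewrite expRN in h.
have t1 : 0 < 1 - t by lra.
have : expR t <= (1 - t)^-1.
  by rewrite -[leLHS]invrK lef_pV2 ?posrE ?invr_gt0 ?expR_gt0.
have -> : (1 - t)^-1 = 1 + t + t ^+ 2 / (1 - t) by rewrite expr2; field; rewrite gt_eqF.
have : t ^+ 2 / (1 - t) <= t ^+ 2 * 2.
  rewrite ler_wpM2l ?exprn_ge0// -[leRHS]invrK lef_pV2 ?posrE ?invr_gt0//; lra.
lra.
Qed.

(* The relative rate of implied unit clauses stays below [g < 1] until a
   fraction [1 - rho] of the variables has been eliminated. *)
Lemma low_temperature (alpha : R) (k : nat) : 0 <= alpha -> alpha < 1 ->
  exists C theta : R, exists N0 : nat, [/\ 0 < C, 0 < theta &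
  forall N M (B beta : R), (N0 <= N)%N -> M%:R <= alpha * N%:R -> 0 <= B -> B <= beta ->
    mean_lnZ k.+2 N M B - mean_lnZ k.+2 N M beta <=
    C * (N%:R * expR (- (theta * B)) + beta)].
Proof.
move=> a0 a1.
(* As long as at least about rho N variables remain, M / (n + 1) is at most alpha / rho < 1. *)
pose rho : R := (1 + alpha) / 2.
have rho2 : 2^-1 <= rho by rewrite /rho; lra.
have rho0 : 0 < rho by lra.
have rho1 : rho < 1 by rewrite /rho; lra.
have ar1 : alpha / rho < 1 by rewrite ltr_pdivrMr// mul1r /rho; lra.
have ar0 : 0 <= alpha / rho by rewrite divr_ge0// ltW.
(* The midpoint between alpha / rho and 1 leaves room for the correction factor 1 + y in
   [unit_rate_le]. *)
pose g : R := (1 + alpha / rho) / 2.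
have g1 : g < 1 by rewrite /g; lra.
have g0 : 0 < g by rewrite /g; lra.
(* With these [t] and [theta], t - theta exceeds g (t + 2 t^2) by t (1 - g)^2 / 2, which gives the
   contraction. *)
pose t : R := (1 - g) / 4.
have t0 : 0 < t by rewrite /t; lra.
pose theta : R := t * (1 - g) / 2.
have th0 : 0 < theta by rewrite /theta divr_gt0// mulr_gt0//; lra.
have th1 : theta <= 1 by rewrite /theta /t; nra.
have eth : 0 < 1 - expR (- theta) by rewrite subr_gt0 expR_lt1 oppr_lt0.
have [N0 hN0] : exists N0 : nat, forall N, (N0 <= N)%N ->
   8 / (1 - alpha) + 8 / (1 - rho) + 8 <= N%:R :> R.
  exists (Num.truncn (8 / (1 - alpha) + 8 / (1 - rho) + 8 : R)).+1 => N hN.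
  apply: (@le_trans _ _ (Num.truncn (8 / (1 - alpha) + 8 / (1 - rho) + 8 : R)).+1%:R).
    by rewrite ltW// truncnS_gt.
  by rewrite ler_nat.
pose C1 : R := expR t / theta.
pose C2 : R := expR t * (((1 - expR (- theta)) * t)^-1 + (t * theta * (1 - rho) / 2)^-1).
have C10 : 0 < C1 by rewrite divr_gt0 ?expR_gt0.
have C20 : 0 < C2.
  have h : 0 < t * theta * (1 - rho) / 2 by rewrite divr_gt0// mulr_gt0 ?subr_gt0// mulr_gt0.
  by apply: mulr_gt0; [exact: expR_gt0|apply: addr_gt0; rewrite invr_gt0// mulr_gt0].
exists (C1 + C2), theta, N0; split => //; first by rewrite addr_gt0.
move=> N M B beta /hN0 NN MN B0 Bb.
have beta0 : 0 <= beta by exact: le_trans Bb.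
have i1 : 0 < 8 / (1 - alpha) by rewrite divr_gt0// subr_gt0.
have i2 : 0 < 8 / (1 - rho) by rewrite divr_gt0// subr_gt0.
have N8 : 8 <= N%:R :> R by lra.
have Npos : 0 < N%:R :> R by lra.
have Na : 8 <= (1 - alpha) * N%:R.
  by rewrite mulrC -ler_pdivrMr ?subr_gt0//; lra.
have Nr : 8 <= (1 - rho) * N%:R.
  by rewrite mulrC -ler_pdivrMr ?subr_gt0//; lra.
pose n1 := Num.truncn (rho * N%:R).
have rN0 : 0 <= rho * N%:R by apply: mulr_ge0; apply: ltW.
have n1le : n1%:R <= rho * N%:R by rewrite truncn_le.
have n1lt : rho * N%:R < n1.+1%:R by rewrite truncnS_gt.
have n13 : (3 <= n1)%N.
  by rewrite truncn_ge_nat//; nra.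
have n1N : (n1 <= N)%N.
  by rewrite -(ler_nat R) (le_trans n1le)// ler_piMl// ltW.
(* Solves b0 (1 - e^-theta) t = beta / N, which dominates the cost y beta / 2 because n + 1 > rho N
   >= N / 2. *)
pose b0 : R := beta / (N%:R * ((1 - expR (- theta)) * t)).
have b00 : 0 <= b0 by apply: divr_ge0 => //; rewrite ltW// mulr_gt0// mulr_gt0.
have N_n0 : (0 < N)%N by rewrite -(ltr_nat R).
pose d := (expR (- (theta * B)) / theta + b0 + beta / t * expR (- (theta * (N - n1)%:R))) * expR t.
have Md : mean_lnZ k.+2 N M B - mean_lnZ k.+2 N M beta <= M%:R * d.
  apply: mean_lnZ_diff_le => // sigma sM.
  rewrite /d -[X in _ * X]expr1.
  apply: (unit_cost_bound (two_tempP B0 Bb) (two_temp_max B0 Bb) t0 th0 th1 b00 _ _ n1N) sM.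
    exact: leq_trans n13.
  move=> n n1n; have n3 : (3 <= n)%N by exact: leq_trans n1n.
  have n_1 : (1 <= n)%N by exact: leq_trans n3.
  have Q0 := unit_rate_ge0 n k.+2.
  have hQ := unit_rate_feasible k n3.
  have Qle := unit_rate_le k n_1; rewrite /= in Qle.
  set y := n.+1%:R^-1 in hQ Qle *.
  have y0 : 0 < y by rewrite invr_gt0.
  have rNy : rho * N%:R * y <= 1.
    rewrite ler_pdivrMr// mul1r (le_trans (ltW n1lt))// ler_nat ltnS //.
  have My : M%:R * y <= alpha / rho.
    rewrite ler_pdivlMr//.
    apply: (@le_trans _ _ (alpha * (rho * N%:R * y))).
      rewrite [leRHS](_ : _ = alpha * N%:R * (y * rho)); last by ring.
      by rewrite -[leLHS]mulrA ler_wpM2r// mulr_ge0// ltW.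
    by rewrite ler_piMr.
  have ysmall : y <= (1 - alpha) / 4.
    have : (1 - alpha) / 4 * (rho * N%:R) >= 1 by nra.
    move=> h; rewrite -(ler_pM2r (_ : 0 < rho * N%:R)); last by rewrite mulr_gt0.
    by rewrite mulrC; apply: le_trans rNy h.
  have MQ : M%:R * unit_rate R k.+2 n <= g.
    apply: (@le_trans _ _ (M%:R * (y * (1 + y)))); first by rewrite ler_wpM2l.
    rewrite mulrA; apply: (@le_trans _ _ (alpha / rho * (1 + y))).
      by rewrite ler_wpM2r// addr_ge0// ltW.
    have : alpha / rho * (1 + y) <= alpha / rho + y.
      by rewrite mulrDr mulr1 lerD2l ler_piMl// ltW.
    have : (1 - alpha) / 2 <= 1 - alpha / rho.
      have -> : 1 - alpha / rho = (1 - alpha) / (2 * rho).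
        rewrite /rho; field; rewrite gt_eqF//; lra.
      rewrite ler_wpM2l ?subr_ge0 ?(ltW a1)// lef_pV2 ?posrE// ; lra.
    rewrite /g; lra.
  split => //.
    apply: (@le_trans _ _ (expR (M%:R * unit_rate R k.+2 n * (expR t - 1)))).
      rewrite -mulrA expRM_natl lerXn2r ?nnegrE ?expR_ge0//.
        by rewrite addr_ge0// mulr_ge0// subr_ge0 -expR0 ler_expR ltW.
      exact: expR_ge1Dx.
    rewrite -expRD ler_expR.
    have t2 : t <= 2^-1 by rewrite /t; lra.
    have q := expR_le_quad (ltW t0) t2.
    have e0 : 0 <= expR t - 1 by rewrite subr_ge0 -expR0 ler_expR ltW.
    apply: (@le_trans _ _ (g * (t + 2 * t ^+ 2))).
      by apply: ler_pM => //; rewrite mulr_ge0.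
    have -> : t - theta = t * (1 - (1 - g) / 2) by rewrite /theta; ring.
    have -> : g * (t + 2 * t ^+ 2) = t * (g + 2 * g * t) by rewrite expr2; ring.
    rewrite ler_wpM2l ?(ltW t0)// /t; nra.
  have y2 : 0 <= y / 2 by rewrite divr_ge0// ltW.
  split.
    rewrite mulrA ler_wpM2r//.
    have y21 : y / 2 <= 1 by lra.
    apply: (@le_trans _ _ (M%:R * ((y / 2) * (y / 2)))).
      by rewrite ler_wpM2l// expr_le_sqr.
    rewrite mulrA ler_piMl//; lra.
  have yN : y / 2 <= N%:R^-1.
    rewrite -[leRHS]mul1r ler_pdivlMr// ; nra.
  have -> : b0 * (1 - expR (- theta)) * t = N%:R^-1 * beta.
    by rewrite /b0; field; rewrite !gt_eqF.
  by rewrite ler_wpM2r.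
apply: (le_trans Md).
apply: (@le_trans _ _ (N%:R * d)).
  have d0 : 0 <= d.
    apply: mulr_ge0; last exact: expR_ge0.
    apply: addr_ge0; first apply: addr_ge0 => //.
      by apply: divr_ge0; [exact: expR_ge0|exact: ltW].
    by apply: mulr_ge0; [apply: divr_ge0 => //; exact: ltW|exact: expR_ge0].
  by rewrite ler_wpM2r// (le_trans MN)// ler_piMl// ltW.
have m0 : (1 - rho) * N%:R / 2 <= (N - n1)%:R.
  rewrite natrB//; nra.
(* The bound e^-x <= 1/x is enough: it cancels the prefactor N and leaves a multiple of beta. *)
have ex : expR (- (theta * (N - n1)%:R)) <= (theta * ((1 - rho) * N%:R / 2))^-1.
  have h0 : 0 < theta * ((1 - rho) * N%:R / 2) by rewrite mulr_gt0//; nra.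
  rewrite expRN lef_pV2 ?posrE ?expR_gt0//.
  apply: (@le_trans _ _ (theta * (N - n1)%:R)); first by rewrite ler_wpM2l// ltW.
  by apply: le_trans (expR_ge1Dx _); rewrite lerDr.
have h1 : N%:R * d <= N%:R * expR (- (theta * B)) * C1 + beta * C2.
  rewrite /d /C1 /C2.
  have -> : N%:R * expR (- (theta * B)) * (expR t / theta) + beta * (expR t *
     (((1 - expR (- theta)) * t)^-1 + (t * theta * (1 - rho) / 2)^-1)) =
     N%:R * ((expR (- (theta * B)) / theta + b0 +
        beta / t * (theta * ((1 - rho) * N%:R / 2))^-1) * expR t).
    rewrite /b0; field.
    by rewrite (gt_eqF eth) !gt_eqF//= ?subr_gt0//.
  rewrite ler_wpM2l ?(ltW Npos)// ler_wpM2r ?expR_ge0// lerD2l ler_wpM2l//.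
  by rewrite divr_ge0// ltW.
apply: (le_trans h1).
have h2 : 0 <= N%:R * expR (- (theta * B)) by rewrite mulr_ge0 ?expR_ge0.
nra.
Qed.
End LowTemperatureEstimate.

(** * Interpolation in the number of variables *)

Section Binomial.
Variable R : realType.
Implicit Types p q : R.

(** Expectation of [psi] under the binomial law with M trials, conditioned on one trial at a time;
    this matches the clause by clause recursion of [blocks_decouple]. *)
Fixpoint binE p (M : nat) (psi : nat -> R) : R :=
  if M is M'.+1 then p * binE p M' (fun m => psi m.+1) + (1 - p) * binE p M' psi
  else psi 0%N.

Lemma binE_expectation p M : 0 <= p <= 1 -> expectation (binE p M).
Proof.
move=> /andP[p0 p1]; have q0 : 0 <= 1 - p by rewrite subr_ge0.
elim: M => [|M [[D Z L] O]].
  by split => //; split => // f g fg; exact: fg.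
split; first split; rewrite /=.
- by move=> f g; rewrite !D; ring.
- by move=> c f; rewrite !Z; ring.
- by move=> f g fg; apply: lerD; apply: ler_wpM2l => //; exact: L.
- by rewrite O !mulr1 addrC subrK.
Qed.

Lemma binE1 M psi : binE 1 M psi = psi M.
Proof. by elim: M psi => //= M IH psi; rewrite !IH subrr mul0r addr0 mul1r. Qed.

Lemma binE_thinning p q M psi : 0 <= q <= 1 ->
  binE q M (fun m => binE p m psi) = binE (q * p) M psi.
Proof.
move=> q01; elim: M psi => [//|M IH] psi /=.
have eq := binE_expectation M q01.
by rewrite (plD eq.1) !(plZ eq.1) !IH; ring.
Qed.

Lemma binE_id p M : 0 <= p <= 1 -> binE p M (fun m => m%:R) = M%:R * p.
Proof.
move=> p01; elim: M => [|M IH] /=; first by rewrite mul0r.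
have e := binE_expectation M p01.
have -> : (fun m => m.+1%:R) = (fun m => m%:R + 1) :> (nat -> R).
  by apply/funext => m; rewrite -natr1.
by rewrite (expectDr e) IH -natr1; ring.
Qed.

Lemma binE_sqr p M c : 0 <= p <= 1 ->
  binE p M (fun m => (m%:R - c) ^+ 2) = M%:R * p * (1 - p) + (M%:R * p - c) ^+ 2.
Proof.
move=> p01; elim: M => [|M IH] /=; first by ring.
have e := binE_expectation M p01.
have -> : (fun m => (m.+1%:R - c) ^+ 2) =
    (fun m => (m%:R - c) ^+ 2 + (2 * m%:R + (1 - 2 * c))) :> (nat -> R).
  by apply/funext => m; rewrite -natr1; ring.
by rewrite (plD e.1) (expectDr e) (plZ e.1) IH binE_id// -[M.+1%:R]natr1; ring.
Qed.

End Binomial.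

Section Interpolation.
Variables (R : realType) (s : R) (beta : R).
Hypothesis hs : 0 <= s /\ expR (- beta) <= 1 - s.
Variable k : nat.

Let st (_ : bool) := s.
Let hst i : 0 <= st i /\ expR (- beta) <= 1 - st i. Proof. exact: hs. Qed.

(** The arbitrary weight [w] absorbs the clauses already treated, so that inductions on the number
    of clauses close. *)
Definition lnZw n (w : assignment n -> R) (G : seq (seq (literal n))) : R :=
  ln (\sum_x w x * \prod_(c <- G) (1 - s * (viol x c)%:R)).

Definition add_clause n (w : assignment n -> R) (c : seq (literal n)) x : R :=
  w x * (1 - s * (viol x c)%:R).

Lemma lnZw_cons n w c (G : seq (seq (literal n))) : lnZw w (c :: G) = lnZw (add_clause w c) G.
Proof. by congr ln; apply: eq_bigr => x _; rewrite big_cons mulrA. Qed.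

Lemma add_clause_gt0 n (w : assignment n -> R) c :
  (forall x, 0 < w x) -> forall x, 0 < add_clause w c x.
Proof. by move=> w0 x; rewrite mulr_gt0// (factor_gt0 hst (true, c)). Qed.

Lemma clauses_gt0 n (w : assignment n -> R) (G : seq (seq (literal n))) :
  (forall x, 0 < w x) -> forall x, 0 < w x * \prod_(c <- G) (1 - s * (viol x c)%:R).
Proof.
move=> w0 x; rewrite mulr_gt0//; apply: prodr_gt0 => c _.
exact: (factor_gt0 hst (true, c)).
Qed.

Lemma prodE_cons_swap n (A : op R (seq (literal n))) (B : op R (seq (literal n))) M w :
  positive_linear B -> (forall U (C : op R U), positive_linear C -> swaps A C) ->
  prodE (nseq M A) (fun G => B (fun c => lnZw w (c :: G))) =
  B (fun c => prodE (nseq M A) (lnZw (add_clause w c))).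
Proof.
move=> pB sA; rewrite (prodE_swaps (B := B)); last by apply: all_prop_nseq; exact: sA.
apply: (congr1 B); apply/funext => c; congr prodE; apply/funext => G.
exact: lnZw_cons.
Qed.

Lemma cE_expectation n j : (0 < n)%N -> expectation (@cE R n j).
Proof. by move=> n0; apply: prodE_nseq_expectation; exact: litE_expectation. Qed.

Lemma cE_swaps n j U (C : op R U) : positive_linear C -> swaps (@cE R n j) C.
Proof. by move=> pC; apply: prodE_swaps; apply: all_prop_nseq; exact: avg_swaps. Qed.

Section TwoBlocks.
Variables n1 n2 : nat.
Hypotheses (n1_gt0 : (0 < n1)%N) (n2_gt0 : (0 < n2)%N).
Let n := (n1 + n2)%N.
Let p : R := n1%:R / n%:R.

Definition lsh (l : literal n1) : literal n := (lshift n2 l.1, l.2).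
Definition rsh (l : literal n2) : literal n := (rshift n1 l.1, l.2).

Definition block1 : op R (literal n) := fun f => litE R n1 (f \o lsh).
Definition block2 : op R (literal n) := fun f => litE R n2 (f \o rsh).

Definition blockE : op R (seq (literal n)) :=
  fun f => p * prodE (nseq k block1) f + (1 - p) * prodE (nseq k block2) f.

Let n0 : (0 < n)%N. Proof. by rewrite addn_gt0 n1_gt0. Qed.

Lemma p01 : 0 <= p <= 1.
Proof.
by rewrite divr_ge0//= ler_pdivrMr ?ltr0n// mul1r ler_nat leq_addr.
Qed.

Lemma oneBp : 1 - p = n2%:R / n%:R.
Proof. by rewrite /p /n natrD; field; rewrite -natrD pnatr_eq0 -lt0n. Qed.

Lemma block1_expectation : expectation block1.
Proof.
have [[D Z L] O] := litE_expectation R n1_gt0.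
by split => //; split => [f g|c f|f g fg]; rewrite /block1; [exact: D|exact: Z|apply: L => l; exact: fg].
Qed.

Lemma block2_expectation : expectation block2.
Proof.
have [[D Z L] O] := litE_expectation R n2_gt0.
by split => //; split => [f g|c f|f g fg]; rewrite /block2; [exact: D|exact: Z|apply: L => l; exact: fg].
Qed.

Lemma litE_blocks f : litE R n f = p * block1 f + (1 - p) * block2 f.
Proof.
rewrite oneBp /block1 /block2 /litE /avg !card_prod !card_ord !card_bool.
have E m (g : literal m -> R) : \sum_l g l = \sum_(i < m) (g (i, true) + g (i, false)).
  rewrite (eq_bigr (fun q => g (q.1, q.2))); last by case.
  rewrite -(pair_bigA_idem _ (fun i b => g (i, b)))//=; last by rewrite addr0.
  by apply: eq_bigr => i _; rewrite big_bool.
rewrite !E big_split_ord /= mulrDr.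
have nz : n%:R != 0 :> R by rewrite pnatr_eq0 -lt0n.
have nz1 : n1%:R != 0 :> R by rewrite pnatr_eq0 -lt0n.
have nz2 : n2%:R != 0 :> R by rewrite pnatr_eq0 -lt0n.
congr (_ + _); rewrite mulrA; congr (_ * _); rewrite /p !natrM; field; rewrite -?natrD.
  by rewrite nz nz1.
by rewrite nz nz2.
Qed.

Lemma blockE_expectation : expectation blockE.
Proof.
have [[D1 Z1 L1] O1] := prodE_nseq_expectation k block1_expectation.
have [[D2 Z2 L2] O2] := prodE_nseq_expectation k block2_expectation.
have /andP[p0 p1] := p01.
rewrite /blockE; split; first split.
- by move=> f g; rewrite D1 D2; ring.
- by move=> c f; rewrite Z1 Z2; ring.
- by move=> f g fg; apply: lerD; rewrite ler_wpM2l ?subr_ge0// ?L1 ?L2.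
- by rewrite O1 O2; ring.
Qed.

Lemma blockE_swaps U (C : op R U) : positive_linear C -> swaps blockE C.
Proof.
move=> pC f; rewrite /blockE.
have s1 : swaps (prodE (nseq k block1)) C.
  by apply: prodE_swaps; apply: all_prop_nseq => g; rewrite /block1 /litE -(avg_swaps pC).
have s2 : swaps (prodE (nseq k block2)) C.
  by apply: prodE_swaps; apply: all_prop_nseq => g; rewrite /block2 /litE -(avg_swaps pC).
by rewrite (plD pC) !(plZ pC) -s1 -s2.
Qed.

Lemma blocks_le M (w : assignment n -> R) : (forall x, 0 < w x) ->
  prodE (nseq M blockE) (lnZw w) <= prodE (nseq M (cE n k)) (lnZw w).
Proof.
elim: M w => [//|M IH] w w0 /=.
have eM := prodE_nseq_expectation M (cE_expectation k n0).
rewrite (prodE_cons_swap _ _ blockE_expectation.1 blockE_swaps).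
apply: (@le_trans _ _ (prodE (nseq M (cE n k)) (fun G => blockE (fun c => lnZw w (c :: G))))).
  rewrite (prodE_cons_swap _ _ blockE_expectation.1 (fun U C => @cE_swaps n k U C)).
  by apply: (pl_le blockE_expectation.1) => c; apply: IH; exact: add_clause_gt0.
apply: (pl_le eM.1) => G.
have w0' := clauses_gt0 G w0.
have := mixture_le hst k true p01 (litE_expectation R n0)
  block1_expectation block2_expectation litE_blocks w0'.
have -> // : ln_with st (fun x => w x * \prod_(c <- G) (1 - s * (viol x c)%:R)) true =
   (fun c => lnZw w (c :: G)).
apply/funext => c; rewrite /ln_with /lnZw; congr ln; apply: eq_bigr => x _.
by rewrite big_cons /factor /st /=; ring.
Qed.

Definition pair_wt (w1 : assignment n1 -> R) (w2 : assignment n2 -> R) (x : assignment n) : R :=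
  w1 [ffun i : 'I_n1 => x (lshift n2 i)] * w2 [ffun i : 'I_n2 => x (rshift n1 i)].

Lemma sum_pair_wt w1 w2 : \sum_x pair_wt w1 w2 x = (\sum_x w1 x) * \sum_x w2 x.
Proof.
rewrite big_distrlr pair_bigA /=.
pose f (x : assignment n) : assignment n1 * assignment n2 :=
  ([ffun i : 'I_n1 => x (lshift n2 i)], [ffun i : 'I_n2 => x (rshift n1 i)]).
pose f' (z : assignment n1 * assignment n2) : assignment n :=
  [ffun i : 'I_n => match fintype.split i with inl j => z.1 j | inr j => z.2 j end].
rewrite (reindex f) //; exists f' => [x _|[x1 x2] _].
  apply/ffunP => i; rewrite ffunE.
  by case: splitP => j ij; rewrite ffunE; congr (x _); apply: val_inj; rewrite /= ij.
congr pair; apply/ffunP => j; rewrite !ffunE.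
  by have := unsplitK (inl j : 'I_n1 + 'I_n2); rewrite /= => ->.
by have := unsplitK (inr j : 'I_n1 + 'I_n2); rewrite /= => ->.
Qed.

Lemma prodE_block1 j f : prodE (nseq j block1) f = cE n1 j (fun c => f (map lsh c)).
Proof. by elim: j f => [//|j IH] f /=; rewrite IH /cE. Qed.

Lemma prodE_block2 j f : prodE (nseq j block2) f = cE n2 j (fun c => f (map rsh c)).
Proof. by elim: j f => [//|j IH] f /=; rewrite IH /cE. Qed.

Lemma pair_wt_lsh w1 w2 c :
  add_clause (pair_wt w1 w2) (map lsh c) = pair_wt (add_clause w1 c) w2.
Proof.
apply/funext => x; rewrite /add_clause /pair_wt.
have -> : viol x (map lsh c) = viol [ffun i : 'I_n1 => x (lshift n2 i)] c.
  rewrite /viol /violated all_map; apply: eq_all => l.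
  by rewrite /falsified /= ffunE.
ring.
Qed.

Lemma pair_wt_rsh w1 w2 c :
  add_clause (pair_wt w1 w2) (map rsh c) = pair_wt w1 (add_clause w2 c).
Proof.
apply/funext => x; rewrite /add_clause /pair_wt.
have -> : viol x (map rsh c) = viol [ffun i : 'I_n2 => x (rshift n1 i)] c.
  rewrite /viol /violated all_map; apply: eq_all => l.
  by rewrite /falsified /= ffunE.
ring.
Qed.

(** Clauses confined to a block make the partition function a product, and the number of clauses in
    each block is binomial. *)
Lemma blocks_decouple M w1 w2 : (forall x, 0 < w1 x) -> (forall x, 0 < w2 x) ->
  prodE (nseq M blockE) (lnZw (pair_wt w1 w2)) =
  binE p M (fun m => prodE (nseq m (cE n1 k)) (lnZw w1)) +
  binE (1 - p) M (fun m => prodE (nseq m (cE n2 k)) (lnZw w2)).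
Proof.
elim: M w1 w2 => [|M IH] w1 w2 w10 w20 /=.
  have E m (w : assignment m -> R) : lnZw w [::] = ln (\sum_x w x).
    by congr ln; apply: eq_bigr => x _; rewrite big_nil mulr1.
  by rewrite !E sum_pair_wt lnM// posrE asg_sum_gt0.
have /andP[p0 p1] := p01.
have q01 : 0 <= 1 - p <= 1 by rewrite subr_ge0 p1 gerBl.
have e1 := binE_expectation M p01; have e2 := binE_expectation M q01.
have c1 := cE_expectation k n1_gt0; have c2 := cE_expectation k n2_gt0.
rewrite (prodE_cons_swap _ _ blockE_expectation.1 blockE_swaps) {1}/blockE.
rewrite prodE_block1 prodE_block2.
have -> : cE n1 k (fun c => prodE (nseq M blockE) (lnZw (add_clause (pair_wt w1 w2) (map lsh c)))) =
    binE p M (fun m => prodE (nseq m.+1 (cE n1 k)) (lnZw w1)) +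
    binE (1 - p) M (fun m => prodE (nseq m (cE n2 k)) (lnZw w2)).
  have -> : binE p M (fun m => prodE (nseq m.+1 (cE n1 k)) (lnZw w1)) =
      cE n1 k (fun c => binE p M (fun m => prodE (nseq m (cE n1 k)) (lnZw (add_clause w1 c)))).
    rewrite (cE_swaps _ e1.1); apply: (congr1 (binE p M)); apply/funext => m /=.
    exact: (prodE_cons_swap _ _ c1.1 (fun U C => @cE_swaps n1 k U C)).
  rewrite -(expectDr c1); apply: (congr1 (cE n1 k)); apply/funext => c.
  by rewrite pair_wt_lsh IH//; exact: add_clause_gt0.
have -> : cE n2 k (fun c => prodE (nseq M blockE) (lnZw (add_clause (pair_wt w1 w2) (map rsh c)))) =
    binE (1 - p) M (fun m => prodE (nseq m.+1 (cE n2 k)) (lnZw w2)) +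
    binE p M (fun m => prodE (nseq m (cE n1 k)) (lnZw w1)).
  have -> : binE (1 - p) M (fun m => prodE (nseq m.+1 (cE n2 k)) (lnZw w2)) =
      cE n2 k (fun c => binE (1 - p) M (fun m => prodE (nseq m (cE n2 k)) (lnZw (add_clause w2 c)))).
    rewrite (cE_swaps _ e2.1); apply: (congr1 (binE (1 - p) M)); apply/funext => m /=.
    exact: (prodE_cons_swap _ _ c2.1 (fun U C => @cE_swaps n2 k U C)).
  rewrite -(expectDr c2); apply: (congr1 (cE n2 k)); apply/funext => c.
  by rewrite pair_wt_rsh IH// 1?addrC//; exact: add_clause_gt0.
by rewrite /=; ring.
Qed.

End TwoBlocks.
End Interpolation.

Section MeanProperties.
Variables (R : realType) (k : nat) (beta : R).
Hypothesis beta0 : 0 <= beta.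

Let s : R := 1 - expR (- beta).
Let st (_ : bool) : R := s.

Lemma strengthP : 0 <= s /\ expR (- beta) <= 1 - s.
Proof. by rewrite /s subKr subr_ge0 expR_le1 oppr_le0. Qed.

Let hst (i : bool) : 0 <= st i /\ expR (- beta) <= 1 - st i. Proof. exact: strengthP. Qed.

Lemma lnZ_insert n (F G : seq (seq (literal n))) c :
  lnZ s (F ++ G) - beta <= lnZ s (F ++ c :: G) <= lnZ s (F ++ G).
Proof.
rewrite -!(lnpart_tag st true) !map_cat /=.
by rewrite (lnpart_insert_ge hst) (lnpart_insert_le hst).
Qed.

Lemma mean_lnZ0 n : mean_lnZ k n 0 beta = n%:R * ln 2.
Proof.
rewrite /mean_lnZ /= /lnZ.
under eq_bigr do rewrite big_nil.
rewrite sumr_const card_ffun card_bool card_ord natrX.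
by elim: n => [|n IH]; rewrite ?expr0 ?ln1 ?mul0r// exprS lnM ?posrE ?exprn_gt0// IH -natr1; ring.
Qed.

Lemma mean_lnZS n M : (0 < n)%N ->
  mean_lnZ k n M beta - beta <= mean_lnZ k n M.+1 beta <= mean_lnZ k n M beta.
Proof.
move=> n0; have eC := cE_expectation R k n0; have eM := prodE_nseq_expectation M eC.
rewrite /mean_lnZ /= -(expectDr eM); apply/andP; split; apply: (pl_le eM.1) => G.
  by apply: (expect_ge_cst eC) => c; have /andP[] := lnZ_insert [::] G c.
by apply: (expect_le_cst eC) => c; have /andP[] := lnZ_insert [::] G c.
Qed.

Lemma mean_lnZ_add n M j : (0 < n)%N ->
  mean_lnZ k n M beta - j%:R * beta <= mean_lnZ k n (M + j) beta <= mean_lnZ k n M beta.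
Proof.
move=> n0; elim: j => [|j IH]; first by rewrite mul0r subr0 addn0 lexx.
have := mean_lnZS (M + j) n0; rewrite addnS; move: IH.
by rewrite -[j.+1%:R]natr1 mulrDl mul1r; lra.
Qed.

Lemma mean_lnZ_le n M : (0 < n)%N -> mean_lnZ k n M beta <= n%:R * ln 2.
Proof. by move=> n0; rewrite -mean_lnZ0; have /andP[] := mean_lnZ_add 0 M n0. Qed.

Lemma mean_lnZ_ge n M : (0 < n)%N -> n%:R * ln 2 - M%:R * beta <= mean_lnZ k n M beta.
Proof. by move=> n0; rewrite -mean_lnZ0; have /andP[] := mean_lnZ_add 0 M n0. Qed.

(** [mean_lnZ] is beta-Lipschitz in the number of clauses. Replacing |m - c| by a quadratic bound
    with free parameter [tau] means that only binomial variances have to be computed. *)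
Lemma mean_lnZ_lip n m c (tau : R) : (0 < n)%N -> 0 < tau ->
  mean_lnZ k n c beta - beta * ((m%:R - c%:R) ^+ 2 / (2 * tau) + tau / 2) <=
  mean_lnZ k n m beta.
Proof.
move=> n0 tau0.
have h : mean_lnZ k n c beta - beta * `|m%:R - c%:R| <= mean_lnZ k n m beta.
  have [mc|cm] := leqP m c.
    have := mean_lnZ_add m (c - m) n0; rewrite subnKC// => /andP[_ h].
    by apply: le_trans h; rewrite gerBl mulr_ge0.
  have := mean_lnZ_add c (m - c) n0; rewrite subnKC ?(ltnW cm)// => /andP[h _].
  apply: le_trans h; rewrite lerD2l lerN2 natrB ?(ltnW cm)// mulrC ler_wpM2l//.
  exact: ler_norm.
apply: le_trans h; rewrite lerD2l lerN2 ler_wpM2l//.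
rewrite -real_normK ?num_real//; set z := `|_|.
have -> : z ^+ 2 / (2 * tau) + tau / 2 = z + (z - tau) ^+ 2 / (2 * tau).
  by field; rewrite gt_eqF.
by rewrite lerDl divr_ge0 ?sqr_ge0// mulr_ge0// ltW.
Qed.

Lemma mean_lnZ_superadd n1 n2 M (p := n1%:R / (n1 + n2)%:R) : (0 < n1)%N -> (0 < n2)%N ->
  binE p M (fun m => mean_lnZ k n1 m beta) + binE (1 - p) M (fun m => mean_lnZ k n2 m beta) <=
  mean_lnZ k (n1 + n2) M beta.
Proof.
move=> n10 n20.
have E n (G : seq (seq (literal n))) : lnZ s G = lnZw s (fun=> 1) G.
  by congr ln; apply: eq_bigr => x _; rewrite mul1r.
have Ef n : @lnZ R n s = lnZw s (fun=> 1) by apply/funext => G; exact: E.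
have one n (x : assignment n) : 0 < 1 :> R by [].
rewrite /mean_lnZ -/s !Ef.
have := blocks_decouple strengthP k n10 n20 M (@one n1) (@one n2); rewrite -/p => <-.
apply: le_trans (blocks_le strengthP k n10 n20 M (@one (n1 + n2)%N)).
rewrite (_ : pair_wt _ _ = fun=> 1)//.
by apply/funext => x; rewrite /pair_wt mulr1.
Qed.

(** The blocks are split off one at a time; a thinned binomial is binomial, so all blocks of size n
    end with the same parameter n / N. *)
Lemma mean_lnZ_blocks q n r M (N := (q * n + r)%N) : (0 < n)%N -> (0 < r)%N ->
  q%:R * binE (n%:R / N%:R) M (fun m => mean_lnZ k n m beta) +
  binE (r%:R / N%:R) M (fun m => mean_lnZ k r m beta) <= mean_lnZ k N M beta.
Proof.
move=> n0 r0; rewrite /N {N}; elim: q M => [|q IH] M.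
  by rewrite mul0r add0r mul0n add0n divff ?binE1// pnatr_eq0 -lt0n.
set N := (q * n + r)%N in IH *.
have -> : (q.+1 * n + r = n + N)%N by rewrite mulSn addnA.
have N0 : (0 < N)%N by rewrite addn_gt0 r0 orbT.
have nN0 : (0 < n + N)%N by rewrite addn_gt0 n0.
have hN (a : nat) : (a <= N)%N -> 0 <= (a%:R / N%:R : R) <= 1.
  by move=> aN; rewrite divr_ge0//= ler_pdivrMr ?ltr0n// mul1r ler_nat.
have qN : 1 - n%:R / (n + N)%:R = N%:R / (n + N)%:R :> R.
  by rewrite natrD; field; rewrite -natrD pnatr_eq0 -lt0n.
have q01 : 0 <= (N%:R / (n + N)%:R : R) <= 1.
  by rewrite divr_ge0//= ler_pdivrMr ?ltr0n// mul1r ler_nat leq_addl.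
have := mean_lnZ_superadd M n0 N0; rewrite qN; apply: le_trans.
rewrite -natr1 mulrDl mul1r [q%:R * _ + _]addrC -addrA lerD2l.
have eq := binE_expectation M q01.
apply: le_trans (pl_le eq.1 IH).
rewrite (plD eq.1) (plZ eq.1) !binE_thinning//.
by rewrite !mulf_div ![N%:R * _]mulrC -!mulf_div divff ?mulr1// pnatr_eq0 -lt0n.
Qed.

End MeanProperties.

(** * Convergence at fixed temperature *)

Section Convergence.
Variables (R : realType) (k : nat) (alpha beta : R).
Hypotheses (alpha0 : 0 <= alpha) (alpha1 : alpha <= 1) (beta0 : 0 <= beta).

Definition clauses (N : nat) : nat := Num.truncn (alpha * N%:R).

Lemma clauses_le N : (clauses N)%:R <= alpha * N%:R :> R.
Proof. by rewrite /clauses truncn_le// mulr_ge0. Qed.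

Lemma clauses_gt N : alpha * N%:R - 1 < (clauses N)%:R :> R.
Proof.
have : alpha * N%:R < (clauses N).+1%:R by rewrite /clauses truncnS_gt.
by rewrite -natr1; lra.
Qed.

Lemma clauses_leN N : (clauses N)%:R <= N%:R :> R.
Proof. by apply: (le_trans (clauses_le N)); rewrite ler_piMl. Qed.

Definition density (N : nat) : R := mean_lnZ k N (clauses N) beta.

(** The number of clauses in a block of size n has variance at most n, and its mean differs from
    [clauses n] by at most 1 through rounding. Taking tau^2 = n + 1 in [mean_lnZ_lip] makes both of
    its error terms at most tau / 2. *)
Lemma density_blocks q n r : (0 < n)%N -> (0 < r)%N -> (r <= n)%N ->
  q%:R * (density n - beta * Num.sqrt n.+1%:R) - beta * n%:R <= density (q * n + r).
Proof.
move=> n0 r0 rn; set N := (q * n + r)%N.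
have N0 : (0 < N)%N by rewrite addn_gt0 r0 orbT.
have NR : 0 < N%:R :> R by rewrite ltr0n.
case: q @N N0 NR => [|q] N N0 NR.
  rewrite mul0r sub0r /density; apply: le_trans (mean_lnZ_ge k beta0 _ N0).
  rewrite /N mul0n add0n -[leLHS]add0r; apply: lerD.
    by rewrite mulr_ge0// ln_ge0// ler1n.
  rewrite lerN2 mulrC ler_wpM2l//; apply: le_trans (clauses_leN r) _.
  by rewrite ler_nat.
have nN : (n <= N)%N by rewrite /N mulSn -addnA leq_addr.
have rN : (r <= N)%N by rewrite /N leq_addl.
apply: le_trans (mean_lnZ_blocks k beta0 q.+1 (clauses N) n0 r0).
rewrite -/N; set p := n%:R / N%:R; set p' := r%:R / N%:R.
have hN (a : nat) : (a <= N)%N -> 0 <= (a%:R / N%:R : R) <= 1.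
  by move=> aN; rewrite divr_ge0//= ler_pdivrMr// mul1r ler_nat.
have p01 := hN _ nN; have p'01 := hN _ rN; rewrite -/p -/p' in p01 p'01.
have pE : p * N%:R = n%:R by rewrite /p mulfVK// gt_eqF.
have p'E : N%:R * p' = r%:R by rewrite /p' mulrC mulfVK// gt_eqF.
clearbody p p'.
have ep := binE_expectation (clauses N) p01.
have ep' := binE_expectation (clauses N) p'01.
apply: lerD.
  rewrite ler_wpM2l//.
  set tau := Num.sqrt n.+1%:R.
  have tau0 : 0 < tau by rewrite sqrtr_gt0.
  have tau2 : tau ^+ 2 = n%:R + 1 by rewrite sqr_sqrtr// natr1.
  apply: (@le_trans _ _ (binE p (clauses N) (fun m => density n -
     beta * ((m%:R - (clauses n)%:R) ^+ 2 / (2 * tau) + tau / 2)))); last first.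
    by apply: (pl_le ep.1) => m; exact: mean_lnZ_lip.
  rewrite (plB ep.1) (expect_cst ep) (plZ ep.1) (expectDr ep) (plZr ep.1) binE_sqr//.
  rewrite lerD2l lerN2 ler_wpM2l//.
  set V := (clauses N)%:R * p.
  have /andP[p0 p1] := p01.
  have V1 : V <= alpha * n%:R.
    by rewrite /V -pE [p * _]mulrC mulrA ler_wpM2r// clauses_le.
  have V2 : alpha * n%:R - 1 <= V.
    rewrite /V -pE.
    have := ler_wpM2r p0 (ltW (clauses_gt N)).
    by move: p1; set c := (clauses N)%:R; rewrite mulrBl mul1r; lra.
  have c1 := clauses_le n; have c2 := clauses_gt n.
  have Vsq : (V - (clauses n)%:R) ^+ 2 <= 1.
    rewrite -real_normK ?num_real// exprn_ile1// ler_norml.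
    by apply/andP; split; move: V1 V2 c1 c2; set z := alpha * n%:R; lra.
  have V0 : 0 <= V by rewrite /V mulr_ge0.
  have Vp : V * (1 - p) <= n%:R.
    apply: (@le_trans _ _ V); first by rewrite ler_piMr// gerBl.
    by apply: (le_trans V1); rewrite ler_piMl.
  have h : (V * (1 - p) + (V - (clauses n)%:R) ^+ 2) / (2 * tau) <= tau / 2.
    rewrite ler_pdivrMr ?mulr_gt0//.
    rewrite (_ : tau / 2 * (2 * tau) = tau ^+ 2); last by field.
    rewrite tau2; lra.
  lra.
apply: (@le_trans _ _ (binE p' (clauses N) (fun m => (- beta) * m%:R))); last first.
  apply: (pl_le ep'.1) => m.
  apply: le_trans (mean_lnZ_ge k beta0 m r0).
  rewrite mulNr mulrC -[leLHS]add0r lerD2r mulr_ge0// ln_ge0// ler1n //.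
rewrite (plZ ep'.1) binE_id// mulNr lerN2 ler_wpM2l//.
apply: (@le_trans _ _ (N%:R * p')); first by rewrite ler_wpM2r ?clauses_leN//; case/andP: p'01.
by rewrite p'E ler_nat.
Qed.

End Convergence.

Section Limit.
Variable R : realType.

(* A bounded sequence that eventually almost dominates each of its terms
   converges (to its lower limit). *)
Lemma almost_increasing_cvg (h : nat -> R) (lo hi : R) :
  (forall n, lo <= h n <= hi) ->
  (forall e, 0 < e -> exists n0, forall n, (n0 <= n)%N ->
     exists N1, forall N, (N1 <= N)%N -> h n - e <= h N) ->
  forall e, 0 < e -> exists phi : R, exists N1, forall N, (N1 <= N)%N -> `|h N - phi| <= e.
Proof.
move=> hb hA e e0.
pose E : set R := [set x | exists N1, forall N, (N1 <= N)%N -> x <= h N].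
have hE : has_sup E.
  split; first by exists lo, 0%N => N _; case/andP: (hb N).
  by exists hi => x [N1 h1]; apply: le_trans (h1 N1 (leqnn _)) _; case/andP: (hb N1).
have [n0 hn0] := hA e e0.
have [x [N1 hx] xs] := sup_adherent e0 hE.
exists (sup E), (maxn n0 N1) => N; rewrite geq_max => /andP[n0N N1N].
rewrite ler_norml; apply/andP; split.
  have := hx N N1N; move: xs; set S := sup E; lra.
have : E (h N - e) by have [N2 hN2] := hn0 N n0N; exists N2.
by move/(ub_le_sup hE.2); set S := sup E; lra.
Qed.

Lemma density_cvg k (alpha beta e : R) : 0 <= alpha -> alpha <= 1 -> 0 <= beta -> 0 < e ->
  exists phi : R, exists N1, forall N, (N1 <= N)%N ->
    `|density k alpha beta N - phi * N%:R| <= e * N%:R.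
Proof.
move=> a0 a1 b0 e0.
have ln2 : ln (2 : R) <= 1.
  by rewrite -[leRHS]expRK ler_ln ?posrE ?expR_gt0// (le_trans _ (expR_ge1Dx 1))//; lra.
pose D := density k alpha beta.
have Dle n : (0 < n)%N -> D n <= n%:R.
  move=> n0; apply: (le_trans (mean_lnZ_le k b0 _ n0)).
  by rewrite ler_piMr.
have Dge n : (0 < n)%N -> - (beta * n%:R) <= D n.
  move=> n0; apply: le_trans (mean_lnZ_ge k b0 _ n0).
  rewrite -[leLHS]add0r; apply: lerD; first by rewrite mulr_ge0// ln_ge0// ler1n.
  by rewrite lerN2 mulrC ler_wpM2l// clauses_leN.
have [||phi [N1 hphi]] := @almost_increasing_cvg (fun N => D N / N%:R) (- beta) 1 _ _ e e0.
- case=> [|n]; first by rewrite invr0 mulr0 oppr_le0 b0 ler01.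
  by rewrite ler_pdivlMr// ler_pdivrMr// mul1r mulNr Dge ?Dle.
- move=> d d0.
  pose d' := d / (4 * (1 + beta)).
  have d'0 : 0 < d' by rewrite divr_gt0// mulr_gt0//; lra.
  have d'E : d' * (4 * (1 + beta)) = d.
    by rewrite /d' mulfVK// gt_eqF// mulr_gt0//; lra.
  clearbody d'.
  exists (Num.truncn (2 / d' ^+ 2)).+2 => n hn.
  have n0 : (0 < n)%N by exact: leq_trans hn.
  have nR : 0 < n%:R :> R by rewrite ltr0n.
  have nbig : 2 / d' ^+ 2 <= n%:R.
    rewrite ltW// (lt_le_trans (truncnS_gt _))// ler_nat.
    exact: leq_trans hn.
  have sq : Num.sqrt n.+1%:R <= d' * n%:R.
    rewrite -ler_sqr; last 2 first.
    - by rewrite nnegrE sqrtr_ge0.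
    - by rewrite nnegrE mulr_ge0// ltW.
    rewrite sqr_sqrtr//.
    have : 2 <= d' ^+ 2 * n%:R by rewrite mulrC -ler_pdivrMr ?exprn_gt0.
    move/(ler_wpM2r (ltW nR)); rewrite exprMn -[n.+1%:R]natr1 => h.
    have n1 : 1 <= n%:R :> R by rewrite ler1n.
    rewrite [n%:R ^+ 2]expr2 mulrA; apply: le_trans h; lra.
  exists (Num.truncn ((1 + beta) * n%:R * 2 / d)).+2 => N hN.
  have N0 : (0 < N)%N by exact: leq_trans hN.
  have NR : 0 < N%:R :> R by rewrite ltr0n.
  have Nbig : (1 + beta) * n%:R * 2 <= N%:R * d.
    rewrite -ler_pdivrMr// ltW// (lt_le_trans (truncnS_gt _))// ler_nat.
    exact: leq_trans hN.
  (* Dividing N - 1 instead of N gives a last block of size between 1 and n, never an empty one. *)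
  pose q := ((N.-1) %/ n)%N; pose r := ((N.-1) %% n).+1.
  have NE : N = (q * n + r)%N by rewrite /r addnS -divn_eq prednK.
  have rn : (r <= n)%N by rewrite ltn_mod.
  have DN := density_blocks k a0 a1 b0 q n0 (isT : (0 < r)%N) rn.
  rewrite -NE -/(D N) -/(D n) in DN.
  have qE : q%:R = (N%:R - r%:R) / n%:R :> R.
    by rewrite NE natrD natrM addrK mulfK// gt_eqF.
  have Yn : D n - beta * Num.sqrt n.+1%:R <= n%:R.
    by rewrite lerBlDr (le_trans (Dle _ n0))// lerDl mulr_ge0// sqrtr_ge0.
  have [Y YE] : exists Y, D n - beta * Num.sqrt n.+1%:R = Y by eexists.
  rewrite YE in DN Yn.
  have rY : r%:R / n%:R * Y <= n%:R.
    have r0 : 0 <= r%:R / n%:R :> R by rewrite divr_ge0// ltW.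
    apply: (@le_trans _ _ (r%:R / n%:R * n%:R)); first by rewrite ler_wpM2l.
    by rewrite mulfVK ?gt_eqF// ler_nat.
  rewrite lerBlDr ler_pdivrMr// mulrDl.
  have -> : D N / N%:R * n%:R = D N * (n%:R / N%:R) by rewrite mulrAC mulrA.
  have -> : D n = Y + beta * Num.sqrt n.+1%:R by rewrite -YE subrK.
  have bs : beta * Num.sqrt n.+1%:R <= d / 4 * n%:R.
    apply: (@le_trans _ _ (beta * (d' * n%:R))); first by rewrite ler_wpM2l.
    by rewrite mulrA ler_wpM2r ?(ltW nR)//; move: d'E d'0; lra.
  have NY : N%:R * Y <= n%:R * D N + (1 + beta) * n%:R * n%:R.
    have : n%:R * (q%:R * Y) = N%:R * Y - n%:R * (r%:R / n%:R * Y).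
      by rewrite qE; field; rewrite gt_eqF.
    have := ler_wpM2l (ltW nR) DN; have := ler_wpM2l (ltW nR) rY.
    set v := q%:R * Y; rewrite mulrBr [n%:R * (beta * _)]mulrCA.
    set w := n%:R * v; set z := n%:R * D N; lra.
  rewrite -lerBrDr -(ler_pM2l NR).
  have -> : N%:R * (D N * (n%:R / N%:R) + d * n%:R - beta * Num.sqrt n.+1%:R) =
     n%:R * D N + N%:R * (d * n%:R - beta * Num.sqrt n.+1%:R) by field; rewrite gt_eqF.
  apply: (le_trans NY); rewrite lerD2l.
  apply: (@le_trans _ _ (N%:R * (d / 2 * n%:R))).
    rewrite [leRHS](_ : _ = N%:R * d / 2 * n%:R); last by ring.
    by rewrite ler_wpM2r ?(ltW nR)// ler_pdivlMr.
  rewrite ler_wpM2l// ?(ltW NR)//.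
  have : 0 <= d * n%:R by rewrite mulr_ge0// ltW.
  by move: bs; set s := beta * _; lra.
exists phi, (maxn N1 1) => N; rewrite geq_max => /andP[/hphi hN N0].
have NR : 0 < N%:R :> R by rewrite ltr0n.
rewrite -[X in `|X|](mulfVK (lt0r_neq0 NR)) mulrBl mulfK ?gt_eqF// normrM.
by rewrite [`|N%:R|]gtr0_norm// ler_pM2r.
Qed.

End Limit.

(** * Concentration and lower bound *)

Section Concentration.
Variable R : realType.

Lemma expect_sqr_dev T (A : op R T) (X : T -> R) (x : R) : expectation A ->
  A (fun c => (X c - x) ^+ 2) = A (fun c => X c ^+ 2) - 2 * x * A X + x ^+ 2.
Proof.
move=> eA.
have -> : (fun c => (X c - x) ^+ 2) = (fun c => (X c ^+ 2 - (2 * x) * X c) + x ^+ 2).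
  by apply/funext => c; ring.
by rewrite (expectDr eA) (plB eA.1) (plZ eA.1).
Qed.

(** Integrating out one clause costs its conditional variance, which is at most the mean square
    distance to [phi F], the value without that clause; the conditional mean [psi] inherits the
    bounded differences. *)
Lemma prodE_variance T (As : seq (op R T)) (phi : seq T -> R) (b : R) :
  all_prop (@expectation R T) As ->
  (forall F c G, phi (F ++ G) - b <= phi (F ++ c :: G) <= phi (F ++ G)) ->
  prodE As (fun F => phi F ^+ 2) - prodE As phi ^+ 2 <= (size As)%:R * b ^+ 2.
Proof.
elim: As phi => [|A As IH] phi /=; first by rewrite subrr mul0r.
case=> eA eAs hphi; have e := prodE_expectation eAs.
pose psi F := A (fun c => phi (c :: F)).
have hpsi F c G : psi (F ++ G) - b <= psi (F ++ c :: G) <= psi (F ++ G).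
  rewrite /psi -(expectDr eA); apply/andP; split; apply: (pl_le eA.1) => d.
    by have /andP[] := hphi (d :: F) c G.
  by have /andP[] := hphi (d :: F) c G.
have step : prodE As (fun F => A (fun c => phi (c :: F) ^+ 2)) <=
    prodE As (fun F => psi F ^+ 2) + b ^+ 2.
  rewrite -(expectDr e); apply: (pl_le e.1) => F.
  have h := expect_sqr_dev (fun c => phi (c :: F)) (phi F) eA.
  have h2 : A (fun c => (phi (c :: F) - phi F) ^+ 2) <= b ^+ 2.
    apply: (expect_le_cst eA) => c.
    have /andP[/= h1 h2] := hphi [::] c F.
    have -> : (phi (c :: F) - phi F) ^+ 2 = (phi F - phi (c :: F)) ^+ 2 by ring.
    by rewrite lerXn2r// ?nnegrE; move: h1 h2; lra.
  have h3 := sqr_ge0 (psi F - phi F).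
  move: h h2 h3; rewrite -/(psi F) sqrrB => -> ; rewrite mulr_natl -mulr_natl; lra.
have := IH psi eAs hpsi; rewrite -natr1 mulrDl mul1r; move: step.
by rewrite -/psi; lra.
Qed.

Lemma chebyshev_expectation T (E : op R T) (X : T -> R) (v d : R) : expectation E -> 0 < d ->
  E (fun c => X c ^+ 2) - E X ^+ 2 <= v ->
  E (fun c => (d < `|X c - E X|)%R%:R) <= v / d ^+ 2.
Proof.
move=> eE d0 hv; rewrite ler_pdivlMr ?exprn_gt0// -(plZr eE.1).
have h := expect_sqr_dev X (E X) eE.
apply: (@le_trans _ _ (E (fun c => (X c - E X) ^+ 2))).
  apply: (pl_le eE.1) => c; case: ltP => h1; last by rewrite mul0r sqr_ge0.
  by rewrite mul1r -[leRHS]real_normK ?num_real// lerXn2r// ?nnegrE// ltW.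
by rewrite h; move: hv; rewrite !expr2; lra.
Qed.

End Concentration.

Section Isolated.
Variables (R : realType) (n : nat).

Definition isolated (G : seq (seq (literal n))) (v : 'I_n) : bool :=
  all (all (fun l => l.1 != v)) G.

Lemma litE_neq (v : 'I_n) : litE R n (fun l => (l.1 != v)%:R) = 1 - n%:R^-1.
Proof.
have n0 : (0 < n)%N by exact: leq_ltn_trans (ltn_ord v).
rewrite /litE /avg card_prod card_ord card_bool.
rewrite (eq_bigr (fun q : literal n => (q.1 != v)%:R : R))//.
rewrite -(pair_bigA_idem _ (fun (i : 'I_n) (b : bool) => ((i != v)%:R : R)))//=; last by rewrite addr0.
under eq_bigr do rewrite sumr_const card_bool.
rewrite sumrMnl (bigD1 v)//= eqxx add0r.
rewrite (eq_bigr (fun=> 1 : R)); last by move=> i ->.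
rewrite sumr_const cardC1 card_ord natrM -mulr_natr.
have -> : n%:R = n.-1%:R + 1 :> R by rewrite natr1 prednK.
by field; rewrite natr1 pnatr_eq0.
Qed.

Lemma mean_isolated k M : (0 < n)%N ->
  prodE (nseq M (cE n k)) (fun G => \sum_v (isolated G v)%:R) =
  n%:R * (1 - n%:R^-1) ^+ (k * M) :> R.
Proof.
move=> n0; have eC := cE_expectation R k n0; have eM := prodE_nseq_expectation M eC.
rewrite (pl_sum eM.1) (eq_bigr (fun=> (1 - n%:R^-1) ^+ (k * M))).
  by rewrite sumr_const card_ord [RHS]mulr_natl.
move=> v _.
have -> : (fun G => (isolated G v)%:R) =
   (fun G => \prod_(c <- G) \prod_(l <- c) (l.1 != v)%:R) :> (_ -> R).
  apply/funext => G; rewrite /isolated -prod_bool; apply: eq_bigr => c _.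
  by rewrite prod_bool.
rewrite (prodE_prod (fun c => \prod_(l <- c) (l.1 != v)%:R)); last first.
  by apply: all_prop_nseq; exact: eC.1.
rewrite big_nseq iter_mulr_1 /cE (prodE_prod (fun l => (l.1 != v)%:R)); last first.
  by apply: all_prop_nseq; exact: (litE_expectation R n0).1.
by rewrite big_nseq iter_mulr_1 litE_neq exprM.
Qed.

Lemma boltzmann (beta : R) (G : seq (seq (literal n))) x :
  \prod_(c <- G) (1 - (1 - expR (- beta)) * (viol x c)%:R) =
  expR (- (beta * (count (viol x) G)%:R)).
Proof.
elim: G => [|c G IH]; first by rewrite big_nil mulr0 oppr0 expR0.
rewrite big_cons IH /=; case: viol; rewrite ?mulr1 ?mulr0 ?subr0 ?mul1r ?add0n// subKr.
by rewrite -expRD natrD; congr expR; rewrite /=; ring.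
Qed.

(* Flipping isolated variables of a near-optimal assignment. *)
Lemma lnZ_ge_isolated (beta beta' : R) (G : seq (seq (literal n))) :
  0 <= beta -> beta <= beta' -> 0 < beta' ->
  ln 2 * (\sum_v (isolated G v)%:R) +
    beta / beta' * (lnZ (1 - expR (- beta')) G - n%:R * ln 2) <=
  lnZ (1 - expR (- beta)) G.
Proof.
move=> b0 bb b'0; rewrite /lnZ.
have EZ (b : R) : \sum_(x : assignment n) \prod_(c <- G) (1 - (1 - expR (- b)) * (viol x c)%:R) =
    \sum_(x : assignment n) expR (- (b * (count (viol x) G)%:R)).
  by apply: eq_bigr => x _; exact: boltzmann.
pose Z (b : R) := \sum_(x : assignment n) expR (- (b * (count (viol x) G)%:R)).
rewrite !EZ.
have Z0 (b : R) : 0 < Z b by apply: asg_sum_gt0 => x; exact: expR_gt0.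
rewrite -/(Z beta) -/(Z beta').
(* Some assignment has at least the average weight; this bounds the number of clauses it
   violates. *)
have [x hx] : exists x : assignment n, Z beta' <= 2 ^+ n * expR (- (beta' * (count (viol x) G)%:R)).
  apply: contrapT => /forallNP hN.
  have : \sum_(x : assignment n) 2 ^+ n * expR (- (beta' * (count (viol x) G)%:R)) <
      \sum_(x : assignment n) Z beta'.
    apply: ltr_sum => [|x _]; last by move: (hN x) => /negP; rewrite -ltNge.
    by apply/hasP; exists [ffun=> true] => //; rewrite mem_index_enum.
  by rewrite -mulr_sumr sumr_const card_ffun card_bool card_ord -[_ *+ (2 ^ n)]mulr_natl natrX ltxx.
set e := (count (viol x) G)%:R in hx.
have he : beta' * e <= n%:R * ln 2 - ln (Z beta').
  have h2n : 0 < (2 : R) ^+ n by rewrite exprn_gt0.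
  have : ln (Z beta') <= ln (2 ^+ n * expR (- (beta' * e))).
    by rewrite ler_ln ?posrE ?mulr_gt0 ?expR_gt0.
  rewrite lnM ?posrE ?expR_gt0// expRK lnXn// -mulr_natl; lra.
pose I := [set v | isolated G v]%SET.
have hI : \sum_v (isolated G v)%:R = #|I|%:R :> R.
  rewrite -sum1_card natr_sum [RHS]big_mkcond/=; apply: eq_bigr => v _.
  by rewrite inE; case: isolated.
have hZ : 2 ^+ #|I| * expR (- (beta * e)) <= Z beta.
  (* For [z] supported on the isolated variables, [flip z] violates the same clauses as [x], which
     yields 2^|I| assignments of that energy. *)
  pose flip (z : assignment n) : assignment n := [ffun v => z v (+) x v].
  have flipK : involutive flip.
    by move=> z; apply/ffunP => v; rewrite !ffunE -addbA addbb addbF.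
  rewrite /Z (reindex_inj (inv_inj flipK))/=.
  rewrite (bigID (mem (pffun_on false (mem I) predT)))/= -[leLHS]addr0.
  apply: lerD; last by apply: sumr_ge0 => z _; exact: expR_ge0.
  rewrite (eq_bigr (fun=> expR (- (beta * e)))); last first.
    move=> z /pffun_onP[hz _]; rewrite /e; congr (expR (- (beta * _%:R))).
    apply: eq_in_count => c cG; rewrite /viol /violated; apply: eq_in_all => l lc.
    rewrite /falsified ffunE.
    have lI : l.1 \notin I.
      apply/negP; rewrite inE /isolated => /allP/(_ _ cG)/allP/(_ _ lc).
      by rewrite eqxx.
    have -> : z l.1 = false.
      by apply/negbTE/negP => zl; move/fintype.subsetP/(_ l.1): hz; rewrite unfold_in zl => /(_ isT); exact/negP.
    by rewrite addFb.
  by rewrite sumr_const card_pffun_on card_bool -[leRHS]mulr_natl natrX.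
have : #|I|%:R * ln 2 - beta * e <= ln (Z beta).
  have h2n : 0 < (2 : R) ^+ #|I| by rewrite exprn_gt0.
  have : ln (2 ^+ #|I| * expR (- (beta * e))) <= ln (Z beta).
    by rewrite ler_ln ?posrE ?mulr_gt0 ?expR_gt0.
  by rewrite lnM ?posrE ?expR_gt0// expRK lnXn// -[_ *+ #|I|]mulr_natl.
rewrite hI; apply: le_trans; rewrite mulrC lerD2l -(opprB (n%:R * ln 2)) mulrN lerN2.
have -> : beta * e = beta / beta' * (beta' * e) by field; rewrite gt_eqF.
by rewrite ler_wpM2l// divr_ge0// ltW.
Qed.

End Isolated.

Section DensityEstimates.
Variables (R : realType) (k : nat) (alpha : R).
Hypotheses (alpha0 : 0 <= alpha) (alpha1 : alpha < 1).

Local Notation density := (density k.+2 alpha).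

Lemma oneB_ge_expR (z : R) : 0 <= z -> z <= 2^-1 -> expR (- (2 * z)) <= 1 - z.
Proof.
move=> z0 z2; rewrite expRN -[leRHS]invrK lef_pV2 ?posrE ?invr_gt0 ?expR_gt0//; last by lra.
apply: le_trans (expR_ge1Dx _); rewrite -div1r ler_pdivrMr; nra.
Qed.

Lemma lnZ_monotone n (beta beta' : R) (G : seq (seq (literal n))) :
  0 <= beta -> beta <= beta' ->
  lnZ (1 - expR (- beta')) G <= lnZ (1 - expR (- beta)) G <=
  lnZ (1 - expR (- beta')) G + (beta' - beta) * (size G)%:R.
Proof.
move=> b0 bb; rewrite /lnZ.
have EZ (b : R) : \sum_(x : assignment n) \prod_(c <- G) (1 - (1 - expR (- b)) * (viol x c)%:R) =
    \sum_(x : assignment n) expR (- (b * (count (viol x) G)%:R)).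
  by apply: eq_bigr => x _; exact: boltzmann.
rewrite !EZ.
have Z0 (b : R) : 0 < \sum_(x : assignment n) expR (- (b * (count (viol x) G)%:R)).
  by apply: asg_sum_gt0 => x; exact: expR_gt0.
apply/andP; split.
  rewrite ler_ln ?posrE//; apply: ler_sum => x _.
  by rewrite ler_expR lerN2 ler_wpM2r.
rewrite -[X in _ + X]expRK -lnM ?posrE ?expR_gt0// ler_ln ?posrE ?mulr_gt0 ?expR_gt0//.
rewrite mulr_suml; apply: ler_sum => x _.
rewrite -expRD ler_expR -subr_ge0.
have -> : - (beta' * (count (viol x) G)%:R) + (beta' - beta) * (size G)%:R -
   - (beta * (count (viol x) G)%:R) =
  (beta' - beta) * ((size G)%:R - (count (viol x) G)%:R) by ring.
by rewrite mulr_ge0 ?subr_ge0// ler_nat count_size.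
Qed.

Lemma density_monotone n (beta beta' : R) : (0 < n)%N -> 0 <= beta -> beta <= beta' ->
  density beta' n <= density beta n <= density beta' n + (beta' - beta) * n%:R.
Proof.
move=> n0 b0 bb; have eM := prodE_nseq_expectation (clauses alpha n) (cE_expectation R k.+2 n0).
have pM : all_prop (@positive_linear R _) (nseq (clauses alpha n) (@cE R n k.+2)).
  by apply: all_prop_nseq; exact: (cE_expectation R k.+2 n0).1.
apply/andP; split.
  by apply: (pl_le eM.1) => G; have /andP[] := lnZ_monotone G b0 bb.
apply: (@le_trans _ _ (density beta' n + (beta' - beta) * (clauses alpha n)%:R)).
  rewrite -(expectDr eM); apply: prodE_le_size => // G sG.
  by have /andP[_] := lnZ_monotone G b0 bb; rewrite sG size_nseq.
by rewrite lerD2l ler_wpM2l ?subr_ge0// clauses_leN// ltW.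
Qed.

Lemma density_concentration n (beta d : R) : (0 < n)%N -> 0 <= beta -> 0 < d ->
  prodE (nseq (clauses alpha n) (cE n k.+2)) (fun G =>
    (d * n%:R < `|lnZ (1 - expR (- beta)) G - density beta n|)%R%:R) <=
  beta ^+ 2 / (d ^+ 2 * n%:R).
Proof.
move=> n0 b0 d0; have nR : 0 < n%:R :> R by rewrite ltr0n.
have eC := cE_expectation R k.+2 n0.
have eM := prodE_nseq_expectation (clauses alpha n) eC.
have eCs : all_prop (@expectation R _) (nseq (clauses alpha n) (@cE R n k.+2)).
  exact: all_prop_nseq.
have V := prodE_variance (b := beta) eCs (fun F c G => lnZ_insert b0 F G c).
have dn : 0 < d * n%:R by rewrite mulr_gt0.
apply: (le_trans (chebyshev_expectation eM dn V)); rewrite size_nseq.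
rewrite ler_pdivrMr ?exprn_gt0//.
have -> : beta ^+ 2 / (d ^+ 2 * n%:R) * (d * n%:R) ^+ 2 = n%:R * beta ^+ 2.
  by field; rewrite !gt_eqF.
by rewrite ler_wpM2r ?sqr_ge0// clauses_leN// ltW.
Qed.

Lemma density_positive : exists c : R, exists N0 : nat, 0 < c /\
  forall N (beta : R), (N0 <= N)%N -> 0 <= beta -> beta ^+ 4 <= N%:R ->
    c * N%:R <= density beta N.
Proof.
have [C [theta [N0 [C0 th0 low]]]] := low_temperature k alpha0 alpha1.
have ln2 : 0 < ln (2 : R) by rewrite ln_gt0// ltr1n.
(* A variable is isolated with probability at least e^(-2K), where K is the clause size. Half of the
   resulting entropy is kept, the other half pays for the violated clauses. *)
pose c := ln 2 * expR (- (2 * k.+2%:R)) / 2 : R.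
have c0 : 0 < c by rewrite divr_gt0// mulr_gt0// expR_gt0.
pose e := c / (2 * C).
have e0 : 0 < e by rewrite divr_gt0// mulr_gt0.
exists c, (N0 + (Num.truncn (e ^- 4)).+2)%N; split => // N beta hN b0 b4.
have NN0 : (N0 <= N)%N by apply: leq_trans hN; exact: leq_addr.
have N2 : (2 <= N)%N by apply: leq_trans hN; rewrite !addnS.
have n0 : (0 < N)%N by exact: leq_trans N2.
have NR : 0 < N%:R :> R by rewrite ltr0n.
have Ne : e ^- 4 <= N%:R.
  rewrite ltW// (lt_le_trans (truncnS_gt _))// ler_nat (leq_trans _ hN)//.
  by rewrite addnS ltnW// ltnS leq_addl.
(* An auxiliary inverse temperature: [low_temperature] between 0 and [b'] shows that [density b' N]
   is below N ln 2 by at most 2 C N, and this loss enters with the factor beta / b' <= N^(-1/4). *)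
pose b' : R := Num.sqrt N%:R.
have b'0 : 0 < b' by rewrite sqrtr_gt0.
have b'2 : b' ^+ 2 = N%:R by rewrite sqr_sqrtr ?ltW.
have b'N : b' <= N%:R.
  by rewrite -b'2 expr2 ler_peMr ?(ltW b'0)// -sqrtr1 ler_wsqrtr// ler1n ltnW.
have ratio4 : (beta / b') ^+ 4 <= N%:R^-1.
  have b'4 : b' ^+ 4 = N%:R * N%:R by rewrite -expr2 -b'2 -exprM.
  rewrite exprMn exprVn b'4 invfM mulrA ler_piMl ?invr_ge0//.
  by rewrite ler_pdivrMr// mul1r.
have r0 : 0 <= beta / b' by rewrite divr_ge0// ltW.
have ratio : beta / b' <= e.
  rewrite leNgt; apply/negP => er.
  have : e ^+ 4 < (beta / b') ^+ 4 by rewrite ltrXn2r ?nnegrE ?ltW.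
  apply/negP; rewrite -leNgt (le_trans ratio4)// -[leRHS]invrK.
  by rewrite lef_pV2 ?posrE ?invr_gt0 ?exprn_gt0.
have bb' : beta <= b'.
  have : beta / b' <= 1.
    rewrite leNgt; apply/negP => er.
    have : 1 < (beta / b') ^+ 4 by rewrite exprn_egt1.
    by apply/negP; rewrite -leNgt (le_trans ratio4)// invf_le1// ler1n.
  by rewrite ler_pdivrMr// mul1r.
have eM := prodE_nseq_expectation (clauses alpha N) (cE_expectation R k.+2 n0).
have iso := mean_isolated R k.+2 (clauses alpha N) n0.
have h : ln 2 * (N%:R * (1 - N%:R^-1) ^+ (k.+2 * clauses alpha N)) +
    beta / b' * (density b' N - N%:R * ln 2) <= density beta N.
  rewrite -iso -(plZ eM.1).
  have -> : beta / b' * (density b' N - N%:R * ln 2) =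
     prodE (nseq (clauses alpha N) (cE N k.+2)) (fun G =>
       beta / b' * (lnZ (1 - expR (- b')) G - N%:R * ln 2)).
    by rewrite (plZ eM.1) (expectDr eM).
  rewrite -(plD eM.1); apply: (pl_le eM.1) => G.
  exact: lnZ_ge_isolated.
have d0 : N%:R * ln 2 <= density 0 N.
  by apply: le_trans (mean_lnZ_ge k.+2 (lexx 0) _ n0); rewrite mulr0 subr0.
have hlow := low N (clauses alpha N) 0 b' NN0 (clauses_le alpha0 N) (lexx 0) (ltW b'0).
rewrite mulr0 oppr0 expR0 mulr1 -/(density 0 N) -/(density b' N) in hlow.
have hd : - (2 * C * N%:R) <= density b' N - N%:R * ln 2.
  have : C * (N%:R + b') <= C * (N%:R + N%:R) by rewrite ler_wpM2l ?(ltW C0)// lerD2l.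
  by move: hlow d0; set D0 := density 0 N; set D1 := density b' N; lra.
have h2 : - (c * N%:R) <= beta / b' * (density b' N - N%:R * ln 2).
  apply: le_trans (ler_wpM2l r0 hd).
  rewrite mulrN lerN2; apply: (@le_trans _ _ (e * (2 * C * N%:R))).
    by rewrite ler_wpM2r// !mulr_ge0 ?ltW.
  rewrite /e le_eqVlt; apply/orP; left; apply/eqP; field.
  by rewrite gt_eqF.
have h1 : 2 * c * N%:R <= ln 2 * (N%:R * (1 - N%:R^-1) ^+ (k.+2 * clauses alpha N)).
  rewrite [leLHS](_ : _ = ln 2 * (N%:R * expR (- (2 * k.+2%:R)))); last first.
    by rewrite /c; field.
  rewrite ler_wpM2l ?(ltW ln2)// ler_wpM2l ?(ltW NR)//.
  have y0 : 0 <= N%:R^-1 :> R by rewrite invr_ge0.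
  have y2 : N%:R^-1 <= 2^-1 :> R by rewrite lef_pV2 ?posrE// ler_nat.
  apply: (@le_trans _ _ (expR (- (2 * N%:R^-1)) ^+ (k.+2 * clauses alpha N))).
    rewrite -expRM_natr ler_expR natrM mulNr lerN2.
    have := clauses_leN alpha0 (ltW alpha1) N.
    set M := (clauses alpha N)%:R => MN.
    rewrite [leLHS](_ : _ = 2 * k.+2%:R * (M / N%:R)); last by ring.
    by rewrite ler_piMr ?mulr_ge0// ler_pdivrMr// mul1r.
  by rewrite lerXn2r ?nnegrE ?expR_ge0 ?oneB_ge_expR// subr_ge0 invf_le1// ler1n.
move: h h1 h2; set A := ln 2 * (_ * _); set B := beta / b' * _; lra.
Qed.

End DensityEstimates.

(** * Clauses on distinct variables *)

Section FiniteProducts.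
Variable R : realType.

Lemma sum_tuple_cons (T : finType) m (f : seq T -> R) :
  \sum_(t : m.+1.-tuple T) f t = \sum_(t : m.-tuple T) \sum_x f (x :: t).
Proof.
rewrite exchange_big pair_bigA /=.
pose h (p : T * m.-tuple T) : m.+1.-tuple T := [tuple of p.1 :: p.2].
rewrite (reindex h) //; exists (fun t => (thead t, [tuple of behead t])) => [[x t] _|t _].
  by congr pair; apply: val_inj.
by rewrite /h /= -tuple_eta.
Qed.

Lemma prodE_avg (T : finType) m (f : seq T -> R) :
  prodE (nseq m (@avg R T)) f = #|T|%:R^-1 ^+ m * \sum_(t : m.-tuple T) f t.
Proof.
elim: m f => [|m IH] f /=.
  by rewrite mul1r (big_pred1 [tuple])// => t; apply/esym/eqP; exact: tuple0.
rewrite IH sum_tuple_cons exprSr -mulrA; congr (_ * _).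
by rewrite mulr_sumr.
Qed.

Lemma sum_ffun_tuple (T : finType) m (f : seq T -> R) :
  \sum_(F : {ffun 'I_m -> T}) f [seq F j | j <- enum 'I_m] = \sum_(t : m.-tuple T) f t.
Proof.
pose h (t : m.-tuple T) : {ffun 'I_m -> T} := [ffun j => tnth t j].
rewrite (reindex h)/=.
  apply: eq_bigr => t _; congr f.
  by rewrite -[RHS]map_tnth_enum; apply: eq_map => j; rewrite ffunE.
exists (fun F : {ffun 'I_m -> T} => [tuple F j | j < m]) => [t _|F _].
  by apply: eq_from_tnth => j; rewrite tnth_mktuple ffunE.
by apply/ffunP => j; rewrite ffunE tnth_mktuple.
Qed.

End FiniteProducts.

Definition literals N k (d : kclause N k) : seq (literal N) := enum (val d).

Section Transfer.
Variables (R : realType) (N k : nat).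
Hypothesis N0 : (0 < N)%N.

Definition proper (c : seq (literal N)) : bool := uniq [seq l.1 | l <- c].

(** Forgets order and repetition, so that a proper list and the [literals] of the clause it
    represents become the same sequence. *)
Definition canon (c : seq (literal N)) : seq (literal N) := enum [set l in c]%SET.

Lemma viol_canon x c : viol x (canon c) = viol x c.
Proof.
rewrite /viol /violated; apply: eq_all_r => l.
by rewrite mem_enum inE.
Qed.

Lemma viol_kclause x (d : kclause N k) : viol x (literals d) = ~~ satisfies x d.
Proof.
rewrite /literals /viol /violated /satisfies; apply/allP/existsPn => [h l|h l].
  rewrite negb_and; case: (boolP (l \in val d)) => //= ld.
  by apply: (h l); rewrite mem_enum.
by rewrite mem_enum => ld; have := h l; rewrite ld.
Qed.

Lemma ln_partition_function M (beta : R) (F : kformula N M k) :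
  ln (partition_function beta F) =
  lnZ (1 - expR (- beta)) [seq literals (F j) | j <- enum 'I_M].
Proof.
congr ln; apply: eq_bigr => x _; rewrite boltzmann; congr expR.
rewrite mulNr; congr (- (_ * _%:R)).
rewrite /energy cardsE -sum1_card count_map -sum1_count big_enum_cond/=.
by apply: eq_bigl => j; rewrite viol_kclause.
Qed.

Lemma set_of_proper (c : seq (literal N)) : proper c -> size c = k ->
  is_kclause k [set l in c]%SET.
Proof.
move=> pc sc; have uc : uniq c by exact: map_uniq pc.
rewrite /is_kclause cardsE (card_uniqP uc) sc eqxx /=.
have -> : [set l.1 | l in [set l in c]]%SET = [set v in [seq l.1 | l <- c]]%SET.
  apply/setP => v; rewrite inE; apply/imsetP/mapP => -[l lc ->]; exists l => //.
    by rewrite inE in lc.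
  by rewrite inE.
by rewrite cardsE (card_uniqP pc) size_map sc.
Qed.

Lemma card_orderings (d : kclause N k) :
  #|[set t : k.-tuple (literal N) | proper t & [set l in t]%SET == val d]%SET| = k`!.
Proof.
have /andP[/eqP dk /eqP dv] := valP d.
have := card_uniq_tuples k (mem (val d)); rewrite dk ffactnn => <-; apply: eq_card => t.
rewrite !inE; apply/andP/andP => [[pt /eqP td]|[td ut]].
  split; last exact: map_uniq pt.
  apply/allP => l lt; have : l \in val d by rewrite -td inE.
  by [].
have td' : [set l in t]%SET = val d.
  apply/eqP; rewrite eqEcard; apply/andP; split.
    by apply/fintype.subsetP => l; rewrite inE => /(allP td).
  by rewrite cardsE (card_uniqP ut) size_tuple dk.
split; last exact/eqP.
rewrite /proper; apply/card_uniqP; rewrite size_map size_tuple -[RHS]dv.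
apply: eq_card => v; apply/mapP/imsetP => -[l lc ->]; exists l => //; first by rewrite -td' inE.
by rewrite -td' inE in lc.
Qed.

Definition proper_prob : R := cE N k (fun c => (proper c)%:R).

Lemma cE_proper (g : seq (literal N) -> R) :
  cE N k (fun c => (proper c)%:R * g (canon c)) =
  (#|{: literal N}|%:R^-1 ^+ k * (k`!)%:R) * \sum_(d : kclause N k) g (literals d).
Proof.
rewrite /cE (prodE_avg k (fun c => (proper c)%:R * g (canon c))) -mulrA; congr (_ * _).
pose S (t : k.-tuple (literal N)) : {set literal N} := [set l in t]%SET.
transitivity (\sum_(t : k.-tuple (literal N)) \sum_(d : kclause N k)
    (proper t && (S t == val d))%:R * g (literals d)).
  apply: eq_bigr => t _; case: (boolP (proper t)) => [pt|_] /=; last first.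
    by rewrite mul0r big1// => d _; rewrite mul0r.
  have St : is_kclause k (S t) by apply: set_of_proper => //; exact: size_tuple.
  rewrite (bigD1 (eqtype.Sub (S t) St : kclause N k))//= eqxx mul1r big1 ?addr0 ?mul1r// => d.
  by rewrite -val_eqE /= eq_sym => /negbTE ->; rewrite mul0r.
rewrite exchange_big mulr_sumr; apply: eq_bigr => d _.
rewrite -mulr_suml -(card_orderings d) -sum1_card natr_sum [in RHS]big_mkcond/=.
congr (_ * _); apply: eq_bigr => t _; rewrite inE /S.
by case: (_ && _).
Qed.

Lemma proper_probE : proper_prob =
  #|{: literal N}|%:R^-1 ^+ k * (k`!)%:R * #|{: kclause N k}|%:R.
Proof.
have := cE_proper (fun=> 1); rewrite sumr_const => <-.
by congr cE; apply/funext => c; rewrite mulr1.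
Qed.

(** By a union bound, a new literal hits one of fewer than k earlier variables with probability at
    most k / N. *)
Lemma proper_prob_ge : (k <= N)%N -> (1 - k%:R / N%:R) ^+ k <= proper_prob.
Proof.
move=> kN; rewrite /proper_prob.
have NR : 0 < N%:R :> R by rewrite ltr0n.
suff H : forall j, (j <= k)%N ->
  (1 - k%:R / N%:R) ^+ j <= cE N j (fun c => (proper c)%:R) :> R by exact: H.
have z0 : 0 <= 1 - k%:R / N%:R :> R by rewrite subr_ge0 ler_pdivrMr// mul1r ler_nat.
have eL := litE_expectation R N0.
elim=> [|j IH] jk; first by rewrite /cE /= expr0.
have {}IH := IH (ltnW jk).
apply: (@le_trans _ _ ((1 - k%:R / N%:R) * cE N j (fun c => (proper c)%:R))).
  by rewrite exprS ler_wpM2l.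
have pj : all_prop (@positive_linear R _) (nseq j (litE R N)).
  by apply: all_prop_nseq; exact: eL.1.
rewrite /cE -(plZ (prodE_positive_linear pj)) /=.
apply: prodE_le_size => // c; rewrite size_nseq => sc.
have -> : (fun l => (proper (l :: c))%:R) =
    (fun l => (l.1 \notin [seq l.1 | l <- c])%:R * (proper c)%:R) :> (_ -> R).
  by apply/funext => l; rewrite /proper /= -natrM mulnb.
rewrite (plZr eL.1) ler_wpM2r//.
have h (l : literal N) : 1 - \sum_(l' <- c) (1 - (l.1 != l'.1)%:R) <=
    (l.1 \notin [seq l.1 | l <- c])%:R :> R.
  elim: c {sc} => [|l' c IHc]; first by rewrite big_nil subr0.
  rewrite big_cons /= inE negb_or; case: eqVneq => [_|_] /=.
    rewrite subr0 opprD addrA subrr sub0r oppr_le0.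
    by apply: sumr_ge0 => i _; rewrite subr_ge0 lern1 leq_b1.
  by rewrite subrr add0r.
apply: le_trans (pl_le eL.1 h).
have -> : litE R N (fun l => 1 - \sum_(l' <- c) (1 - (l.1 != l'.1)%:R)) =
    1 - \sum_(l' <- c) N%:R^-1.
  rewrite (plB eL.1) eL.2 (pl_sum eL.1); congr (_ - _); apply: eq_bigr => l' _.
  by rewrite (plB eL.1) eL.2 litE_neq subKr.
rewrite lerD2l lerN2 big_const_seq count_predT iter_addr_0 sc -[_ *+ j]mulr_natl.
by rewrite ler_wpM2r ?invr_ge0// ler_nat ltnW.
Qed.

End Transfer.

Section Probability.
Variable R : realType.

Lemma prodE_proper N k M (Psi : seq (seq (literal N)) -> R) : (0 < N)%N ->
  (0 < #|{: kclause N k}|)%N ->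
  prodE (nseq M (cE N k)) (fun G => (all (@proper N) G)%:R * Psi (map (@canon N) G)) =
  proper_prob R N k ^+ M *
    prodE (nseq M (@avg R (kclause N k))) (fun D => Psi [seq literals d | d <- D]).
Proof.
move=> N0 K0; have eC := cE_expectation R k N0.
have eK : expectation (@avg R (kclause N k)) by exact: avg_expectation.
have one g : cE N k (fun c => (proper c)%:R * g (canon c)) =
    proper_prob R N k * avg (fun d : kclause N k => g (literals d)).
  by rewrite cE_proper// proper_probE// /avg mulrA mulfK// pnatr_eq0 -lt0n.
elim: M Psi => [|M IH] Psi /=; first by rewrite !mul1r.
transitivity (prodE (nseq M (cE N k)) (fun G => (all (@proper N) G)%:R *
    (proper_prob R N k * avg (fun d : kclause N k => Psi (literals d :: map (@canon N) G))))).
  congr prodE; apply/funext => G; rewrite -(one (fun c => Psi (c :: map (@canon N) G))).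
  rewrite -(plZ eC.1); apply: (congr1 (cE N k)); apply/funext => c.
  by rewrite -mulnb natrM mulrCA mulrA.
rewrite (IH (fun L => proper_prob R N k * avg (fun d : kclause N k => Psi (literals d :: L)))).
rewrite exprSr -mulrA; congr (_ * _).
by rewrite -(plZ (prodE_nseq_expectation M eK).1).
Qed.

Lemma prob_kSATE N M k (A : pred (kformula N M k)) :
  prob_kSAT R A = #|{: kclause N k}|%:R^-1 ^+ M * \sum_F (A F)%:R.
Proof.
rewrite /prob_kSAT big_mkcond mulr_sumr; apply: eq_bigr => F _.
by rewrite prodr_const card_ord; case: (A F); rewrite ?mulr1 ?mulr0.
Qed.

Lemma prob_kSAT_le N M k (A B : pred (kformula N M k)) : (forall F, A F -> B F) ->
  prob_kSAT R A <= prob_kSAT R B.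
Proof.
move=> AB; rewrite !prob_kSATE ler_wpM2l ?exprn_ge0 ?invr_ge0//.
apply: ler_sum => F _; rewrite ler_nat; move: (AB F).
by case: (A F) => // /(_ isT) ->.
Qed.

Lemma prob_kSAT_ge0 N M k (A : pred (kformula N M k)) : 0 <= prob_kSAT R A.
Proof.
by rewrite prob_kSATE mulr_ge0 ?exprn_ge0 ?invr_ge0//; apply: sumr_ge0 => F _.
Qed.

Lemma prob_kSAT_not N M k (A : pred (kformula N M k)) : (0 < #|{: kclause N k}|)%N ->
  prob_kSAT R A = 1 - prob_kSAT R (fun F => ~~ A F).
Proof.
move=> K0; rewrite !prob_kSATE.
have -> : \sum_F (A F)%:R = #|{: kclause N k}|%:R ^+ M - \sum_F (~~ A F)%:R :> R.
  have -> : #|{: kclause N k}|%:R ^+ M = \sum_(F : kformula N M k) 1 :> R.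
    by rewrite sumr_const card_ffun card_ord natrX.
  by rewrite -sumrB; apply: eq_bigr => F _; case: (A F); rewrite ?subr0 ?subrr.
by rewrite mulrBr -exprMn mulVf ?expr1n// pnatr_eq0 -lt0n.
Qed.

Lemma lnZ_canon N (s : R) (G : seq (seq (literal N))) : lnZ s (map (@canon N) G) = lnZ s G.
Proof.
congr ln; apply: eq_bigr => x _; rewrite big_map; apply: eq_bigr => c _.
by rewrite viol_canon.
Qed.

(** A uniform formula is a formula of independent literals conditioned on all its clauses being
    proper; dropping the conditioning costs the inverse of that probability. *)
Lemma prob_kSAT_lnZ_le N M k (beta : R) (P : pred R) : (0 < N)%N ->
  (0 < #|{: kclause N k}|)%N -> 0 < proper_prob R N k ->
  prob_kSAT R (fun F : kformula N M k => P (ln (partition_function beta F))) <=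
  (proper_prob R N k)^-1 ^+ M *
    prodE (nseq M (cE N k)) (fun G => (P (lnZ (1 - expR (- beta)) G))%:R).
Proof.
move=> N0 K0 p0; rewrite prob_kSATE.
pose s := 1 - expR (- beta).
pose f (D : seq (kclause N k)) : R := (P (lnZ s [seq literals d | d <- D]))%:R.
have -> : \sum_(F : kformula N M k) (P (ln (partition_function beta F)))%:R =
    \sum_(F : kformula N M k) f [seq F j | j <- enum 'I_M].
  by apply: eq_bigr => F _; rewrite ln_partition_function /f -map_comp.
rewrite sum_ffun_tuple -prodE_avg.
have := prodE_proper M (fun L => (P (lnZ s L))%:R) N0 K0; rewrite -/f => H.
have -> : prodE (nseq M (@avg R (kclause N k))) f =
    (proper_prob R N k)^-1 ^+ M * prodE (nseq M (cE N k)) (fun G =>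
      (all (@proper N) G)%:R * (P (lnZ s (map (@canon N) G)))%:R).
  by rewrite H mulrA -exprMn mulVf ?gt_eqF// expr1n mul1r.
rewrite ler_wpM2l ?exprn_ge0 ?invr_ge0 ?(ltW p0)//.
apply: (pl_le (prodE_nseq_expectation M (cE_expectation R k N0)).1) => G.
by rewrite lnZ_canon; case: all; rewrite ?mul1r ?mul0r// ler0n.
Qed.

(** For clauses of size K all of them are proper with probability at least e^(-2 K^2), uniformly in
    N because M <= N. So the Chebyshev bound survives the change of law up to a constant. *)
Lemma density_whp k (alpha beta d : R) N : 0 <= alpha -> alpha < 1 ->
  (2 * k.+2 <= N)%N -> 0 <= beta -> 0 < d ->
  1 - expR (2 * k.+2%:R * k.+2%:R) * (beta ^+ 2 / (d ^+ 2 * N%:R)) <=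
  prob_kSAT R (fun F : kformula N (clauses alpha N) k.+2 =>
    `|ln (partition_function beta F) - density k.+2 alpha beta N| <= d * N%:R).
Proof.
move=> a0 a1 kN b0 d0.
have N0 : (0 < N)%N by apply: leq_trans kN; rewrite muln_gt0.
have kN' : (k.+2 <= N)%N by apply: leq_trans kN; rewrite leq_pmull.
have NR : 0 < N%:R :> R by rewrite ltr0n.
have z0 : 0 <= k.+2%:R / N%:R :> R by rewrite divr_ge0// ltW.
have z2 : k.+2%:R / N%:R <= 2^-1 :> R.
  by rewrite ler_pdivrMr// ler_pdivlMl// -natrM ler_nat.
have pge : expR (- (2 * (k.+2%:R / N%:R))) ^+ k.+2 <= proper_prob R N k.+2.
  apply: le_trans (proper_prob_ge R N0 kN').
  by rewrite lerXn2r ?nnegrE ?expR_ge0 ?oneB_ge_expR//; lra.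
have p0 : 0 < proper_prob R N k.+2 by rewrite (lt_le_trans _ pge)// exprn_gt0// expR_gt0.
have K0 : (0 < #|{: kclause N k.+2}|)%N.
  rewrite lt0n; apply/eqP => K0; move: p0.
  by rewrite proper_probE// K0 mulr0 ltxx.
have pM : (proper_prob R N k.+2)^-1 ^+ clauses alpha N <= expR (2 * k.+2%:R * k.+2%:R).
  apply: (@le_trans _ _ (expR (2 * (k.+2%:R / N%:R)) ^+ k.+2 ^+ clauses alpha N)).
    rewrite lerXn2r ?nnegrE ?invr_ge0 ?exprn_ge0 ?expR_ge0 ?(ltW p0)//.
    rewrite -[leRHS]invrK lef_pV2 ?posrE ?invr_gt0 ?exprn_gt0 ?expR_gt0//.
    by rewrite -exprVn -expRN.
  rewrite -!expRM_natr ler_expR.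
  have MN := clauses_leN a0 (ltW a1) N.
  rewrite [leLHS](_ : _ = 2 * k.+2%:R * k.+2%:R * ((clauses alpha N)%:R / N%:R)); last by ring.
  by rewrite ler_piMr ?mulr_ge0// ler_pdivrMr// mul1r.
rewrite [leRHS]prob_kSAT_not// lerD2l lerN2.
have := @prob_kSAT_lnZ_le N (clauses alpha N) k.+2 beta
  (fun z => ~~ (`|z - density k.+2 alpha beta N| <= d * N%:R)) N0 K0 p0.
move/le_trans; apply.
have eM := prodE_nseq_expectation (clauses alpha N) (cE_expectation R k.+2 N0).
apply: ler_pM => //.
- by rewrite exprn_ge0// invr_ge0 ltW.
- by apply: (pl_ge0 eM.1) => G; rewrite ler0n.
- apply: le_trans (density_concentration k a0 a1 N0 b0 d0).
  by apply: (pl_le eM.1) => G; rewrite -ltNge.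
Qed.

End Probability.

(** * Table lookup *)

Section TableProgram.
Variable R : realType.

Lemma halted_stable P (beta : R) s n : halted P s -> iter n (step P beta) s = s.
Proof.
move=> h; elim: n => //= n ->; rewrite /step.
by rewrite onth_default.
Qed.

Lemma step_at (pre post : program) i (beta : R) m :
  step (pre ++ i :: post) beta (size pre, m) = exec beta i (size pre, m).
Proof. by rewrite /step /= onth_cat ltnn subnn. Qed.

(* Scratch registers; [rZ] is never written and holds 0. *)
Definition rN : int := Negz 0.
Definition rA : int := Negz 1.
Definition rB : int := Negz 2.
Definition rZ : int := Negz 3.

(** There is no multiplication instruction; [d] is a constant of the program, so d N is unrolled
    into |d| additions or subtractions. *)
Definition add_multiple (d : int) : program :=
  match d with
  | Posz n => nseq n (Add 0 0 rN)
  | Negz n => nseq n.+1 (Sub 0 0 rN)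
  end.

(* Adds [d * N] to X_0, unless [i <= D * beta]. *)
Definition entry_code (pc : nat) (D : int) (e : int * int) : program :=
  [:: Const rA e.1, Const rB D, Query rA rB (pc + 3 + size (add_multiple e.2))%N
   & add_multiple e.2].

(** The address [pc] is carried along because jump targets are absolute. *)
Fixpoint table_code (pc : nat) (D : int) (l : seq (int * int)) : program :=
  if l is e :: l' then
    entry_code pc D e ++ table_code (pc + size (entry_code pc D e))%N D l'
  else [::].

Definition table_value (beta : R) (D : int) (l : seq (int * int)) : int :=
  \sum_(e <- l) (if e.1%:~R <= D%:~R * beta then 0 else e.2).

Definition agree (m m' : memory) (v : int) : Prop :=
  [/\ m' 0 = v, m' 1 = m 1, m' rN = m rN & m' rZ = m rZ].

Lemma add_multiple_run (beta : R) (pre post : program) d m :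
  exists m', iter (size (add_multiple d)) (step (pre ++ add_multiple d ++ post) beta)
      (size pre, m) = ((size pre + size (add_multiple d))%N, m') /\
    agree m m' (m 0 + d * m rN).
Proof.
have run i n (g : int) : (forall s m, exec beta i (s, m) = (s.+1, upd m 0 (m 0 + g * m rN))) ->
  exists m', iter n (step (pre ++ nseq n i ++ post) beta) (size pre, m) =
     ((size pre + n)%N, m') /\ agree m m' (m 0 + g *+ n * m rN).
  move=> hi; elim: n pre m => [|n IH] pre' m0.
    by exists m0; rewrite addn0; split => //; split => //; rewrite mulr0n mul0r addr0.
  have [m' [h1 [h2 h3 h4 h5]]] := IH (rcons pre' i) (upd m0 0 (m0 0 + g * m0 rN)).
  exists m'; split.
    rewrite iterSr step_at hi -[RHS](_ : ((size (rcons pre' i) + n)%N, m') = _); last first.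
      by rewrite size_rcons addSnnS.
    by rewrite -h1 size_rcons cat_rcons.
  split; rewrite ?h2 ?h3 ?h4 ?h5 //=.
  by rewrite /upd /= mulrSr mulrDl; ring.
case: d => n.
  have [s m0|m' [h1 h2]] := run (Add 0 0 rN) n 1; first by rewrite /= mul1r.
  by exists m'; rewrite /= size_nseq; split => //; move: h2; rewrite natz.
have [s m0|m' [h1 h2]] := run (Sub 0 0 rN) n.+1 (-1); first by rewrite /= mulN1r.
by exists m'; rewrite [size _](size_nseq n.+1); split => //; move: h2; rewrite mulNrn natz NegzE.
Qed.

Lemma step_offset (pre code post : program) j i (beta : R) m : onth code j = Some i ->
  step (pre ++ code ++ post) beta ((size pre + j)%N, m) = exec beta i ((size pre + j)%N, m).
Proof.
move=> h; have jc : (j < size code)%N by rewrite -onthTE h.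
by rewrite /step /= onth_cat ltnNge leq_addr /= addKn onth_cat jc h.
Qed.

Lemma entry_run (beta : R) (pre post : program) D e m :
  let code := entry_code (size pre) D e in
  exists t m', [/\ (t <= size code)%N,
    iter t (step (pre ++ code ++ post) beta) (size pre, m) = ((size pre + size code)%N, m') &
    agree m m' (m 0 + (if e.1%:~R <= D%:~R * beta then 0 else e.2) * m rN)].
Proof.
move=> code; pose P := pre ++ code ++ post.
pose m2 := upd (upd m rA e.1) rB D.
have s1 : step P beta (size pre, m) = ((size pre).+1, upd m rA e.1).
  by have := @step_offset pre code post 0%N _ beta m erefl; rewrite addn0.
have s2 : step P beta ((size pre).+1, upd m rA e.1) = ((size pre).+2, m2).
  have := @step_offset pre code post 1%N _ beta (upd m rA e.1) erefl.
  by rewrite addn1.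
have s3 : step P beta ((size pre).+2, m2) =
   (if e.1%:~R <= D%:~R * beta then (size pre + 3 + size (add_multiple e.2))%N
    else (size pre).+3, m2).
  have := @step_offset pre code post 2%N _ beta m2 erefl.
  by rewrite addn2.
have szc : size code = (3 + size (add_multiple e.2))%N by [].
case: ifPn s3 => hq s3.
  exists 3%N, m2; split; first by rewrite szc leq_addr.
    by rewrite -/P szc addnA 3!iterS [iter 0 _ _]/= s1 s2 s3.
  by split => //; rewrite mul0r addr0.
pose pre3 := pre ++ [:: Const rA e.1; Const rB D;
  Query rA rB (size pre + 3 + size (add_multiple e.2))%N].
have sp3 : size pre3 = (size pre).+3 by rewrite size_cat /= addn3.
have [m' [h1 [h2 h3 h4 h5]]] := add_multiple_run beta pre3 post e.2 m2.
have PE : P = pre3 ++ add_multiple e.2 ++ post by rewrite /P /pre3 -catA.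
exists (size (add_multiple e.2) + 3)%N, m'; split.
- by rewrite szc addnC.
- rewrite -/P iterD 3!iterS [iter 0 _ _]/= s1 s2 s3 PE -sp3 h1 sp3 szc; congr pair.
  by rewrite addnA addn3.
- by split.
Qed.

Lemma table_run (beta : R) (pre post : program) D l m :
  let code := table_code (size pre) D l in
  exists t m', [/\ (t <= size code)%N,
    iter t (step (pre ++ code ++ post) beta) (size pre, m) = ((size pre + size code)%N, m') &
    agree m m' (m 0 + table_value beta D l * m rN)].
Proof.
elim: l pre m => [|e l IH] pre m code.
  exists 0%N, m; split => //=; first by rewrite addn0.
  by split => //; rewrite /table_value big_nil mul0r addr0.
pose c1 := entry_code (size pre) D e; pose c2 := table_code (size pre + size c1) D l.
have -> : code = c1 ++ c2 by [].
have [t1 [m1 [ht1 h1 [a1 a2 a3 a4]]]] := entry_run beta pre (c2 ++ post) D e m.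
have := IH (pre ++ c1) m1; rewrite size_cat -/c2.
case=> t2 [m2 [ht2 h2 [b1 b2 b3 b4]]].
exists (t2 + t1)%N, m2; split.
- by rewrite size_cat addnC leq_add.
- by rewrite iterD -catA h1 catA h2 size_cat addnA.
- split; rewrite ?b1 ?b2 ?b3 ?b4 ?a1 ?a2 ?a3 ?a4//.
  by rewrite /table_value big_cons; ring.
Qed.

(* Inputs with [N <= N0] are rejected at once, so that the running time is
   bounded by [N + 4] whatever the size of the table. *)
Definition table_program (N0 : nat) (den a D : int) (l : seq (int * int)) : program :=
  let prologue len := [:: Const rA N0%:Z; Sub rA 0 rA; JumpPos rA 4; Query rZ rZ len;
    Add rN 0 rZ; Const 0 0; Const 1 den] in
  let body := add_multiple a ++ table_code (7 + size (add_multiple a)) D l in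
  prologue (7 + size body)%N ++ body.

(** All jumps go forward, so the program halts within as many steps as it has instructions, and
    running it for exactly that many steps yields its output. *)
Lemma table_program_run (N0 : nat) (den a D : int) (l : seq (int * int))
    (N M k : nat) (beta : R) (F : kformula N M k) :
  let P := table_program N0 den a D l in
  let v := output R (iter (size P) (step P beta) (init F)) in
  exists t, [/\ computes_within P beta F v t,
    (N <= N0)%N -> (t <= 4)%N, (t <= size P)%N &
    (N0 < N)%N -> v = (a + table_value beta D l)%:~R * N%:R / den%:~R].
Proof.
move=> P v.
pose body := add_multiple a ++ table_code (7 + size (add_multiple a)) D l.
have szP : size P = (7 + size body)%N by [].
have [m0 m0E] : exists m0, init F = (0%N, m0) by eexists.
have m00 : m0 0 = N%:Z by move: m0E; rewrite /init => -[<-].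
have m0N i : m0 (Negz i) = 0 by move: m0E; rewrite /init => -[<-].
suff [t [ht tP hv]] : exists t, [/\ halted P (iter t (step P beta) (init F)),
    (t <= size P)%N & ((N <= N0)%N -> (t <= 4)%N) /\ ((N0 < N)%N ->
   output R (iter t (step P beta) (init F)) =
     (a + table_value beta D l)%:~R * N%:R / den%:~R)].
  have vE : v = output R (iter t (step P beta) (init F)).
    by rewrite /v -(subnK tP) iterD halted_stable.
  by exists t; split; [split | exact: hv.1 | | rewrite vE; exact: hv.2].
rewrite m0E.
have off j i m : onth P j = Some i -> step P beta (j, m) = exec beta i (j, m).
  by move=> h; rewrite /step h.
pose m1 := upd m0 rA N0%:Z.
pose m2 := upd m1 rA (m1 0 - m1 rA).
have s1 : step P beta (0%N, m0) = (1%N, m1) by rewrite (off 0%N (Const rA N0%:Z)).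
have s2 : step P beta (1%N, m1) = (2%N, m2) by rewrite (off 1%N (Sub rA 0 rA)).
have m2A : m2 rA = N%:Z - N0%:Z by rewrite /m2 /m1 /upd /= m00.
have m2Z : m2 rZ = 0 by rewrite /m2 /m1 /upd /= m0N.
have m20 : m2 0 = N%:Z by rewrite /m2 /m1 /upd /= m00.
have s3 : step P beta (2%N, m2) = (if 0 < m2 rA then 4%N else 3%N, m2).
  by rewrite (off 2%N (JumpPos rA 4)).
have hlt m : halted P (size P, m) by rewrite /halted leqnn.
have [NN0|NN0] := leqP N N0.
  (* The query compares 0 with 0 beta and hence always succeeds: it serves as an unconditional jump
     to the end. *)
  have s4 : step P beta (3%N, m2) = (size P, m2).
    rewrite (off 3%N (Query rZ rZ (size P)))//= m2Z.
    by rewrite mul0r lexx.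
  exists 4%N; rewrite /= s1 s2 s3 m2A subr_gt0 ltz_nat ltnNge NN0 /= s4.
  by split; [exact: hlt | by [] | split => //; rewrite ltnNge NN0].
have s3' : step P beta (2%N, m2) = (4%N, m2).
  by rewrite s3 m2A subr_gt0 ltz_nat NN0.
pose m4 := upd m2 rN (m2 0 + m2 rZ).
pose m5 := upd m4 0 0.
pose m6 := upd m5 1 den.
have s5 : step P beta (4%N, m2) = (5%N, m4) by rewrite (off 4%N (Add rN 0 rZ)).
have s6 : step P beta (5%N, m4) = (6%N, m5) by rewrite (off 5%N (Const 0 0)).
have s7 : step P beta (6%N, m5) = (7%N, m6) by rewrite (off 6%N (Const 1 den)).
pose pre := [:: Const rA N0%:Z; Sub rA 0 rA; JumpPos rA 4; Query rZ rZ (size P);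
  Add rN 0 rZ; Const 0 0; Const 1 den].
have PE : P = pre ++ add_multiple a ++ (table_code (7 + size (add_multiple a)) D l ++ [::]).
  by rewrite cats0.
have [m8 [h8 [a1 a2 a3 a4]]] := add_multiple_run beta pre
  (table_code (7 + size (add_multiple a)) D l ++ [::]) a m6.
have [t9 [m9 [ht9 h9 [b1 b2 b3 b4]]]] := table_run beta (pre ++ add_multiple a) [::] D l m8.
have szpa : size (pre ++ add_multiple a) = (7 + size (add_multiple a))%N by rewrite size_cat.
rewrite szpa in ht9 h9.
rewrite -PE in h8.
have PE' : P = (pre ++ add_multiple a) ++ table_code (7 + size (add_multiple a)) D l ++ [::].
  by rewrite PE catA.
rewrite -PE' in h9.
exists (t9 + (size (add_multiple a) + 6))%N.
have run : iter (t9 + (size (add_multiple a) + 6)) (step P beta) (0%N, m0) = (size P, m9).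
  by rewrite 2!iterD 6!iterS [iter 0 _ _]/= s1 s2 s3' s5 s6 s7 h8 h9 szP size_cat addnA.
rewrite run; split; first exact: hlt.
- by rewrite szP size_cat addnC addnA leq_add// addnC leq_add2r.
- split => [//|_].
  have m60 : m6 0 = 0 by [].
  have m61 : m6 1 = den by [].
  have m6N : m6 rN = N%:Z.
    by rewrite /m6 /m5 /m4 /upd /= m20 m2Z addr0.
  rewrite /output /= b1 b2 a1 a2 a3 m60 m61 m6N add0r -mulrDl intrM.
  by rewrite -pmulrn.
Qed.

End TableProgram.

(** * Bound on the threshold and construction of the table *)

Section Assembly.
Variable R : realType.

Lemma bernoulli_ge (x : R) n : 0 <= x -> x <= 1 -> 1 - n%:R * x <= (1 - x) ^+ n.
Proof.
move=> x0 x1; elim: n => [|n IH]; first by rewrite mul0r subr0 expr0.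
have x1' : 0 <= 1 - x by rewrite subr_ge0.
have n0 : 0 <= n%:R :> R by [].
rewrite exprS -[n.+1%:R]natr1; apply: le_trans (ler_wpM2l x1' IH); nra.
Qed.

(** From e^(-k/2) <= 2 / (k + 2) and Bernoulli's inequality, the power in kappa(1) is at least 4 /
    (k + 2), which makes kappa(1) >= 7/4; the intermediate value theorem then gives a root in (0,
    1]. *)
Lemma alpha_star_le1 k (a : R) : (2 <= k)%N -> is_alpha_star k a -> a <= 1.
Proof.
move=> k2 [a0 _ amin].
have K1 : 1 <= kappa k (1 : R).
  have kR : 2 <= k%:R :> R by rewrite ler_nat.
  pose e : R := expR (- (k%:R * 1 / 2)).
  have e0 : 0 <= e by exact: expR_ge0.
  have e1 : e * (k%:R + 2) <= 2.
    rewrite /e mulr1 expRN mulrC ler_pdivrMr ?expR_gt0//.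
    have := expR_ge1Dx (k%:R / 2 : R); lra.
  have e2 : e <= 2^-1 by nra.
  have h : 1 - (k - 2)%:R * (2^-1 * e) <= (1 - 2^-1 * e) ^+ (k - 2).
    by apply: bernoulli_ge; nra.
  rewrite natrB// in h.
  rewrite /kappa -/e mulr1.
  set X := (1 - 2^-1 * e) ^+ (k - 2) in h *.
  have h2 : 4 <= (k%:R + 2) * X.
    have : (k%:R + 2) * (1 - (k%:R - 2) * (2^-1 * e)) <= (k%:R + 2) * X.
      by rewrite ler_wpM2l//; lra.
    nra.
  have X0 : 0 <= X by nra.
  have h3 : k%:R + 2 <= 2 * (k%:R * (k%:R - 1)) :> R by nra.
  have h4 : 7 / 8 <= 1 - 4^-1 * e by lra.
  have h5 : 2 <= k%:R * (k%:R - 1) * X.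
    have := ler_wpM2r X0 h3; lra.
  rewrite mulrAC; set Y := k%:R * (k%:R - 1) * X in h5 *; nra.
have K0 : kappa k (0 : R) = 0 by rewrite /kappa mulr0 !mul0r.
have [c cI Kc] : exists2 c, c \in `[0, 1] & kappa k c = 1 :> R.
  apply: IVT => //; first by apply: continuous_subspaceT; exact: continuous_kappa.
  by rewrite K0 ge_min ler01/= le_max K1 orbT.
move: cI; rewrite in_itv/= => /andP[c0 c1].
apply: le_trans c1; apply: amin => //.
rewrite lt_neqAle c0 andbT; apply/eqP => cz.
by move: Kc; rewrite -cz K0 => /eqP; rewrite eq_sym oner_eq0.
Qed.

(** Increments that telescope: starting from [a K], the coldest grid value, the entries with i + 1 >
    D beta lead back to the value at the grid point just below beta. *)
Definition table (a : nat -> int) (K : nat) : seq (int * int) :=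
  [seq (i.+1%:Z, a i - a i.+1) | i <- index_iota 0 K].

Lemma table_valueE (a : nat -> int) (D : nat) (beta : R) K : 0 <= beta ->
  exists j, [/\ (j <= K)%N, j%:R <= D%:R * beta,
    (j < K)%N -> D%:R * beta < j.+1%:R &
    a K + table_value beta D%:Z (table a K) = a j].
Proof.
move=> b0; have Db : 0 <= D%:R * beta by rewrite mulr_ge0.
have E n : table_value beta D%:Z (table a n) =
    \sum_(0 <= i < n) (if i.+1%:R <= D%:R * beta then 0 else a i - a i.+1).
  by rewrite /table_value big_map.
elim: K => [|K [j [jK j1 j2 j3]]].
  by exists 0%N; split => //; rewrite E big_nil addr0.
have [h|h] := leP K.+1%:R (D%:R * beta).
  exists K.+1; split; rewrite ?ltnn// E big_nat big1 ?addr0// => i /andP[_ iK].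
  by rewrite (le_trans _ h)// ler_nat.
exists j; split => //; first exact: leqW.
  rewrite ltnS leq_eqVlt => /predU1P[->//|]; exact: j2.
rewrite -j3 !E big_nat_recr//= leNgt h /= addrCA [RHS]addrC.
by congr (_ + _); rewrite addrC subrK.
Qed.

(** The three errors [eta] are: convergence at a grid point, passage from beta to the grid point,
    and rounding of the limit to a multiple of 1 / D. *)
Lemma lookup_value k (alpha eta : R) : 0 <= alpha -> alpha < 1 -> 0 < eta ->
  exists (D K : nat) (a : nat -> int) (N1 : nat), (0 < D)%N /\
  forall N (beta : R), (N1 < N)%N -> 0 <= beta -> beta ^+ 4 <= N%:R ->
    `|density k.+2 alpha beta N -
      (a K + table_value beta D%:Z (table a K))%:~R * N%:R / D%:R| <= 3 * eta * N%:R.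
Proof.
move=> a0 a1 eta0.
have [C [theta [N0 [C0 th0 low]]]] := low_temperature k a0 a1.
(* Above [B] a single entry serves all beta: [low_temperature] gives an error C (N e^(-theta B) +
   beta), whose first half is small by this choice and whose second by beta <= sqrt N. *)
pose B := (Num.truncn (2 * C / (eta * theta))).+1.
have hB : C * expR (- (theta * B%:R)) <= eta / 2.
  have b1 : 2 * C / (eta * theta) <= B%:R by rewrite ltW// truncnS_gt.
  have bpos : 0 < theta * B%:R by rewrite mulr_gt0// ltr0n.
  have : expR (- (theta * B%:R)) <= (theta * B%:R)^-1.
    rewrite expRN lef_pV2 ?posrE ?expR_gt0//.
    by apply: le_trans (expR_ge1Dx _); rewrite lerDr.
  move/(ler_wpM2l (ltW C0))/le_trans; apply.
  rewrite ler_pdivrMr// -ler_pdivrMl; last by rewrite divr_gt0.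
  rewrite (_ : _ * C = 2 * C / (eta * theta) * theta); last by field; rewrite !gt_eqF.
  by rewrite mulrC ler_wpM2l// ltW.
pose D := (Num.truncn eta^-1).+1.
have hD : D%:R^-1 <= eta.
  by rewrite -[leRHS]invrK lef_pV2 ?posrE ?invr_gt0// ltW// truncnS_gt.
have D0 : 0 < D%:R :> R by rewrite ltr0n.
pose K := (B * D)%N.
have gridC (i : nat) : exists phi_N : R * nat, forall N, (phi_N.2 <= N)%N ->
    `|density k.+2 alpha (i%:R / D%:R) N - phi_N.1 * N%:R| <= eta * N%:R.
  have [|phi [N1 h]] := density_cvg k.+2 a0 (ltW a1) (_ : 0 <= i%:R / D%:R) eta0.
    by rewrite divr_ge0.
  by exists (phi, N1).
(* Only the existence of the limits is used; their roundings become constants of the program. *)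
have [f hf] := choice gridC.
pose a i : int := Num.floor ((f i).1 * D%:R).
pose N1 := (N0 + (Num.truncn (4 * C ^+ 2 / eta ^+ 2)).+1 + \sum_(i < K.+1) (f i).2)%N.
exists D, K, a, N1; split => // N beta hN b0 b4.
have N_0 : (0 < N)%N by exact: leq_ltn_trans hN.
have NR : 0 < N%:R :> R by rewrite ltr0n.
have NN0 : (N0 <= N)%N.
  by apply: leq_trans (ltnW hN); rewrite /N1 -addnA leq_addr.
have Nbig : 4 * C ^+ 2 / eta ^+ 2 <= N%:R.
  rewrite ltW// (lt_le_trans (truncnS_gt _))// ler_nat.
  by apply: leq_trans (ltnW hN); rewrite /N1 addnAC leq_addl.
have [j [jK j1 j2 ->]] := table_valueE a D K b0.
have Nj : ((f j).2 <= N)%N.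
  apply: leq_trans (ltnW hN); rewrite /N1 (bigD1 (Ordinal (jK : (j < K.+1)%N)))//=.
  by rewrite addnCA leq_addr.
have e1 := hf j N Nj.
have gj : j%:R / D%:R <= beta by rewrite ler_pdivrMr// mulrC.
have gj0 : 0 <= j%:R / D%:R :> R by rewrite divr_ge0.
have /andP[m1 m2] := density_monotone k a0 a1 N_0 gj0 gj.
have e2 : density k.+2 alpha (j%:R / D%:R) N - density k.+2 alpha beta N <= eta * N%:R.
  have [jK'|Kj] := ltnP j K.
    have : (beta - j%:R / D%:R) * N%:R <= eta * N%:R.
      rewrite ler_wpM2r ?(ltW NR)//; apply: le_trans hD.
      rewrite -(ler_pM2l D0) mulrBr mulrCA !divff ?gt_eqF// mulr1.
      by have := j2 jK'; rewrite -[j.+1%:R]natr1; lra.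
    by move: m2; set X := density _ _ _ _; set Y := density _ _ _ _; lra.
  have jE : j = K by apply/eqP; rewrite eqn_leq jK Kj.
  have gE : j%:R / D%:R = B%:R :> R by rewrite jE /K natrM mulfK// gt_eqF.
  rewrite gE in gj *.
  apply: (le_trans (low N _ B%:R beta NN0 (clauses_le a0 N) (ler0n _ _) gj)).
  have bC : C * beta <= eta / 2 * N%:R.
    have b2 : beta <= Num.sqrt N%:R.
      rewrite -[leLHS]ger0_norm// -sqrtr_sqr ler_wsqrtr//.
      have N1' : 1 <= N%:R :> R by rewrite ler1n.
      rewrite leNgt; apply/negP => h.
      have : N%:R * N%:R < beta ^+ 2 * beta ^+ 2 by apply: ltr_pM => //; exact: ltW.
      rewrite -exprD => h'; have := lt_le_trans h' b4.
      by apply/negP; rewrite -leNgt ler_peMr// ltW.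
    have s0 : 0 < Num.sqrt N%:R :> R by rewrite sqrtr_gt0.
    have s2 : Num.sqrt N%:R ^+ 2 = N%:R :> R by rewrite sqr_sqrtr// ltW.
    have s3 : 2 * C / eta <= Num.sqrt N%:R.
      have p0 : 0 <= 2 * C / eta by rewrite divr_ge0 ?(ltW eta0)// mulr_ge0// ltW.
      rewrite -[leLHS]ger0_norm// -sqrtr_sqr ler_wsqrtr//.
      by rewrite exprMn exprVn exprMn expr2 -natrM.
    apply: (@le_trans _ _ (C * Num.sqrt N%:R)); first by rewrite ler_wpM2l// ltW.
    rewrite -[X in _ <= _ * X]s2 expr2 mulrA ler_wpM2r ?(ltW s0)//.
    have -> : C = eta / 2 * (2 * C / eta) by field; rewrite gt_eqF.
    by rewrite ler_wpM2l// divr_ge0// ltW.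
  have := ler_wpM2r (ltW NR) hB; rewrite mulrDr; lra.
have e3 : `|(f j).1 * N%:R - (a j)%:~R * N%:R / D%:R| <= eta * N%:R.
  have /andP[f1 f2] := floor_itv ((f j).1 * D%:R).
  rewrite -/(a j) in f1 f2.
  have -> : (f j).1 * N%:R - (a j)%:~R * N%:R / D%:R =
     ((f j).1 * D%:R - (a j)%:~R) / D%:R * N%:R by field; rewrite gt_eqF.
  rewrite normrM [X in _ * X]gtr0_norm// ler_wpM2r ?(ltW NR)//.
  apply: le_trans hD; rewrite normrM [X in _ * X]gtr0_norm ?invr_gt0//.
  apply: ler_piMl; first by rewrite invr_ge0 ltW.
  by rewrite ler_norml; apply/andP; move: f1 f2; rewrite intrD mulr1z; split; lra.
move: e1 e2 e3; rewrite !ler_norml.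
set X1 := density _ _ _ _ in m1 m2 *; set X2 := density _ _ _ _ in m1 m2 *.
set X3 := (f j).1 * N%:R; set X4 := (a j)%:~R * _ / D%:R.
rewrite -(mulrA 3); set X5 := eta * N%:R.
by move=> /andP[u1 u2] u3 /andP[u4 u5]; apply/andP; split; lra.
Qed.

End Assembly.

Lemma sqrt_decay_cvg (R : realType) (N0 : nat) (c : R) : 0 <= c ->
  (fun n => if (n <= N0)%N then 1 else c / Num.sqrt n%:R) n @[n --> \oo] --> (0 : R).
Proof.
move=> c0; apply/cvgrPdist_le => /= e e0.
near=> n.
have nN : (N0 < n)%N by near: n; exact: nbhs_infty_gt.
have n0 : 0 < n%:R :> R by rewrite ltr0n; exact: leq_ltn_trans nN.
have nc : (c / e) ^+ 2 <= n%:R by near: n; exact: nbhs_infty_ger.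
rewrite leqNgt nN/= sub0r normrN ger0_norm ?divr_ge0 ?sqrtr_ge0//.
rewrite ler_pdivrMr ?sqrtr_gt0// mulrC -ler_pdivrMr//.
by rewrite -[leLHS]ger0_norm ?divr_ge0 ?(ltW e0)// -sqrtr_sqr ler_wsqrtr.
Unshelve. all: by end_near. Qed.

Lemma expr4_le_powR (R : realType) (N : nat) (beta : R) : 0 <= beta ->
  beta <= N%:R `^ 4^-1 -> beta ^+ 4 <= N%:R.
Proof.
move=> b0 b1; have := lerXn2r 4 b0 (powR_ge0 _ _) b1.
by rewrite -[leRHS]powR_mulrn ?powR_ge0// -powRrM mulVf ?pnatr_eq0// powRr1.
Qed.

Theorem theorem1 (R : realType) (k : nat) (alpha alpha_star : R)
    (k_ge2 : (2 <= k)%N)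
    (alpha_starP : is_alpha_star k alpha_star)
    (alpha_ge0 : 0 <= alpha) (alpha_lt : alpha < alpha_star) :
  exists p : {poly nat},
  forall eps : R, 0 < eps ->
  exists (delta : R) (P : program)
         (Phi : forall N M : nat, R -> kformula N M k -> R),
  [/\ 0 < delta,
      (forall (N M : nat) (beta : R) (F : kformula N M k),
         exists t : nat,
           computes_within P beta F (Phi N M beta F) t /\
           (M = Num.truncn (alpha * N%:R) -> (t <= p.[N])%N)) &
      (exists eta : nat -> R,
         eta n @[n --> \oo] --> (0 : R) /\
         forall (N : nat) (beta : R), 0 <= beta -> beta <= N%:R `^ delta ->
           1 - eta N <=
             prob_kSAT R (fun F : kformula N (Num.truncn (alpha * N%:R)) k =>
               (Phi N _ beta F * (1 - eps) <= ln (partition_function beta F)) &&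
               (ln (partition_function beta F) <= Phi N _ beta F * (1 + eps))))].
Proof.
have alpha_lt1 : alpha < 1 := lt_le_trans alpha_lt (alpha_star_le1 k_ge2 alpha_starP).
case: k k_ge2 alpha_starP => [//|[//|k]] _ _.
exists ('X + 4%:P) => eps eps0.
have [c [Nc [c0 pos]]] := density_positive k alpha_ge0 alpha_lt1.
(* Concentration and lookup together err by at most 4 d N = e c N / 2. As log Z has mean at least c
   N, this forces c N <= 2 Phi, and the error is at most eps Phi. *)
pose e := Num.min eps 2^-1; pose d := e * c / 8.
have e0 : 0 < e by rewrite lt_min eps0/=; lra.
have d0 : 0 < d by rewrite divr_gt0 ?mulr_gt0.
have [D [K [a [N1 [D0 look]]]]] := lookup_value k alpha_ge0 alpha_lt1 d0.
pose prog N0 := table_program N0 D%:Z (a K) D%:Z (table a K).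
(* The program is constant, so waiting for N to exceed its length makes the
   running time at most N, whatever the length is. *)
pose N0 := (N1 + Nc + 2 * k.+2 + size (prog 0%N))%N.
have progS : size (prog N0) = size (prog 0%N) by [].
pose P := prog N0.
pose Phi N M (beta : R) (F : kformula N M k.+2) : R :=
  output R (iter (size P) (step P beta) (init F)).
exists 4^-1, P, Phi; split; first by rewrite invr_gt0.
  move=> N M beta F.
  have [t [run small bounded _]] := table_program_run N0 D%:Z (a K) D%:Z (table a K) beta F.
  exists t; split=> // _; rewrite hornerD hornerX hornerC.
  have [/small/leq_trans|N0N] := leqP N N0; first by apply; exact: leq_addl.
  apply: leq_trans bounded _; rewrite -/(prog N0) progS.
  by apply: leq_trans (leq_addr _ _); apply: leq_trans (ltnW N0N); exact: leq_addl.
pose cst := expR (2 * k.+2%:R * k.+2%:R) / d ^+ 2.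
(* The value 1 makes the claim trivial on rejected inputs; beyond, beta^4 <= N turns beta^2 / N into
   1 / sqrt N. *)
exists (fun n => if (n <= N0)%N then 1 else cst / Num.sqrt n%:R); split.
  by apply: sqrt_decay_cvg; rewrite divr_ge0 ?expR_ge0 ?sqr_ge0.
move=> N beta b0 /(expr4_le_powR b0) b4.
have [_|N0N] := leqP N N0; first by rewrite subrr; exact: prob_kSAT_ge0.
have NR : 0 < N%:R :> R by rewrite ltr0n; exact: leq_ltn_trans N0N.
have N2k : (2 * k.+2 <= N)%N.
  by apply: leq_trans (ltnW N0N); rewrite /N0 addnAC leq_addl.
apply: le_trans (le_trans (density_whp alpha_ge0 alpha_lt1 N2k b0 d0) _).
  rewrite lerB// /cst -[leRHS]mulrA ler_wpM2l ?expR_ge0// invfM.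
  rewrite [beta ^+ 2 * _]mulrCA ler_wpM2l ?invr_ge0 ?sqr_ge0//.
  have b2 : beta ^+ 2 <= Num.sqrt N%:R.
    by rewrite -[leLHS]ger0_norm ?sqr_ge0// -sqrtr_sqr ler_wsqrtr// -exprM.
  rewrite -[X in _ / X <= _]sqr_sqrtr ?(ltW NR)// expr2 invfM mulrA ler_pdivrMr ?sqrtr_gt0//.
  by rewrite mulVf ?gt_eqF ?sqrtr_gt0// ler_pdivrMr ?sqrtr_gt0// mul1r.
apply: prob_kSAT_le => F.
move=> whp; set Z := ln _ in whp *.
have [t [_ _ _ PhiE]] := table_program_run N0 D%:Z (a K) D%:Z (table a K) beta F.
have := PhiE N0N; rewrite -/(prog N0) -/P -/(Phi _ _ beta F) => {}PhiE.
have N1N : (N1 < N)%N.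
  by apply: leq_ltn_trans N0N; rewrite /N0 -!addnA leq_addr.
have NcN : (Nc <= N)%N.
  by apply: leq_trans (ltnW N0N); rewrite /N0 -!addnA addnCA leq_addr.
have := look N beta N1N b0 b4.
rewrite (_ : _%:~R * N%:R / D%:R = Phi N _ beta F); last by rewrite PhiE.
have := pos N beta NcN b0 b4; move: whp.
set X := density _ _ _ _; set Y := Phi _ _ _ _.
rewrite !ler_norml => /andP[h1 h2] h3 /andP[h4 h5].
have e2 : e <= 2^-1 by rewrite ge_min lexx orbT.
have ee : e <= eps by rewrite ge_min lexx.
have dc : d * N%:R = e / 8 * (c * N%:R) by rewrite /d; lra.
have cN : 0 < c * N%:R by rewrite mulr_gt0.
rewrite -mulrA dc in h1 h2 h4 h5.
have Yc : c * N%:R <= 2 * Y by nra.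
have Ye : e * Y <= eps * Y by rewrite ler_wpM2r//; lra.
have Yd : e * (c * N%:R) <= e * (2 * Y) by rewrite ler_wpM2l// ltW.
by rewrite mulrBr mulrDr mulr1 [Y * eps]mulrC; apply/andP; split; lra.
Qed.
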